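(* Bipartite Contraction is fixed parameter tractable when parameterized by $k$.
   Context: In the Bipartite Contraction problem we are given a graph $G$ and an integer $k$, and the task is to determine whether there exists a set $S \subseteq E(G)$ of at most $k$ edges such that the graph $G/S$ obtained by contracting the edges of $S$ is bipartite. A problem with input $(G,k)$ is fixed parameter tractable if it can be solved in time $f(k)\, n^{O(1)}$ for some function $f$ depending only on $k$. *)

(* Defs.v *)
From mathcomp Require Import all_boot.
Set Implicit Arguments. Unset Strict Implicit. Unset Printing Implicit Defensive.

Definition simple_graph (n : nat) (e : rel 'I_n) : Prop :=
  symmetric e /\ irreflexive e.

(* An edge set: each undirected edge {x,y} is represented once, as the
   ordered pair (x,y) with x < y. *)
Definition is_edge_set (n : nat) (e : rel 'I_n) (S : {set 'I_n * 'I_n}) : Prop :=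
  forall p, p \in S -> (val p.1 < val p.2) && e p.1 p.2.

Definition srel (n : nat) (S : {set 'I_n * 'I_n}) : rel 'I_n :=
  fun x y => ((x, y) \in S) || ((y, x) \in S).

(* Contraction G/S: its vertices are the connected components of the
   spanning subgraph (V, S), represented by their canonical roots
   (fingraph's [root]); two distinct components are adjacent iff some
   edge of G joins them (edges inside a component disappear, parallel
   edges are merged). *)
Definition contr_vertex (n : nat) (S : {set 'I_n * 'I_n}) (v : 'I_n) : bool :=
  root (srel S) v == v.

Definition contr_adj (n : nat) (e : rel 'I_n) (S : {set 'I_n * 'I_n}) : rel 'I_n :=
  fun a b =>
    [&& contr_vertex S a, contr_vertex S b, a != b &
        [exists x, exists y,
           [&& e x y, root (srel S) x == a & root (srel S) y == b]]].

Definition contraction_bipartite (n : nat) (e : rel 'I_n) (S : {set 'I_n * 'I_n}) : Prop :=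
  exists col : 'I_n -> bool,
    forall a b, contr_vertex S a -> contr_vertex S b ->
      contr_adj e S a b -> col a != col b.

Definition BipartiteContraction (n : nat) (e : rel 'I_n) (k : nat) : Prop :=
  exists S : {set 'I_n * 'I_n},
    is_edge_set e S /\ #|S| <= k /\ contraction_bipartite e S.

Inductive sym := Blank | S0 | S1 | Hash.
Inductive dir := L | R | Stay.

(* A machine with m.+1 states, start state ord0; [delta] = None halts. *)
Record TM (m : nat) := {
  delta : 'I_m.+1 -> sym -> option ('I_m.+1 * sym * dir);
  accepting : 'I_m.+1 -> bool
}.

(* configuration: state, left tape (nearest cell first), head, right tape *)
Definition config (m : nat) : Type := ('I_m.+1 * seq sym * sym * seq sym)%type.

Definition move (l : seq sym) (h : sym) (r : seq sym) (d : dir)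
  : seq sym * sym * seq sym :=
  match d with
  | L => match l with
         | [::] => ([::], Blank, h :: r)
         | x :: l' => (l', x, h :: r)
         end
  | R => match r with
         | [::] => (h :: l, Blank, [::])
         | x :: r' => (h :: l, x, r')
         end
  | Stay => (l, h, r)
  end.

Definition step (m : nat) (M : TM m) (c : config m) : option (config m) :=
  let: (q, l, h, r) := c in
  match delta M q h with
  | None => None
  | Some (q', w, d) => let: (l', h', r') := move l w r d in Some (q', l', h', r')
  end.

Fixpoint run (m : nat) (M : TM m) (t : nat) (c : config m) : option (config m) :=
  match step M c with
  | None => Some c
  | Some c' => match t with
               | 0 => None
               | t'.+1 => run M t' c'
               end
  end.

Definition init (m : nat) (w : seq sym) : config m :=
  match w with
  | [::] => (ord0, [::], Blank, [::])
  | x :: w' => (ord0, [::], x, w')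
  end.

Definition cfg_state (m : nat) (c : config m) : 'I_m.+1 :=
  let: (q, _, _, _) := c in q.

Definition encode (n : nat) (e : rel 'I_n) (k : nat) : seq sym :=
  nseq n S1 ++ Hash ::
    [seq (if e i j then S1 else S0) | i <- enum 'I_n, j <- enum 'I_n]
    ++ Hash :: nseq k S1.

Definition BipartiteContraction_FPT : Prop :=
  exists (m : nat) (M : TM m) (f : nat -> nat) (c : nat),
    forall (n : nat) (e : rel 'I_n) (k : nat), simple_graph e ->
      exists cf, run M (f k * n.+1 ^ c) (init m (encode e k)) = Some cf /\
        (accepting M (cfg_state cf) <-> BipartiteContraction e k).

(* Main.v *)
(* Contracting at most k edges yields a bipartite graph iff some 2-coloring has a
   graph of monochromatic edges of rank at most k.  Such a coloring is maintained
   while the edges are inserted one at a time, so each repair starts from a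
   coloring c of rank at most k + 1.  The set D of vertices to be recolored is cut by
   at most Q = O(k^2) edges.  The repair coarsens an equivalence relation whose
   classes some D still respects.  As long as there are more than P classes, minimum
   cuts give a region U with at most 2 Q border edges that no cut of at most Q edges
   splits into two parts each having a connected piece of more than P classes.  One
   side of D inside U then has only pieces of at most P classes; those pieces that
   touch a terminal (a vertex on the border of U or on a monochromatic edge) have
   bounded total size, and the others may be moved to the other side of D.
   Growing a set from the terminals, with bits telling whether each vertex met is
   taken, thus produces that side from boundedly many bits, that is, from the number
   of a vertex once the graph is padded to N = tow k 6 + n vertices.  Only the trace
   on the border of U of the resulting components and their rank matter outside U, so
   one guess per behaviour suffices, and classes in U that these guesses do not tell
   apart are merged.  With at most P classes left, the guesses for U = V contain a
   solution.
   All this is a formula of first-order logic with iteration over the N vertices, and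
   a fixed formula is evaluated by a Turing machine in time polynomial in N. *)
From HB Require Import structures.
From Stdlib Require Import FunctionalExtensionality Classical.
Require Import Defs.
From mathcomp Require Import all_boot zify.
Set Implicit Arguments. Unset Strict Implicit. Unset Printing Implicit Defensive.

(** * Structured programs for Turing machines *)

(** A coloring of rank [k + 1] is worth having because it makes the change small: an edge between
    [D] and its complement is monochromatic either before or after the change, never both, and a
    graph of bounded rank has boundedly many edges. The set [D] itself may still be large, so no
    bounded guess describes it. Unbreakability leaves only small pieces on one side, and a small
    piece away from the terminals need not be guessed: it has no monochromatic edge, and moving it
    only repairs the edges that leave it. Progress is certain because the number of behaviours on a
    border of at most [2 Q] edges depends on [k] alone, while the region has more than [P] classes.
    The algorithm has no recursion. Every choice ranges over vertices and every state is a relation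
    of arity at most 3, so a single formula expresses it, and [k] enters only through four named
    elements and the size of the universe. This is why the exponent of the running time is
    independent of [k]. The constants are levels of one tower of exponentials, larger than the
    counting requires but easy to compute on a tape. *)

Definition sym_eqb (a b : sym) : bool :=
  match a, b with
  | Blank, Blank | S0, S0 | S1, S1 | Hash, Hash => true
  | _, _ => false
  end.

Lemma sym_eqP : Equality.axiom sym_eqb.
Proof. by case=> [] [] /=; constructor. Qed.

HB.instance Definition _ := hasDecEq.Build sym sym_eqP.

Definition tape : Type := (seq sym * sym * seq sym)%type.
Definition hd (t : tape) : sym := t.1.2.

Inductive prog :=
  | Act of (sym -> sym) & dir
  | Seq of prog & prog
  | If of (sym -> bool) & prog & prog
  | While of (sym -> bool) & prog.

Definition act (w : sym -> sym) (d : dir) (t : tape) : tape :=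
  let: (l, h, r) := t in move l (w h) r d.

Inductive Ex : prog -> tape -> tape -> nat -> Prop :=
  | ExAct w d t : Ex (Act w d) t (act w d t) 1
  | ExSeq p q t1 t2 t3 a b : Ex p t1 t2 a -> Ex q t2 t3 b -> Ex (Seq p q) t1 t3 (a + b)
  | ExIfT (a : sym -> bool) p q t1 t2 n : a (hd t1) -> Ex p t1 t2 n -> Ex (If a p q) t1 t2 n.+1
  | ExIfF (a : sym -> bool) p q t1 t2 n : ~~ a (hd t1) -> Ex q t1 t2 n -> Ex (If a p q) t1 t2 n.+1
  | ExWhF (a : sym -> bool) p t : ~~ a (hd t) -> Ex (While a p) t t 1
  | ExWhT (a : sym -> bool) p t1 t2 t3 m n : a (hd t1) -> Ex p t1 t2 m -> Ex (While a p) t2 t3 n ->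
      Ex (While a p) t1 t3 (m + n).+1.

Fixpoint plen (p : prog) : nat :=
  match p with
  | Act _ _ => 1
  | Seq p q => plen p + plen q
  | If _ p q => (plen p + plen q).+1
  | While _ p => (plen p).+1
  end.

Definition instr : Type := sym -> nat * sym * dir.

(* Code for [p] placed at states [b], [b + 1], ..., leaving to state [e]. *)
Fixpoint code (p : prog) (b e : nat) : seq instr :=
  match p with
  | Act w d => [:: fun s => (e, w s, d)]
  | Seq p q => code p b (b + plen p) ++ code q (b + plen p) e
  | If a p q => (fun s => (if a s then b.+1 else b.+1 + plen p, s, Stay))
                :: code p b.+1 e ++ code q (b.+1 + plen p) e
  | While a p => (fun s => (if a s then b.+1 else e, s, Stay)) :: code p b.+1 b
  end.

Lemma size_code p b e : size (code p b e) = plen p.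
Proof.
elim: p b e => [w d|p IHp q IHq|a p IHp q IHq|a p IHp] b e //=;
  by rewrite ?size_cat ?IHp ?IHq.
Qed.

Definition dflt_instr : instr := fun s => (0, s, Stay).

Definition mstep (cd : seq instr) (c : nat * tape) : nat * tape :=
  let: (q', w, d) := nth dflt_instr cd c.1 (hd c.2) in (q', act (fun=> w) d c.2).

Inductive Reach (cd : seq instr) : nat -> nat * tape -> nat * tape -> Prop :=
  | Reach0 c : Reach cd 0 c c
  | ReachS n c c' : c.1 < size cd -> Reach cd n (mstep cd c) c' -> Reach cd n.+1 c c'.

Lemma Reach_trans cd m n c1 c2 c3 :
  Reach cd m c1 c2 -> Reach cd n c2 c3 -> Reach cd (m + n) c1 c3.
Proof. by elim=> [//|{}m c c' lt_c _ IH] /IH; rewrite addSn; apply: ReachS. Qed.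

(** Jumps are absolute, so code is never relocated: a subprogram occurs in the whole code exactly as
    generated for its own start and exit states. *)
Definition placed (p : prog) (b e : nat) (cd : seq instr) : Prop :=
  b + plen p <= size cd /\
  forall i, i < plen p -> nth dflt_instr cd (b + i) = nth dflt_instr (code p b e) i.

Lemma Reach_Ex p t t' n : Ex p t t' n ->
  forall b e cd, placed p b e cd -> Reach cd n (b, t) (e, t').
Proof.
elim=> {p t t' n}.
- move=> w d t b e cd [/= sz /(_ 0 isT)]; rewrite addn0 /= => eq_b.
  apply: ReachS; first by rewrite /=; lia.
  rewrite /mstep /= eq_b /act; case: t => [[l h] r] /=; exact: Reach0.
- move=> p q t1 t2 t3 m n _ IHp _ IHq b e cd [/= sz eq_cd].
  apply: (Reach_trans (IHp b (b + plen p) cd _) (IHq _ _ _ _)).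
    split=> [|i lt_i]; first lia.
    by rewrite eq_cd; [rewrite nth_cat size_code lt_i|lia].
  split=> [|i lt_i]; first lia.
  rewrite -addnA eq_cd; last lia.
  by rewrite nth_cat size_code ltnNge leq_addr /= addKn.
- move=> a p q t1 t2 n a1 _ IH b e cd [/= sz eq_cd].
  apply: ReachS; first by rewrite /=; lia.
  have := eq_cd 0 isT; rewrite addn0 /= => eq_b.
  rewrite /mstep /= eq_b a1; case: t1 a1 IH => [[l h] r] /= a1 IH.
  apply: IH; split=> [|i lt_i]; first lia.
  rewrite addSnnS eq_cd; last lia.
  by rewrite /= nth_cat size_code lt_i.
- move=> a p q t1 t2 n a1 _ IH b e cd [/= sz eq_cd].
  apply: ReachS; first by rewrite /=; lia.
  have := eq_cd 0 isT; rewrite addn0 /= => eq_b.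
  rewrite /mstep /= eq_b (negbTE a1); case: t1 a1 IH => [[l h] r] /= a1 IH.
  apply: IH; split=> [|i lt_i]; first lia.
  rewrite (_ : b.+1 + plen p + i = b + (plen p + i).+1); last lia.
  rewrite eq_cd; last lia.
  by rewrite /= nth_cat size_code ltnNge leq_addr /= addKn.
- move=> a p t a1 b e cd [/= sz eq_cd].
  apply: ReachS; first by rewrite /=; lia.
  have := eq_cd 0 isT; rewrite addn0 /= => eq_b.
  rewrite /mstep /= eq_b (negbTE a1); case: t a1 => [[l h] r] /= _; exact: Reach0.
- move=> a p t1 t2 t3 m n a1 _ IHp _ IHw b e cd pl; have [/= sz eq_cd] := pl.
  apply: ReachS; first by rewrite /=; lia.
  have := eq_cd 0 isT; rewrite addn0 /= => eq_b.
  rewrite /mstep /= eq_b a1; case: t1 a1 IHp => [[l h] r] /= a1 IHp.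
  apply: Reach_trans (IHw _ _ _ pl); apply: IHp; split=> [|i lt_i]; first lia.
  by rewrite addSnnS eq_cd //; lia.
Qed.

(** * The machine of a program *)

Section Machine.
Variable p : prog.

(** State [plen p] is the exit of the program. From there one extra step leads to [ord_max], the
    only accepting state, when the scanned symbol is [S1]; the verdict is thus the symbol under the
    head at the end. *)
Definition pdelta (q : 'I_(plen p).+2) (s : sym) : option ('I_(plen p).+2 * sym * dir) :=
  if q < plen p then
    let: (q', w, d) := nth dflt_instr (code p 0 (plen p)) q s in Some (inord q', w, d)
  else if (q == plen p :> nat) && (s == S1) then Some (ord_max, s, Stay) else None.

Definition pTM : TM (plen p).+1 :=
  {| delta := pdelta; accepting := fun q => q == ord_max |}.

(** Keeps all jumps within the states up to [plen p], so that [inord] in [pdelta] loses nothing. *)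
Lemma code_target p' b e i s : b + plen p' <= plen p -> e <= plen p -> i < plen p' ->
  (nth dflt_instr (code p' b e) i s).1.1 <= plen p.
Proof.
elim: p' b e i => [w d|p1 IH1 p2 IH2|a p1 IH1 p2 IH2|a p1 IH1] b e i /= sz le_e.
- by case: i.
- move=> lt_i; rewrite nth_cat size_code; case: ltnP => le_i.
    by apply: IH1 => //; lia.
  by apply: IH2 => //; lia.
- case: i => [_|i lt_i] /=; first by case: ifP => _ /=; lia.
  rewrite nth_cat size_code; case: ltnP => le_i.
    by apply: IH1 => //; lia.
  by apply: IH2 => //; lia.
- case: i => [_|i lt_i] /=; first by case: ifP => _ /=; lia.
  by apply: IH1 => //; lia.
Qed.

Definition cfg_of (c : nat * tape) : config (plen p).+1 :=
  let: (l, h, r) := c.2 in (inord c.1, l, h, r).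

(** The strict bound on [n] leaves one unit of fuel for the accepting step. *)
Lemma run_Reach n c c' fuel : c.1 <= plen p ->
  Reach (code p 0 (plen p)) n c c' ->
  c'.1 = plen p -> n < fuel ->
  exists2 cf, run pTM fuel (cfg_of c) = Some cf &
    accepting pTM (cfg_state cf) = (hd c'.2 == S1).
Proof.
move=> le_c reach; elim: reach fuel le_c => {n c c'} [c|n c c' lt_c _ IH] fuel le_c.
  case: c le_c => q [[l h] r] /= _ -> lt_f; case: fuel lt_f => // fuel _.
  rewrite /= /pdelta inordK // ltnn eqxx /=; case: eqP => [->|] /=.
    exists (ord_max, l, S1, r); last by rewrite /= eqxx.
    by case: fuel => [|fuel] /=; rewrite /pdelta /= ltnNge leqnSn /= eqn_leq ltnn.
  by move=> _; exists (inord (plen p), l, h, r) => //=; rewrite -val_eqE /= inordK // eqn_leq ltnn andbF.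
case: c lt_c le_c IH => q [[l h] r]; rewrite size_code /= => lt_q le_c IH c'1.
case: fuel => // fuel lt_n.
have := IH fuel; rewrite /mstep /=.
have := @code_target p 0 (plen p) q h (leqnn _) (leqnn _) lt_q.
rewrite /pdelta inordK ?lt_q; last lia.
case: (nth _ _ _ _) => [[q' w] d] /= le_q' {}IH.
have {IH} := IH le_q' c'1 lt_n.
rewrite /cfg_of /act /=; case: (move l w r d) => [[l1 h1] r1] //=.
Qed.

End Machine.

(** * Storing variables and bit arrays on tracks of the tape *)

Definition upd (A : Type) (f : nat -> A) (m : nat) (a : A) : nat -> A :=
  fun j => if j == m then a else f j.

(* The tape is seen as a half-tape [f] growing to the left, with position 0
   at the origin cell; [r] is what lies to the right of the origin. *)
Definition At (f : nat -> sym) (m : nat) (r : seq sym) (t : tape) : Prop :=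
  let: (l, h, r') := t in
  [/\ h = f m, forall j, nth Blank l j = f (m + j).+1 & r' = rev (mkseq f m) ++ r].

Lemma At_L f m r t : At f m r t -> At f m.+1 r (act id L t).
Proof.
case: t => [[l h] r'] [-> l_f ->].
have -> : act id L (l, f m, rev (mkseq f m) ++ r)
  = (behead l, head Blank l, f m :: rev (mkseq f m) ++ r) by case: (l).
split; first by rewrite -nth0 l_f addn0.
- by move=> j; rewrite nth_behead l_f addnS.
- by rewrite mkseqS rev_rcons.
Qed.

Lemma At_R f m r t : At f m.+1 r t -> At f m r (act id R t).
Proof.
case: t => [[l h] r'] [-> l_f ->]; rewrite /act /= mkseqS rev_rcons /=.
by split=> //; case=> [|j] /=; rewrite ?addn0 // l_f addnS.
Qed.

Lemma At_W f m r t s : At f m r t -> At (upd f m s) m r (act (fun=> s) Stay t).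
Proof.
case: t => [[l h] r'] [-> l_f ->]; rewrite /act /= /upd.
split=> [|j|]; first by rewrite eqxx.
  by rewrite l_f; case: eqP => //; lia.
congr (rev _ ++ _); apply/eq_in_map => j; rewrite mem_iota /= => lt_j.
by case: eqP => // ?; lia.
Qed.

Definition wpa (p : prog) (T : nat) (Q : (nat -> sym) -> nat -> seq sym -> Prop) f m r : Prop :=
  forall t, At f m r t -> exists t' n f' m' r',
    [/\ n <= T, Ex p t t' n, At f' m' r' t' & Q f' m' r'].

Lemma wpa_mono p T T' (Q Q' : _ -> _ -> _ -> Prop) f m r :
  T <= T' -> (forall f m r, Q f m r -> Q' f m r) -> wpa p T Q f m r -> wpa p T' Q' f m r.
Proof.
move=> le_T QQ wpQ t /wpQ [t' [n [f' [m' [r' [le_n ex at' Qf]]]]]].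
by exists t', n, f', m', r'; split=> //; [apply: leq_trans le_T|apply: QQ].
Qed.

Lemma wpa_le p T T' Q f m r : T <= T' -> wpa p T Q f m r -> wpa p T' Q f m r.
Proof. by move=> le_T; apply: wpa_mono. Qed.

Definition ML := Act id L.
Definition MR := Act id R.
Definition Wr s := Act (fun=> s) Stay.

Lemma wpa_ML (Q : _ -> _ -> _ -> Prop) f m r : Q f m.+1 r -> wpa ML 1 Q f m r.
Proof.
move=> Qf t at_t; exists (act id L t), 1, f, m.+1, r; split=> //; first exact: ExAct.
exact: At_L.
Qed.

Lemma wpa_MR (Q : _ -> _ -> _ -> Prop) f m r : Q f m r -> wpa MR 1 Q f m.+1 r.
Proof.
move=> Qf t at_t; exists (act id R t), 1, f, m, r; split=> //; first exact: ExAct.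
exact: At_R.
Qed.

Lemma wpa_Wr s (Q : _ -> _ -> _ -> Prop) f m r : Q (upd f m s) m r -> wpa (Wr s) 1 Q f m r.
Proof.
move=> Qf t at_t; exists (act (fun=> s) Stay t), 1, (upd f m s), m, r; split=> //.
  exact: ExAct.
exact: At_W.
Qed.

Lemma wpa_seq p q T1 T2 Q f m r :
  wpa p T1 (fun f m r => wpa q T2 Q f m r) f m r -> wpa (Seq p q) (T1 + T2) Q f m r.
Proof.
move=> wp_p t /wp_p [t1 [n1 [f1 [m1 [r1 [le1 ex1 at1 /(_ _ at1)]]]]]].
case=> t2 [n2 [f2 [m2 [r2 [le2 ex2 at2 Q2]]]]].
exists t2, (n1 + n2), f2, m2, r2; split=> //; [lia|exact: ExSeq ex1 ex2].
Qed.

Lemma At_hd f m r t : At f m r t -> hd t = f m.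
Proof. by case: t => [[l h] r'] []. Qed.

Lemma wpa_if (a : sym -> bool) p q T Q f m r :
  (a (f m) -> wpa p T Q f m r) -> (~~ a (f m) -> wpa q T Q f m r) ->
  wpa (If a p q) T.+1 Q f m r.
Proof.
move=> wpT wpF t at_t; have hd_t := At_hd at_t.
have [a_h|a_h] := boolP (a (f m)).
  have [t' [n [f' [m' [r' [le_n ex at' Q']]]]]] := wpT a_h _ at_t.
  by exists t', n.+1, f', m', r'; split=> //; apply: ExIfT; rewrite ?hd_t.
have [t' [n [f' [m' [r' [le_n ex at' Q']]]]]] := wpF a_h _ at_t.
by exists t', n.+1, f', m', r'; split=> //; apply: ExIfF; rewrite ?hd_t.
Qed.

Lemma wpa_while (a : sym -> bool) p T n (I : nat -> (nat -> sym) -> nat -> seq sym -> Prop)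
    (Q : _ -> _ -> _ -> Prop) f m r :
  I 0 f m r ->
  (forall i f m r, i < n -> I i f m r -> a (f m) /\ wpa p T (I i.+1) f m r) ->
  (forall f m r, I n f m r -> ~~ a (f m) /\ Q f m r) ->
  wpa (While a p) (n * T.+1).+1 Q f m r.
Proof.
move=> I0 IS In.
suff main d i f1 m1 r1 : i + d = n -> I i f1 m1 r1 ->
    wpa (While a p) (d * T.+1).+1 Q f1 m1 r1 by exact: (main n 0).
elim: d i f1 m1 r1 => [|d IH] i f1 m1 r1 i_n Ii t at_t; have hd_t := At_hd at_t.
  rewrite addn0 in i_n; rewrite i_n in Ii; have [a_h Qf] := In _ _ _ Ii.
  by exists t, 1, f1, m1, r1; split=> //; apply: ExWhF; rewrite hd_t.
have [|a_h] := IS i f1 m1 r1 _ Ii; first lia.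
move=> /(_ _ at_t) [t2 [n2 [f2 [m2 [r2 [le2 ex2 at2 I2]]]]]].
have [|t3 [n3 [f3 [m3 [r3 [le3 ex3 at3 Q3]]]]]] := IH i.+1 _ _ _ _ I2 _ at2; first lia.
exists t3, (n2 + n3).+1, f3, m3, r3; split=> //; last by apply: ExWhT ex2 ex3; rewrite ?hd_t.
lia.
Qed.

Fixpoint pow (p : prog) (n : nat) : prog :=
  if n is n'.+1 then Seq p (pow p n') else Act id Stay.

Lemma wpa_nop (Q : _ -> _ -> _ -> Prop) f m r : Q f m r -> wpa (Act id Stay) 1 Q f m r.
Proof.
move=> Qf t at_t; exists t, 1, f, m, r; split=> //.
by have := ExAct id Stay t; rewrite /act; case: t {at_t} => [[l h] r'].
Qed.

Lemma wpa_MLn n (Q : _ -> _ -> _ -> Prop) f m r :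
  Q f (m + n) r -> wpa (pow ML n) n.+1 Q f m r.
Proof.
elim: n m => [|n IH] m Qf /=; first by apply: wpa_nop; rewrite addn0 in Qf.
rewrite -[n.+2]add1n; apply: wpa_seq; apply: wpa_ML; apply: IH.
by rewrite addSnnS.
Qed.

Lemma wpa_MRn n (Q : _ -> _ -> _ -> Prop) f m r :
  Q f m r -> wpa (pow MR n) n.+1 Q f (m + n) r.
Proof.
elim: n => [|n IH] Qf /=; first by apply: wpa_nop; rewrite addn0.
rewrite -[n.+2]add1n [m + _]addnS; apply: wpa_seq; apply: wpa_MR; exact: IH.
Qed.

Definition home := While (fun s => s != Hash) MR.

Lemma wpa_home (Q : _ -> _ -> _ -> Prop) f m r : f 0 = Hash -> (forall j, f j.+1 != Hash) ->
  Q f 0 r -> wpa home (2 * m).+1 Q f m r.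
Proof.
move=> f0 fS Qf; rewrite mulnC.
apply: (@wpa_while _ _ 1 m (fun i f1 m1 r1 => [/\ f1 = f, m1 = m - i & r1 = r])).
- by rewrite subn0.
- move=> i f1 m1 r1 lt_i [-> -> ->].
  have -> : m - i = (m - i.+1).+1 by lia.
  by split=> //; apply: wpa_MR.
- by move=> f1 m1 r1 [-> -> ->]; rewrite subnn f0.
Qed.

Record store := Store { vals : nat -> nat; arrs : nat -> nat -> bool }.

Definition setval (s : store) (x v : nat) : store := Store (upd (vals s) x v) (arrs s).
Definition setarr (s : store) (a i : nat) (b : bool) : store :=
  Store (vals s) (upd (arrs s) a (upd (arrs s a) i b)).

(* Track [2 x] carries the variable [x], as a single mark at its value, and
   track [2 a + 1] the bit array [a]. *)
Definition cell (s : store) (c i : nat) : bool :=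
  if odd c then arrs s c./2 i else i == vals s c./2.

Section Store.

(* Block [i] of the half-tape holds the [i]th bit of each of the [w] tracks. *)
Variable w : nat.

(** Any symbol other than [S1] counts as the bit false, so blank cells need no initialisation. The
    only [Hash] is at position 0, where [home] stops. *)
Definition rep (f : nat -> sym) (s : store) : Prop :=
  [/\ f 0 = Hash, forall j, f j.+1 != Hash &
      forall c i, c < w -> (f (w * i + c).+1 == S1) = cell s c i].

Definition wp (p : prog) (T : nat) (Q : store -> seq sym -> Prop) (s : store) (r : seq sym) :=
  forall f, rep f s ->
    wpa p T (fun f' m' r' => m' = 0 /\ exists2 s', rep f' s' & Q s' r') f 0 r.

Lemma wp_mono p T T' (Q Q' : store -> seq sym -> Prop) s r :
  T <= T' -> (forall s r, Q s r -> Q' s r) -> wp p T Q s r -> wp p T' Q' s r.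
Proof.
move=> le_T QQ wpQ f rep_f; apply: wpa_mono (wpQ f rep_f) => // f1 m1 r1 [-> [s1 rep1 Q1]].
by split=> //; exists s1; last exact: QQ.
Qed.

Lemma wp_le p T T' Q s r : T <= T' -> wp p T Q s r -> wp p T' Q s r.
Proof. by move=> le_T; apply: wp_mono. Qed.

Lemma wp_seq p q T1 T2 Q s r :
  wp p T1 (fun s r => wp q T2 Q s r) s r -> wp (Seq p q) (T1 + T2) Q s r.
Proof.
move=> wp_p f rep_f; apply: wpa_seq; apply: wpa_mono (wp_p _ rep_f) => // f1 m1 r1 [-> [s1 rep1]].
exact.
Qed.

Definition find x := Seq (pow ML x.*2.+1) (While (fun s => s != S1) (pow ML w)).

Definition goto (c d : nat) := if c <= d then pow ML (d - c) else pow MR (c - d).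

Lemma wpa_find x (Q : _ -> _ -> _ -> Prop) f s r : x.*2 < w -> rep f s ->
  Q f (w * vals s x + x.*2).+1 r -> wpa (find x) (w.+2 * (vals s x).+2) Q f 0 r.
Proof.
move=> lt_x [f0 fS f_s] Qf.
apply: (@wpa_le _ (x.*2.+2 + ((vals s x) * w.+2).+1)) => //; first nia.
apply: wpa_seq; apply: wpa_MLn; rewrite add0n.
have f_cell i : (f (w * i + x.*2).+1 == S1) = (i == vals s x).
  by rewrite f_s // /cell odd_double doubleK.
apply: (@wpa_while _ _ _ _
  (fun i f1 m1 r1 => [/\ f1 = f, m1 = (w * i + x.*2).+1 & r1 = r])).
- by rewrite muln0.
- move=> i f1 m1 r1 lt_i [-> -> ->]; rewrite f_cell; split; first by lia.
  by apply: wpa_MLn; split=> //; lia.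
- by move=> f1 m1 r1 [-> -> ->]; rewrite f_cell eqxx.
Qed.

Lemma wpa_goto c d v (Q : _ -> _ -> _ -> Prop) f r : c < w -> d < w ->
  Q f (v + d) r -> wpa (goto c d) w.+1 Q f (v + c) r.
Proof.
move=> lt_c lt_d Qf; rewrite /goto; case: leqP => le_cd.
  apply: (wpa_mono _ _ (wpa_MLn (Q := Q) _)) => [|//|]; first by rewrite ltnS; lia.
  by rewrite -addnA subnKC.
have -> : v + c = v + d + (c - d) by lia.
by apply: (wpa_mono _ _ (wpa_MRn (Q := Q) Qf)) => //; lia.
Qed.

(* An upper bound for the cost of a store operation on a variable of value at most [v]. *)
Definition pc (v : nat) := 10 * (w.+2 * v.+3).

Definition at_cell c x := Seq (find x) (goto x.*2 c).

Lemma wpa_at_cell c x (Q : _ -> _ -> _ -> Prop) f s r : x.*2 < w -> c < w -> rep f s ->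
  Q f (w * vals s x + c).+1 r -> wpa (at_cell c x) (w.+2 * (vals s x).+3) Q f 0 r.
Proof.
move=> lt_x lt_c rep_f Qf; apply: (@wpa_le _ (w.+2 * (vals s x).+2 + w.+1)) => //; first nia.
apply: wpa_seq; apply: wpa_find (lt_x) rep_f _.
by rewrite -addSn in Qf; rewrite -addSn; apply: wpa_goto Qf.
Qed.

Lemma rep_home f s m r (Q : store -> seq sym -> Prop) : rep f s -> Q s r ->
  wpa home (2 * m).+1 (fun f' m' r' => m' = 0 /\ exists2 s', rep f' s' & Q s' r') f m r.
Proof.
by move=> rep_f Qs; have [f0 fS _] := rep_f; apply: wpa_home => //; split=> //; exists s.
Qed.

Definition Put a x b := Seq (at_cell a.*2.+1 x) (Seq (Wr (if b then S1 else S0)) home).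

Lemma rep_eqpos i c j d : c < w -> d < w -> ((w * i + c).+1 == (w * j + d).+1) = (i == j) && (c == d).
Proof.
move=> lt_c lt_d; rewrite eqSS; apply/idP/idP => [/eqP eq_ij|/andP[/eqP-> /eqP->] //].
have: (w * i + c) %/ w = (w * j + d) %/ w by rewrite eq_ij.
have w0 : 0 < w by lia.
rewrite ![w * _]mulnC !divnMDl // !divn_small // !addn0 => ->; rewrite eqxx /=.
have: (w * i + c) %% w = (w * j + d) %% w by rewrite eq_ij.
by rewrite ![w * _]mulnC !modnMDl !modn_small // => ->.
Qed.

Lemma rep_upd f s s' i c (b : bool) : c < w -> rep f s ->
  (forall d j, d < w -> cell s' d j = if (j == i) && (d == c) then b else cell s d j) ->
  rep (upd f (w * i + c).+1 (if b then S1 else S0)) s'.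
Proof.
move=> lt_c [f0 fS f_s] s'_s; split=> [|j|d j lt_d]; rewrite /upd; first by [].
  by case: ifP => _; [case: (b)|exact: fS].
by rewrite rep_eqpos // s'_s //; case: ifP => _; [case: (b)|exact: f_s].
Qed.

Lemma wp_put a x b (Q : store -> seq sym -> Prop) s r : x.*2 < w -> a.*2.+1 < w ->
  Q (setarr s a (vals s x) b) r -> wp (Put a x b) (pc (vals s x)) Q s r.
Proof.
move=> lt_x lt_a Qs f rep_f.
apply: (@wpa_le _ (w.+2 * (vals s x).+3 + (1 + (2 * (w * vals s x + a.*2.+1).+1).+1))) => //.
  by rewrite /pc; nia.
apply: wpa_seq; apply: (wpa_at_cell _ _ rep_f) => //; apply: wpa_seq; apply: wpa_Wr.
apply: (@rep_home _ (setarr s a (vals s x) b)) => //.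
apply: (rep_upd _ rep_f) => // d j lt_d; rewrite /cell /setarr /upd /=.
case: (boolP (odd d)) => odd_d; last first.
  have /negbTE-> : d != a.*2.+1 by apply: contraNneq odd_d => ->; rewrite /= odd_double.
  by rewrite andbF.
have -> : (d == a.*2.+1) = (d./2 == a).
  apply/eqP/eqP => [->|<-]; first by rewrite /= uphalf_double.
  by rewrite -[LHS]odd_double_half odd_d.
by case: eqP => [->|]; rewrite ?andbF ?andbT.
Qed.

Lemma cell_setval s x v d j :
  cell (setval s x v) d j = if d == x.*2 then j == v else cell s d j.
Proof.
rewrite /cell /setval /upd /=; case: (boolP (odd d)) => odd_d.
  have /negbTE-> // : d != x.*2 by apply: contraTneq odd_d => ->; rewrite odd_double.
have -> : (d == x.*2) = (d./2 == x); last by case: (d./2 == x).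
apply/eqP/eqP => [->|<-]; first by rewrite doubleK.
by rewrite -[LHS]odd_double_half (negbTE odd_d).
Qed.

Lemma cell_val s x j : cell s x.*2 j = (j == vals s x).
Proof. by rewrite /cell odd_double doubleK. Qed.

Lemma cell_arr s a j : cell s a.*2.+1 j = arrs s a j.
Proof. by rewrite /cell /= odd_double /= uphalf_double. Qed.

Definition Inc x := Seq (find x) (Seq (Wr S0) (Seq (pow ML w) (Seq (Wr S1) home))).

Lemma wp_inc x (Q : store -> seq sym -> Prop) s r : x.*2 < w ->
  Q (setval s x (vals s x).+1) r -> wp (Inc x) (pc (vals s x)) Q s r.
Proof.
move=> lt_x Qs f rep_f; set v := vals s x.
apply: (@wpa_le _ (w.+2 * v.+2 + (1 + (w.+1 + (1 + (2 * (w * v + x.*2 + w).+1).+1))))).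
  by rewrite /pc; nia.
apply: wpa_seq; apply: wpa_find (lt_x) (rep_f) _; apply: wpa_seq; apply: wpa_Wr.
apply: wpa_seq; apply: wpa_MLn; apply: wpa_seq; apply: wpa_Wr.
rewrite -/v (_ : (w * v + x.*2).+1 + w = (w * v.+1 + x.*2).+1); last by rewrite mulnS; lia.
rewrite (_ : w * v + x.*2 + w = w * v.+1 + x.*2); last by rewrite mulnS; lia.
apply: (@rep_home _ (setval s x v.+1)) => //; have [f0 fS f_s] := rep_f.
split=> [|j|d j lt_d]; rewrite /upd; first by [].
  by do 2?case: ifP.
rewrite !rep_eqpos // cell_setval.
case: (d =P x.*2) => [->|ne_d]; last by rewrite !andbF f_s.
by rewrite !andbT; case: (j =P v.+1) => // _; case: (j =P v) => // ne_j; rewrite f_s // cell_val; case: eqP.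
Qed.

(** The old mark of [y] is erased first, since the track of a variable has to carry a single
    mark. *)
Definition Cpy y x :=
  Seq (find y) (Seq (Wr S0) (Seq home (Seq (at_cell y.*2 x) (Seq (Wr S1) home)))).

Lemma wp_cpy y x (Q : store -> seq sym -> Prop) s r : x.*2 < w -> y.*2 < w -> x != y ->
  Q (setval s y (vals s x)) r -> wp (Cpy y x) (pc (vals s x) + pc (vals s y)) Q s r.
Proof.
move=> lt_x lt_y ne_xy Qs f rep_f; set v := vals s x; set u := vals s y.
apply: (@wpa_le _ (w.+2 * u.+2 + (1 + ((2 * (w * u + y.*2).+1).+1 +
   (w.+2 * v.+3 + (1 + (2 * (w * v + y.*2).+1).+1)))))).
  by rewrite /pc; nia.
have [f0 fS f_s] := rep_f.
apply: wpa_seq; apply: wpa_find (lt_y) (rep_f) _; apply: wpa_seq; apply: wpa_Wr.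
apply: wpa_seq; set g := upd _ _ _.
have g0 : g 0 = Hash by [].
have gS j : g j.+1 != Hash by rewrite /g /upd; case: ifP.
have g_s d j : d < w -> (g (w * j + d).+1 == S1) = cell s d j && ((j != u) || (d != y.*2)).
  move=> lt_d; rewrite /g /upd rep_eqpos //.
  by case: (j =P u); case: (d =P y.*2); rewrite ?andbT ?andbF //= f_s.
apply: wpa_home => //; apply: wpa_seq.
(* With the mark of [y] erased the tape represents no store, so [wpa_at_cell] does not apply and the
   search for the mark of [x] is redone on [g]. *)
apply: (@wpa_le _ (w.+2 * v.+2 + w.+1)); first nia.
apply: wpa_seq; apply: (@wpa_le _ (x.*2.+2 + (v * w.+2).+1)); first nia.
apply: wpa_seq; apply: wpa_MLn; rewrite add0n.
apply: (@wpa_while _ _ _ _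
  (fun i f1 m1 r1 => [/\ f1 = g, m1 = (w * i + x.*2).+1 & r1 = r])).
- by rewrite muln0.
- move=> i f1 m1 r1 lt_i [-> -> ->]; rewrite g_s // cell_val -/v; split; first by lia.
  by apply: wpa_MLn; split=> //; lia.
- move=> f1 m1 r1 [-> -> ->]; rewrite g_s // cell_val eqxx /= (_ : _ != y.*2); last by lia.
  rewrite orbT; split=> //; rewrite -[(w * v + x.*2).+1]addSn; apply: wpa_goto => //; rewrite [_.+1 + y.*2]addSn.
  apply: wpa_seq; apply: wpa_Wr; apply: (@rep_home _ (setval s y v)) => //.
  split=> [|j|d j lt_d]; rewrite /upd; first by [].
    by case: ifP.
  rewrite rep_eqpos // cell_setval -/v.
  case: (d =P y.*2) => [->|ne_d]; last first.
    by rewrite !andbF g_s // (_ : d != y.*2) ?orbT ?andbT //; apply/eqP.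
  rewrite !andbT; case: (j =P v) => // ne_j; rewrite g_s // eqxx orbF cell_val -/u.
  by case: eqP.
Qed.

(** On an even track [y.*2] this tests whether the variables [x] and [y] are equal; on an odd track
    it reads the bit of an array at index [x]. *)
Definition Test c x p q :=
  Seq (at_cell c x) (If (fun s => s == S1) (Seq home p) (Seq home q)).

Lemma wp_test c x p q T (Q : store -> seq sym -> Prop) s r : x.*2 < w -> c < w ->
  (cell s c (vals s x) -> wp p T Q s r) -> (~~ cell s c (vals s x) -> wp q T Q s r) ->
  wp (Test c x p q) (pc (vals s x) + T) Q s r.
Proof.
move=> lt_x lt_c wpT wpF f rep_f; set v := vals s x.
apply: (@wpa_le _ (w.+2 * v.+3 + ((2 * (w * v + c).+1).+1 + T).+1)).
  by rewrite /pc; nia.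
have [f0 fS f_s] := rep_f.
apply: wpa_seq; apply: (wpa_at_cell _ _ rep_f) => //; apply: wpa_if; rewrite f_s // => c_v.
  by apply: wpa_seq; apply: wpa_home => //; apply: wpT.
by apply: wpa_seq; apply: wpa_home => //; apply: wpF.
Qed.

Definition Until c x p :=
  Seq (at_cell c x) (Seq (While (fun s => s != S1) (Seq home (Seq p (at_cell c x)))) home).

Lemma wp_until c x p T n B (I : nat -> store -> seq sym -> Prop) (Q : store -> seq sym -> Prop) s r :
  x.*2 < w -> c < w ->
  I 0 s r ->
  (forall i s r, i < n -> I i s r -> [/\ vals s x <= B, ~~ cell s c (vals s x) & wp p T (I i.+1) s r]) ->
  (forall s r, I n s r -> [/\ vals s x <= B, cell s c (vals s x) & Q s r]) ->
  wp (Until c x p) (n.+1 * (T + pc B)) Q s r.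
Proof.
move=> lt_x lt_c I0 IS In f rep_f.
have le_B i s1 r1 : i <= n -> I i s1 r1 -> vals s1 x <= B.
  rewrite leq_eqVlt; case: eqP => [-> _ /In[]|_ /= lt_i Ii] //.
  by have [] := IS i s1 r1 lt_i Ii.
have step i s1 r1 f1 : i <= n -> I i s1 r1 -> rep f1 s1 ->
  wpa (at_cell c x) (w.+2 * B.+3) (fun f' m' r' => exists2 s', rep f' s' &
    [/\ I i s' r', m' = (w * vals s' x + c).+1 & vals s' x <= B]) f1 0 r1.
  move=> le_i Ii rep1; apply: (@wpa_le _ (w.+2 * (vals s1 x).+3)).
    by have := le_B _ _ _ le_i Ii; nia.
  by apply: (wpa_at_cell _ _ rep1) => //; exists s1; last by split=> //; apply: le_B Ii.
pose T1 := (2 * (w * B + c).+1).+1 + (T + w.+2 * B.+3).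
apply: (@wpa_le _ (w.+2 * B.+3 + ((n * T1.+1).+1 + (2 * (w * B + c).+1).+1))).
  by rewrite /pc /T1; nia.
apply: wpa_seq; apply: wpa_mono (step 0 s r f _ I0 rep_f) => // f1 m1 r1 I1.
apply: wpa_seq; apply: (@wpa_while _ _ _ n (fun i f' m' r' => exists2 s', rep f' s' &
    [/\ I i s' r', m' = (w * vals s' x + c).+1 & vals s' x <= B])) => //.
- move=> i f2 m2 r2 lt_i [s2 rep2 [I2 -> le2]]; have [_ c2 wp2] := IS _ _ _ lt_i I2.
  have [f0 fS f_s] := rep2; rewrite f_s //; split=> //.
  rewrite /T1; apply: wpa_seq; apply: (@wpa_le _ (2 * (w * vals s2 x + c).+1).+1); first nia.
  apply: wpa_home => //; apply: wpa_seq; apply: wpa_mono (wp2 f2 rep2) => //.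
  by move=> f3 m3 r3 [-> [s3 rep3 I3]]; apply: step rep3.
- move=> f2 m2 r2 [s2 rep2 [I2 -> le2]]; have [_ c2 Q2] := In _ _ I2.
  have [f0 fS f_s] := rep2; rewrite f_s // c2; split=> //.
  apply: (@wpa_le _ (2 * (w * vals s2 x + c).+1).+1); first nia.
  exact: rep_home rep2 Q2.
Qed.

Definition zeroV := 0.

Definition For x y p := Seq (Cpy x zeroV) (Until y.*2 x (Seq p (Inc x))).

(** The body has to leave the counter at [i]; the invariant for [i.+1] is asked of the store in
    which the counter has already been incremented. *)
Lemma wp_for x y p T n (I : nat -> store -> seq sym -> Prop) (Q : store -> seq sym -> Prop) s r :
  x.*2 < w -> y.*2 < w -> x != zeroV -> vals s zeroV = 0 ->
  I 0 (setval s x 0) r ->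
  (forall i s r, i < n -> I i s r ->
     [/\ vals s x = i, vals s y = n & wp p T (fun s' r' => vals s' x = i /\ I i.+1 (setval s' x i.+1) r') s r]) ->
  (forall s r, I n s r -> [/\ vals s x = n, vals s y = n & Q s r]) ->
  wp (For x y p) (pc 0 + pc (vals s x) + n.+1 * (T + 2 * pc n)) Q s r.
Proof.
move=> lt_x lt_y ne_x s_0 I0 IS In; apply: wp_seq; rewrite -{1}s_0.
apply: wp_cpy => //; first by rewrite /zeroV double0; lia.
  by rewrite eq_sym.
rewrite s_0; apply: (@wp_le _ (n.+1 * (T + pc n + pc n))); first nia.
apply: (@wp_until _ _ _ _ _ _ I) => //.
- move=> i s1 r1 lt_i I1; have [x1 y1 wp1] := IS _ _ _ lt_i I1.
  split; [lia|by rewrite cell_val; lia|].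
  apply: wp_seq; apply: wp_mono wp1 => // s2 r2 [x2 I2].
  apply: (@wp_le _ (pc (vals s2 x))); first by rewrite x2 /pc; nia.
  by apply: wp_inc => //; rewrite x2.
- by move=> s1 r1 I1; have [x1 y1 Q1] := In _ _ I1; split; [lia|rewrite cell_val; lia|].
Qed.

End Store.

(** * First-order logic with iteration *)

Definition rel3 (N : nat) : Type := 'I_N -> 'I_N -> 'I_N -> bool.

Definition itr (N : nat) (S : Type) (s0 : S) (F : 'I_N -> S -> S) : S :=
  foldl (fun s i => F i s) s0 (enum 'I_N).

(* First-order formulas with iteration; variables are named by their binding depth.
   [FIt phi0 phi psi] is [psi] with a new relation, computed from [phi0] by
   updating it to [phi] once for each element of the universe. *)
Inductive fm :=
  | FRel of nat & nat & nat & nat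
  | FLt of nat & nat
  | FNot of fm
  | FAnd of fm & fm
  | FEx of fm
  | FIt of fm & fm & fm.

Fixpoint sem (N : nat) (d v : nat) (phi : fm) (rho : nat -> rel3 N) (eta : nat -> 'I_N) : bool :=
  match phi with
  | FRel q t x y => rho q (eta t) (eta x) (eta y)
  | FLt x y => eta x < eta y
  | FNot phi => ~~ sem d v phi rho eta
  | FAnd phi psi => sem d v phi rho eta && sem d v psi rho eta
  | FEx phi => [exists a, sem d v.+1 phi rho (upd eta v a)]
  | FIt phi0 phi psi =>
      let q0 : rel3 N := fun t x y =>
        sem d.+1 v.+3 phi0 (upd rho d (fun _ _ _ => false))
          (upd (upd (upd eta v t) v.+1 x) v.+2 y) in
      let F i q : rel3 N := fun t x y =>
        sem d.+1 v.+4 phi (upd rho d q)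
          (upd (upd (upd (upd eta v i) v.+1 t) v.+2 x) v.+3 y) in
      sem d.+1 v psi (upd rho d (itr q0 F)) eta
  end.

Fixpoint wf (d v : nat) (phi : fm) : bool :=
  match phi with
  | FRel q t x y => [&& q < d, t < v, x < v & y < v]
  | FLt x y => (x < v) && (y < v)
  | FNot phi => wf d v phi
  | FAnd phi psi => wf d v phi && wf d v psi
  | FEx phi => wf d v.+1 phi
  | FIt phi0 phi psi => [&& wf d.+1 v.+3 phi0, wf d.+1 v.+4 phi & wf d.+1 v psi]
  end.

(** Bounds the number of relations and elements alive at once, and with it the number of tracks
    needed by the compiled program. *)
Fixpoint depth (d v : nat) (phi : fm) : nat :=
  match phi with
  | FRel _ _ _ _ | FLt _ _ => d + v
  | FNot phi => depth d v phi
  | FAnd phi psi => maxn (depth d v phi) (depth d v psi)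
  | FEx phi => maxn (d + v).+1 (depth d v.+1 phi)
  | FIt phi0 phi psi =>
      maxn (d + v + 5) (maxn (depth d.+1 v.+3 phi0) (maxn (depth d.+1 v.+4 phi) (depth d.+1 v psi)))
  end.

Lemma depth_ge d v phi : d + v <= depth d v phi.
Proof.
elim: phi d v => //= [phi IH psi _|phi _|phi0 _ phi _ psi _] d v; last by lia.
  by rewrite leq_max IH.
by rewrite leq_max leqnSn.
Qed.

Lemma foldl_ind (A S : Type) (F : A -> S -> S) (I : nat -> S -> Prop) (s0 : S) (l : seq A) :
  I 0 s0 -> (forall (i : nat) a s, i < size l -> ohead (drop i l) = Some a -> I i s -> I i.+1 (F a s)) ->
  I (size l) (foldl (fun s i => F i s) s0 l).
Proof.
elim/last_ind: l => [//|l a IH] I0 IS; rewrite size_rcons -cats1 foldl_cat /=.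
have size_la : size (rcons l a) = (size l).+1 by rewrite size_rcons.
apply: (IS); first by rewrite size_la.
  by rewrite -cats1 drop_size_cat.
apply: IH => // i b s lt_i hd_i Ii; apply: IS => //; first by rewrite size_la ltnW.
rewrite -cats1 drop_cat lt_i; case: (drop i l) hd_i => //.
Qed.

Lemma itr_ind (N : nat) (S : Type) (F : 'I_N -> S -> S) (I : nat -> S -> Prop) (s0 : S) :
  I 0 s0 -> (forall (i : 'I_N) s, I i s -> I i.+1 (F i s)) -> I N (itr s0 F).
Proof.
move=> I0 IS; rewrite -[X in I X _]card_ord cardE; apply: foldl_ind => // i a s lt_i.
rewrite -cardE card_ord in lt_i.
rewrite (drop_nth a) ?size_enum_ord //= => -[].
have -> : nth a (enum 'I_N) i = Ordinal lt_i by apply: val_inj; rewrite /= nth_enum_ord.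
by move=> <-; apply: IS (Ordinal lt_i) s.
Qed.

Definition poly (T : nat -> nat) := exists K a, forall N, T N <= K * N.+2 ^ a.

Lemma poly_le T T' : (forall N, T N <= T' N) -> poly T' -> poly T.
Proof. by move=> le_T [K [a le_a]]; exists K, a => N; apply: leq_trans (le_T N) _. Qed.

Lemma poly_const c : poly (fun=> c).
Proof. by exists c, 0 => N; rewrite muln1. Qed.

Lemma poly_id : poly id.
Proof. by exists 1, 1 => N; rewrite mul1n expn1; lia. Qed.

Lemma poly_add T T' : poly T -> poly T' -> poly (fun N => T N + T' N).
Proof.
move=> [K [a le_a]] [K' [b le_b]]; exists (K + K'), (a + b) => N.
rewrite mulnDl leq_add //.
  by apply: leq_trans (le_a N) _; rewrite leq_mul2l leq_pexp2l ?leq_addr ?orbT.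
by apply: leq_trans (le_b N) _; rewrite leq_mul2l leq_pexp2l ?leq_addl ?orbT.
Qed.

Lemma poly_mul T T' : poly T -> poly T' -> poly (fun N => T N * T' N).
Proof.
move=> [K [a le_a]] [K' [b le_b]]; exists (K * K'), (a + b) => N.
by rewrite expnD mulnACA leq_mul.
Qed.

Lemma poly_exp T e : poly T -> poly (fun N => T N ^ e).
Proof.
move=> pT; elim: e => [|e IH]; first exact: (poly_const 1).
by apply: poly_le (poly_mul pT IH) => N; rewrite expnS.
Qed.

Lemma poly_S T : poly T -> poly (fun N => (T N).+1).
Proof. by move=> pT; apply: poly_le (poly_add (poly_const 1) pT) => N; rewrite add1n. Qed.

Ltac poly_tac :=
  repeat match goal with
  | |- poly (fun N => @?f N + @?g N) => apply: (@poly_add f g)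
  | |- poly (fun N => @?f N * @?g N) => apply: (@poly_mul f g)
  | |- poly (fun N => (@?f N) ^ ?e) => apply: (@poly_exp f e)
  | |- poly (fun N => N) => exact: poly_id
  | |- poly (fun=> _) => exact: poly_const
  | |- poly (fun N => (@?f N).+1) => apply: (@poly_S f)
  | H : poly ?T |- poly (fun N => ?T N) => exact: H
  | H : poly ?T |- poly ?T => exact: H
  end.

(** * Compiling formulas into programs *)

Section Compile.
Variable w : nat.

Local Notation pc := (pc w).
Local Notation wp := (wp w).
Local Notation For := (For w).
Local Notation Put := (Put w).
Local Notation Test := (Test w).
Local Notation Inc := (Inc w).
Local Notation Cpy := (Cpy w).

Definition nop := Act id Stay.

Lemma wp_nop (Q : store -> seq sym -> Prop) s r : Q s r -> wp nop 1 Q s r.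
Proof. by move=> Qs f rep_f; apply: wpa_nop; split=> //; exists s. Qed.

Lemma pc_le u v : u <= v -> pc u <= pc v.
Proof. by rewrite /pc; nia. Qed.

Lemma pc_gt0 v : 0 < pc v.
Proof. by rewrite /pc; nia. Qed.

Definition bounded (B : nat) (s : store) := forall x, vals s x <= B.

Lemma bounded_setval B s x v : bounded B s -> v <= B -> bounded B (setval s x v).
Proof. by move=> bs le_v y; rewrite /= /upd; case: ifP. Qed.

(* Variable 0 is constantly 0 and variable 1 holds the size of the universe;
   variables 2 to 5 are scratch. *)
Definition ev (j : nat) := j + 6.

Definition scratch_eq (s s' : store) :=
  arrs s' = arrs s /\ forall x, x < 2 \/ 6 <= x -> vals s' x = vals s x.

Lemma scratch_setval s s' x v : scratch_eq s s' -> 1 < x < 6 -> scratch_eq s (setval s' x v).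
Proof.
case=> ea ev lt_x; split=> // y Hy; rewrite /= /upd; case: eqP => [|_]; first lia.
exact: ev.
Qed.

(** A Horner step: variable 2 is multiplied by the size of the universe and increased by [x]. It is
    done by counting, as the increment is the only arithmetic instruction. *)
Definition Muladd x :=
  Seq (Cpy 3 2) (Seq (Cpy 2 0) (Seq (For 4 3 (For 5 1 (Inc 2))) (For 4 x (Inc 2)))).

Definition mcost B := 40 * (B.+1 * B.+1 * pc B).

Lemma wp_muladd x a b N B (Q : store -> seq sym -> Prop) s r : 12 <= w -> x.*2 < w -> 6 <= x ->
  vals s 0 = 0 -> vals s 1 = N -> vals s 2 = a -> vals s x = b -> bounded B s -> a * N + b <= B ->
  (forall s', scratch_eq s s' -> bounded B s' -> vals s' 2 = a * N + b -> Q s' r) ->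
  wp (Muladd x) (mcost B) Q s r.
Proof.
move=> le_w lt_x le_x s0 s1 s2 sx bs le_B Qs.
have a_B : a <= B by rewrite -s2.
have N_B : N <= B by rewrite -s1.
have b_B : b <= B by rewrite -sx.
have c0 : 0 < pc B := pc_gt0 _.
have pcB (v : nat) : v <= B -> pc v <= pc B by exact: pc_le.
pose c := pc B.
apply: (@wp_le _ _ ((c + c) + ((c + c) + ((c + c + B.+1 * (c + c + B.+1 * (3 * c) + 2 * c)) +
  (c + c + B.+1 * (3 * c)))))); first by rewrite /mcost -/c; nia.
apply: wp_seq; apply: wp_le (wp_cpy _ _ _ _) => //; [|lia|lia|].
  by apply: leq_add; apply: pcB.
rewrite s2; apply: wp_seq; apply: wp_le (wp_cpy _ _ _ _) => //; [|lia|lia|].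
  by apply: leq_add; apply: pcB; rewrite /= /upd /=; [rewrite s0|rewrite s2].
rewrite (_ : vals (setval s 3 a) 0 = 0) //.
set s3 := setval _ _ _.
have b3 : bounded B s3 by do 2!apply: bounded_setval => //.
apply: wp_seq.
pose I i (s' : store) r' := [/\ r' = r, scratch_eq s s', bounded B s', vals s' 3 = a &
   vals s' 4 = i /\ vals s' 2 = i * N].
apply: (@wp_le _ _ (pc 0 + pc (vals s3 4) + a.+1 * ((c + c + B.+1 * (3 * c)) + 2 * pc a))).
  have := pcB _ (b3 4); have := pcB 0 isT; have := pcB _ a_B; rewrite -/c; nia.
apply: (@wp_for _ _ _ _ _ _ I) => //; try lia.
- split=> //; last exact: bounded_setval.
  by do 3!apply: scratch_setval => //.
- move=> i s' r' lt_i [-> [ea ev'] b' e3 [e4 e2]]; split=> //.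
  apply: (@wp_le _ _ (pc 0 + pc (vals s' 5) + N.+1 * (c + 2 * pc N))).
    by have := pcB _ (b' 5); have := pcB 0 isT; have := pcB _ N_B; rewrite -/c; nia.
  pose J j (s' : store) r' := [/\ r' = r, scratch_eq s s', bounded B s', vals s' 3 = a &
    [/\ vals s' 4 = i, vals s' 5 = j & vals s' 2 = i * N + j]].
  apply: (@wp_for _ _ _ _ _ _ J) => //; try lia.
  + by rewrite ev' //; left.
  + split=> //; last by split=> //=; rewrite /upd /= addn0.
      exact: scratch_setval.
    exact: bounded_setval.
  + move=> j s'' r'' lt_j [-> [ea'' ev''] b'' e3'' [e4'' e5'' e2'']]; split=> //.
      by rewrite ev''; [|left].
    have le_ij : (i * N + j).+1 <= B.
      have : i.+1 * N <= a * N by rewrite leq_mul2r lt_i orbT.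
      by rewrite mulSn; lia.
    apply: (wp_le (pcB _ (b'' 2))); apply: wp_inc; first lia.
    rewrite e2'' /upd /=; split=> //; split=> //.
    * by do 2!apply: scratch_setval => //.
    * by apply: bounded_setval; [apply: bounded_setval|lia].
    * by split=> //=; rewrite /upd /= addnS.
  + move=> s'' r'' [-> [ea'' ev''] b'' e3'' [e4'' e5'' e2'']]; split=> //.
      by rewrite ev''; [|left].
    split=> //; split=> //.
    * exact: scratch_setval.
    * by apply: bounded_setval => //; lia.
    * by rewrite /= /upd /= e2'' mulSn addnC.
move=> s4 r4 [-> [ea4 ev4] b4 e3 [e4 e2]]; split=> //.
apply: (@wp_le _ _ (pc 0 + pc (vals s4 4) + b.+1 * (c + 2 * pc b))).
  by have := pcB _ (b4 4); have := pcB 0 isT; have := pcB _ b_B; rewrite -/c; nia.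
pose J j (s' : store) r' := [/\ r' = r, scratch_eq s s', bounded B s', vals s' 4 = j &
   vals s' 2 = a * N + j].
apply: (@wp_for _ _ _ _ _ _ J) => //; try lia.
- by rewrite ev4 //; left.
- split=> //; last by rewrite /= /upd /= addn0.
    exact: scratch_setval.
  exact: bounded_setval.
- move=> j s' r' lt_j [-> [ea' ev'] b' e4' e2']; split=> //.
    by rewrite ev'; [|right].
  apply: (wp_le (pcB _ (b' 2))); apply: wp_inc; first lia.
  rewrite e2' /upd /=; split=> //; split=> //.
  + by do 2!apply: scratch_setval => //.
  + by apply: bounded_setval; [apply: bounded_setval => //; lia|lia].
  + by rewrite /= /upd /= addnS.
- move=> s' r' [-> sc b' e4' e2']; split=> //; last by apply: Qs.
  by case: sc => _ ->; [|right].
Qed.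

(** Row-major address of a triple. Relations are arrays of length [N ^ 3], which is also the bound
    kept on all variables. *)
Definition ad (N t x y : nat) := (t * N + x) * N + y.

Lemma ad_lt N t x y : t < N -> x < N -> y < N -> ad N t x y < N ^ 3.
Proof.
move=> lt_t lt_x lt_y; rewrite /ad !expnS expn0 muln1.
have : (t * N + x).+1 <= N * N by apply: (@leq_trans (t.+1 * N)); [rewrite mulSn; lia|rewrite leq_mul2r lt_t orbT].
by nia.
Qed.

Lemma ad_inj N t x y t' x' y' : x < N -> y < N -> x' < N -> y' < N ->
  ad N t x y = ad N t' x' y' -> [/\ t = t', x = x' & y = y'].
Proof.
have inj (a b a' b' : nat) : b < N -> b' < N -> a * N + b = a' * N + b' -> a = a' /\ b = b'.
  move=> lt_b lt_b' e; have N0 : 0 < N by lia.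
  have : (a * N + b) %/ N = (a' * N + b') %/ N by rewrite e.
  rewrite !divnMDl // !divn_small // !addn0 => eq_a; split=> //.
  by move: e; rewrite eq_a => /addnI.
move=> lt_x lt_y lt_x' lt_y' e; have [e1 ->] := inj _ _ _ _ lt_y lt_y' e.
by have [-> ->] := inj _ _ _ _ lt_x lt_x' e1.
Qed.

Definition Addr t x y := Seq (Cpy 2 0) (Seq (Muladd t) (Seq (Muladd x) (Muladd y))).

Definition acost N := 2 * pc (N ^ 3) + 3 * mcost (N ^ 3).

Lemma wp_addr N t x y (Q : store -> seq sym -> Prop) s r : 12 <= w ->
  t.*2 < w -> x.*2 < w -> y.*2 < w -> 6 <= t -> 6 <= x -> 6 <= y ->
  vals s 0 = 0 -> vals s 1 = N -> bounded (N ^ 3) s ->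
  vals s t < N -> vals s x < N -> vals s y < N ->
  (forall s', scratch_eq s s' -> bounded (N ^ 3) s' ->
     vals s' 2 = ad N (vals s t) (vals s x) (vals s y) -> Q s' r) ->
  wp (Addr t x y) (acost N) Q s r.
Proof.
move=> le_w lt_t lt_x lt_y le_t le_x le_y s0 s1 bs t_N x_N y_N Qs.
have N0 : 0 < N by lia.
have N3 : N ^ 3 = N * N * N by rewrite !expnS expn0 muln1 mulnA.
have txB : (vals s t * N + vals s x) < N * N.
  apply: (@leq_trans ((vals s t).+1 * N)); first by rewrite mulSn; lia.
  by rewrite leq_mul2r t_N orbT.
apply: (@wp_le _ _ (2 * pc (N ^ 3) + (mcost (N ^ 3) + (mcost (N ^ 3) + mcost (N ^ 3))))).
  by rewrite /acost; lia.
apply: wp_seq; apply: (@wp_le _ _ (pc (vals s 0) + pc (vals s 2))).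
  by rewrite mul2n -addnn; apply: leq_add; apply: pc_le.
apply: wp_cpy => //; try lia.
set s3 := setval _ _ _; have sc3 : scratch_eq s s3 by apply: scratch_setval.
have b3 : bounded (N ^ 3) s3 by apply: bounded_setval; rewrite // s0.
have [_ ev3] := sc3.
apply: wp_seq; apply: (@wp_muladd t 0 (vals s t) N) => //.
- by rewrite ev3 //; right.
- by rewrite N3; nia.
move=> s4 [ea4 ev4] b4 e4; apply: wp_seq; apply: (@wp_muladd x (vals s t) (vals s x) N) => //.
- by rewrite ev4 ?ev3 ?s0 //; left.
- by rewrite ev4 ?ev3 ?s1 //; left.
- by rewrite ev4 ?ev3 //; right.
- by rewrite N3; nia.
move=> s5 [ea5 ev5] b5 e5; apply: (@wp_muladd y (vals s t * N + vals s x) (vals s y) N) => //.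
- by rewrite ev5 ?ev4 ?ev3 ?s0 //; left.
- by rewrite ev5 ?ev4 ?ev3 ?s1 //; left.
- by rewrite ev5 ?ev4 ?ev3 //; right.
- by rewrite N3; nia.
move=> s6 [ea6 ev6] b6 e6; apply: Qs => //; split; first by rewrite ea6 ea5 ea4; case: sc3.
by move=> z Hz; rewrite ev6 ?ev5 ?ev4 ?ev3.
Qed.

Definition fcost (T N : nat) := 2 * pc (N ^ 3) + N.+1 * (T + 2 * pc (N ^ 3)).

Lemma wp_fore N b p T (I : nat -> store -> Prop) (Q : store -> seq sym -> Prop) s r :
  12 <= w -> (ev b).*2 < w -> vals s 0 = 0 -> bounded (N ^ 3) s ->
  (forall m s, I m s -> vals s 1 = N) ->
  I 0 (setval s (ev b) 0) ->
  (forall i s, i < N -> I i s -> vals s (ev b) = i ->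
     wp p T (fun s' r' => [/\ r' = r, vals s' (ev b) = i & I i.+1 (setval s' (ev b) i.+1)]) s r) ->
  (forall s', I N s' -> Q s' r) ->
  wp (For (ev b) 1 p) (fcost T N) Q s r.
Proof.
move=> le_w lt_b s0 bs I1 I0 IS In.
have N_3 : N <= N ^ 3 by case: (N) => // n; rewrite expnS leq_pmulr // expn_gt0.
apply: (@wp_le _ _ (pc 0 + pc (vals s (ev b)) + N.+1 * (T + 2 * pc N))).
  rewrite /fcost; have := pc_le (leq0n (N ^ 3)); have := pc_le (bs (ev b)); have := pc_le N_3.
  by nia.
pose J i s' r' := [/\ r' = r, vals s' (ev b) = i & I i s'].
have ne_b : ev b != zeroV by rewrite /ev addnS.
have lt_1 : 1.*2 < w by lia.
apply: (@wp_for _ _ _ _ _ _ J) => //.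
- by split=> //; rewrite /= /upd eqxx.
- move=> i s' r' lt_i [-> vi Ii]; split=> //; first exact: I1 Ii.
  apply: wp_mono (IS i s' lt_i Ii vi) => // s'' r'' [-> vi' IS']; split=> //; split=> //.
  by rewrite /= /upd eqxx.
- by move=> s' r' [-> vi Ii]; split=> //; [apply: I1 Ii|apply: In].
Qed.

Definition For3 b p := For (ev b) 1 (For (ev b.+1) 1 (For (ev b.+2) 1 p)).

(** The three loops visit the addresses in increasing order, so one invariant indexed by the address
    replaces three nested ones. *)
Lemma wp_for3 N b p T (I : nat -> store -> Prop) (Q : store -> seq sym -> Prop) s r :
  12 <= w -> (ev b.+2).*2 < w ->
  (forall m s, I m s -> [/\ vals s 0 = 0, vals s 1 = N & bounded (N ^ 3) s]) ->
  (forall m s j v, I m s -> ev b <= j -> v <= N -> I m (setval s j v)) ->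
  I 0 s ->
  (forall t x y s, t < N -> x < N -> y < N -> I (ad N t x y) s ->
     vals s (ev b) = t -> vals s (ev b.+1) = x -> vals s (ev b.+2) = y ->
     wp p T (fun s' r' => [/\ r' = r, [/\ vals s' (ev b) = t, vals s' (ev b.+1) = x &
       vals s' (ev b.+2) = y] & I (ad N t x y).+1 s']) s r) ->
  (forall s', I (N ^ 3) s' -> Q s' r) ->
  wp (For3 b p) (fcost (fcost (fcost T N) N) N) Q s r.
Proof.
move=> le_w lt_b I1 Iset I0 IS In.
have [s_0 s_1 bs] := I1 _ _ I0.
apply: (@wp_fore N b _ _ (fun i s' => I (ad N i 0 0) s')) => //.
- by rewrite /ev in lt_b *; lia.
- by move=> m s' /I1[].
- by apply: Iset => //; rewrite /ev; lia.
- move=> t s1 lt_t It vt; have [z1 n1 b1] := I1 _ _ It.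
  apply: (@wp_fore N b.+1 _ _ (fun i s' => vals s' (ev b) = t /\ I (ad N t i 0) s')) => //.
  + by rewrite /ev in lt_b *; lia.
  + by move=> m s' [_ /I1[]].
  + split; first by rewrite /= /upd; case: eqP => //; rewrite /ev; lia.
    by apply: Iset => //; rewrite /ev; lia.
  + move=> x s2 lt_x [vt2 Ix] vx; have [z2 n2 b2] := I1 _ _ Ix.
    apply: (@wp_fore N b.+2 _ _ (fun i s' =>
      [/\ vals s' (ev b) = t, vals s' (ev b.+1) = x & I (ad N t x i) s'])) => //.
    * by move=> m s' [_ _ /I1[]].
    * split; first by rewrite /= /upd; case: eqP => //; rewrite /ev; lia.
        by rewrite /= /upd; case: eqP => //; rewrite /ev; lia.
      by apply: Iset => //; rewrite /ev; lia.
    * move=> y s3 lt_y [vt3 vx3 Iy] vy.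
      apply: wp_mono (IS t x y s3 lt_t lt_x lt_y Iy vt3 vx3 vy) => //.
      move=> s4 r4 [-> [vt4 vx4 vy4] I4]; split=> //; split.
      - by rewrite /= /upd; case: eqP => //; rewrite /ev; lia.
      - by rewrite /= /upd; case: eqP => //; rewrite /ev; lia.
      - by apply: Iset => //; [rewrite /ad addnS|rewrite /ev; lia].
    * move=> s3 [vt3 vx3 I3]; split=> //; split.
        by rewrite /= /upd; case: eqP => //; rewrite /ev; lia.
      apply: Iset => //.
      by move: I3; rewrite /ad addn0; congr (I _ _); lia.
  + move=> s2 [vt2 I2]; split=> //.
    apply: Iset => //.
    by move: I2; rewrite /ad !addn0; congr (I _ _); lia.
- by move=> s' I'; apply: In; move: I'; rewrite /ad !addn0 !expnS expn0 muln1 mulnA.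
Qed.

(** Array 0 is the flag. Each depth then owns three arrays: a relation, its next version under
    construction, and the accumulator of an existential quantifier. *)
Definition relA j := 3 * j + 1.
Definition tmpA j := 3 * j + 2.
Definition accA j := 3 * j + 3.

(** What a program compiled at depths [d] and [v] leaves to the enclosing scopes. Relations from [d]
    on, elements from [v] on, the flag and the scratch variables may change. *)
Record frame (d v : nat) (s s' : store) : Prop := Frame {
  frame_0 : vals s' 0 = vals s 0;
  frame_1 : vals s' 1 = vals s 1;
  frame_ev : forall j, j < v -> vals s' (ev j) = vals s (ev j);
  frame_rel : forall j i, j < d -> arrs s' (relA j) i = arrs s (relA j) i;
  frame_tmp : forall j i, j < d -> arrs s' (tmpA j) i = arrs s (tmpA j) i;
  frame_acc : forall j i, j < v -> arrs s' (accA j) i = arrs s (accA j) i }.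

Lemma frame_trans d v s1 s2 s3 : frame d v s1 s2 -> frame d v s2 s3 -> frame d v s1 s3.
Proof.
move=> [a1 a2 a3 a4 a5 a6] [b1 b2 b3 b4 b5 b6].
split=> [||j lt_j|j i lt_j|j i lt_j|j i lt_j].
- by rewrite b1. - by rewrite b2. - by rewrite b3 ?a3. - by rewrite b4 ?a4.
- by rewrite b5 ?a5. - by rewrite b6 ?a6.
Qed.

Lemma frame_le d v d' v' s s' : d <= d' -> v <= v' -> frame d' v' s s' -> frame d v s s'.
Proof.
move=> le_d le_v [a1 a2 a3 a4 a5 a6].
split=> // [j lt_j|j i lt_j|j i lt_j|j i lt_j].
- by rewrite a3 //; lia. - by rewrite a4 //; lia. - by rewrite a5 //; lia.
- by rewrite a6 //; lia.
Qed.

Lemma frame_scratch d v s s' : scratch_eq s s' -> frame d v s s'.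
Proof.
case=> ea ev'; split=> *; rewrite ?ea //; rewrite ev' //; try (by left).
by right; rewrite /ev; lia.
Qed.

Lemma frame_setval d v s x a : ev v <= x -> frame d v s (setval s x a).
Proof.
move=> le_x; split=> //= *; rewrite /upd; case: eqP => //; rewrite /ev in le_x *; lia.
Qed.

Lemma frame_setarr d v s a i b :
  (forall j, j < d -> a <> relA j /\ a <> tmpA j) -> (forall j, j < v -> a <> accA j) ->
  frame d v s (setarr s a i b).
Proof.
move=> ne_a ne_v; split=> //= j k lt_j; rewrite /upd; case: eqP => // e.
- by case: (ne_a _ lt_j); rewrite -e.
- by case: (ne_a _ lt_j); rewrite -e.
- by case: (ne_v _ lt_j); rewrite -e.
Qed.

Definition flag s := arrs s 0 0.

(** The new relation is collected in [tmpA d] and only then copied to [relA d], because [p] still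
    reads the old one while it runs. *)
Definition Fill d b p :=
  Seq (For3 b (Seq p (Seq (Addr (ev b) (ev b.+1) (ev b.+2))
                      (Test 1 0 (Put (tmpA d) 2 true) (Put (tmpA d) 2 false)))))
      (For3 b (Seq (Addr (ev b) (ev b.+1) (ev b.+2))
                (Test (tmpA d).*2.+1 2 (Put (relA d) 2 true) (Put (relA d) 2 false)))).

Definition fillcost T N :=
  fcost (fcost (fcost (T + (acost N + (pc (N ^ 3) + pc (N ^ 3)))) N) N) N +
  fcost (fcost (fcost (acost N + (pc (N ^ 3) + pc (N ^ 3))) N) N) N.

Lemma wp_fill N d b p T (F : rel3 N) (Q : store -> seq sym -> Prop) s r :
  0 < N -> 20 + 6 * (d + b) + 12 <= w ->
  vals s 0 = 0 -> vals s 1 = N -> bounded (N ^ 3) s ->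
  (forall s1 (t x y : 'I_N), frame d b s s1 -> bounded (N ^ 3) s1 ->
     (forall i, arrs s1 (relA d) i = arrs s (relA d) i) ->
     vals s1 (ev b) = t -> vals s1 (ev b.+1) = x -> vals s1 (ev b.+2) = y ->
     wp p T (fun s2 r2 => [/\ r2 = r, frame d.+1 b.+3 s1 s2, bounded (N ^ 3) s2 &
        flag s2 = F t x y]) s1 r) ->
  (forall s', frame d b s s' -> bounded (N ^ 3) s' ->
     (forall t x y : 'I_N, arrs s' (relA d) (ad N t x y) = F t x y) -> Q s' r) ->
  wp (Fill d b p) (fillcost T N) Q s r.
Proof.
move=> N0 le_w s_0 s_1 bs wp_p Qs; apply: wp_seq.
have N_3 : N <= N ^ 3 by case: (N) N0 => // n _; rewrite expnS leq_pmulr // expn_gt0.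
pose filled a m s1 := forall t x y : 'I_N, ad N t x y < m -> arrs s1 a (ad N t x y) = F t x y.
have filled_put a m s1 s2 (t x y : 'I_N) : m = ad N t x y -> filled a m s1 ->
    (forall i, arrs s2 a i = upd (arrs s1 a) m (F t x y) i) -> filled a m.+1 s2.
  move=> em f1 e2 t' x' y' lt_m; rewrite e2 /upd em; case: eqP => [e|ne].
    have [e1 e2' e3] := ad_inj (ltn_ord _) (ltn_ord _) (ltn_ord _) (ltn_ord _) e.
    by congr (F _ _ _); apply: val_inj.
  by apply: f1; move: lt_m; rewrite em ltnS leq_eqVlt => /orP[/eqP|].
have N_ev s1 : frame d b s s1 -> vals s1 0 = 0 /\ vals s1 1 = N.
  by case=> -> -> *.
have ne_tmp : (forall j, j < d -> tmpA d <> relA j /\ tmpA d <> tmpA j) /\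
    (forall j, j < b -> tmpA d <> accA j).
  by split=> j lt_j; rewrite /tmpA /relA /accA; lia.
have ne_rel : (forall j, j < d -> relA d <> relA j /\ relA d <> tmpA j) /\
    (forall j, j < b -> relA d <> accA j).
  by split=> j lt_j; rewrite /tmpA /relA /accA; lia.
apply: (@wp_for3 N _ _ _ (fun m s1 => [/\ frame d b s s1, bounded (N ^ 3) s1,
    forall i, arrs s1 (relA d) i = arrs s (relA d) i & filled (tmpA d) m s1])) => //.
- by lia.
- by rewrite /ev; lia.
- by move=> m s1 [/N_ev[-> ->] b1 _ _].
- move=> m s1 j v [f1 b1 e1 fl1] le_j le_v; split=> //.
    exact: frame_trans f1 (frame_setval _ _ _ le_j).
  by apply: bounded_setval => //; lia.
- move=> t x y s1 lt_t lt_x lt_y [f1 b1 e1 fl1] vt vx vy.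
  apply: wp_seq; apply: wp_mono (wp_p s1 (Ordinal lt_t) (Ordinal lt_x) (Ordinal lt_y) f1 b1 e1 vt vx vy) => //.
  move=> s2 _ [-> f2 b2 fl2]; apply: wp_seq.
  have [z1 n1] := N_ev _ f1.
  have vt2 : vals s2 (ev b) = t by rewrite (frame_ev f2) //; lia.
  have vx2 : vals s2 (ev b.+1) = x by rewrite (frame_ev f2) //; lia.
  have vy2 : vals s2 (ev b.+2) = y by rewrite (frame_ev f2) //; lia.
  apply: wp_addr; rewrite ?vt2 ?vx2 ?vy2 ?(frame_0 f2) ?(frame_1 f2) //; rewrite /ev; try lia.
  move=> s3 sc3 b3 v3; rewrite -/(ev b) -/(ev b.+1) -/(ev b.+2).
  have f3 : frame d.+1 b.+3 s1 s3 := frame_trans f2 (frame_scratch _ _ sc3).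
  have fl3 : flag s3 = F (Ordinal lt_t) (Ordinal lt_x) (Ordinal lt_y).
    by rewrite -fl2 /flag; case: sc3 => -> _.
  have [z3 n3] : vals s3 0 = 0 /\ vals s3 1 = N by rewrite (frame_0 f3) (frame_1 f3).
  suff fin v : v = flag s3 -> wp (Put (tmpA d) 2 v) (pc (N ^ 3)) (fun s' r' =>
      [/\ r' = r, [/\ vals s' (ev b) = t, vals s' (ev b.+1) = x & vals s' (ev b.+2) = y] &
      [/\ frame d b s s', bounded (N ^ 3) s',
         (forall i, arrs s' (relA d) i = arrs s (relA d) i) & filled (tmpA d) (ad N t x y).+1 s']]) s3 r.
    apply: (@wp_le _ _ (pc (vals s3 0) + pc (N ^ 3))); first by rewrite leq_add2r; apply: pc_le.
    apply: wp_test; [lia|lia| |]; rewrite z3 (@cell_arr s3 0 0) -/(flag s3) => fl; apply: fin => //.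
    by rewrite (negbTE fl).
  move=> ->; apply: (@wp_le _ _ (pc (vals s3 2))); first exact: pc_le.
  apply: wp_put; [lia|rewrite /tmpA; lia|].
  split=> //.
    by split; rewrite (frame_ev f3) //; lia.
  split.
  + apply: frame_trans f1 (frame_trans (frame_le _ _ f3) _) => //; first by lia.
    by apply: frame_setarr; case: ne_tmp.
  + exact: b3.
  + by move=> i; rewrite -e1 -(frame_rel f3) //= /upd; case: eqP => //; rewrite /relA /tmpA; lia.
  + apply: (@filled_put _ _ s1 _ (Ordinal lt_t) (Ordinal lt_x) (Ordinal lt_y)) => //.
    move=> i; rewrite /= v3 fl3 /upd eqxx; case: eqP => // _.
    exact: (frame_tmp f3).
move=> s1 [f1 b1 e1 fl1].
apply: (@wp_for3 N _ _ _ (fun m s2 => [/\ frame d b s s2, bounded (N ^ 3) s2,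
    filled (tmpA d) (N ^ 3) s2 & filled (relA d) m s2])) => //.
- by lia.
- by rewrite /ev; lia.
- by move=> m s2 [/N_ev[-> ->] b2 _ _].
- move=> m s2 j v [f2 b2 e2 fl2] le_j le_v; split=> //.
    exact: frame_trans f2 (frame_setval _ _ _ le_j).
  by apply: bounded_setval => //; lia.
- move=> t x y s2 lt_t lt_x lt_y [f2 b2 e2 fl2] vt2 vx2 vy2.
  have [z2 n2] := N_ev _ f2.
  apply: wp_seq; apply: wp_addr; rewrite ?vt2 ?vx2 ?vy2 //; rewrite /ev; try lia.
  move=> s3 sc3 b3 v3; rewrite -/(ev b) -/(ev b.+1) -/(ev b.+2).
  have f3 : frame d b s s3 := frame_trans f2 (frame_scratch _ _ sc3).
  have [z3 n3] := N_ev _ f3.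
  have fl3 : arrs s3 (tmpA d) (ad N t x y) = F (Ordinal lt_t) (Ordinal lt_x) (Ordinal lt_y).
    by case: (sc3) => -> _; apply: (e2 (Ordinal lt_t) (Ordinal lt_x) (Ordinal lt_y)); apply: ad_lt.
  suff fin v : v = F (Ordinal lt_t) (Ordinal lt_x) (Ordinal lt_y) ->
      wp (Put (relA d) 2 v) (pc (N ^ 3)) (fun s' r' =>
      [/\ r' = r, [/\ vals s' (ev b) = t, vals s' (ev b.+1) = x & vals s' (ev b.+2) = y] &
      [/\ frame d b s s', bounded (N ^ 3) s', filled (tmpA d) (N ^ 3) s'
         & filled (relA d) (ad N t x y).+1 s']]) s3 r.
    apply: (@wp_le _ _ (pc (vals s3 2) + pc (N ^ 3))); first by rewrite leq_add2r; apply: pc_le.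
    apply: wp_test; [lia|rewrite /tmpA; lia| |]; rewrite v3 cell_arr fl3 => fl; apply: fin => //.
    by rewrite (negbTE fl).
  move=> ->; apply: (@wp_le _ _ (pc (vals s3 2))); first exact: pc_le.
  apply: wp_put; [lia|rewrite /relA; lia|].
  case: (sc3) => ea3 ev3.
  split=> //; first by split; rewrite /= ev3 //; right; rewrite /ev; lia.
  split.
  + by apply: frame_trans f3 _; apply: frame_setarr; case: ne_rel.
  + exact: b3.
  + move=> t' x' y' lt'; rewrite -(e2 _ _ _ lt') -ea3 /= /upd; case: eqP => //.
    by rewrite /relA /tmpA; lia.
  + apply: (@filled_put _ _ s2 _ (Ordinal lt_t) (Ordinal lt_x) (Ordinal lt_y)) => //.
    by move=> i; rewrite /= v3 ea3 /upd eqxx; case: eqP.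
- move=> s2 [f2 b2 e2 fl2]; apply: Qs => // t x y; apply: fl2; exact: ad_lt.
Qed.

Lemma poly_pc : poly (fun N => pc (N ^ 3)).
Proof. by rewrite /pc; poly_tac. Qed.

Lemma poly_fcost T : poly T -> poly (fun N => fcost (T N) N).
Proof. by have := poly_pc => p_pc pT; rewrite /fcost; poly_tac. Qed.

Lemma poly_acost : poly acost.
Proof. by have := poly_pc => p_pc; rewrite /acost /mcost; poly_tac. Qed.

Lemma poly_fillcost T : poly T -> poly (fun N => fillcost (T N) N).
Proof.
have p_pc := poly_pc; have p_a := poly_acost; move=> pT; rewrite /fillcost.
apply: poly_add; (do 3!apply: poly_fcost); poly_tac.
Qed.

(** The truth value is returned in the flag. For [FIt] the relation is cleared beforehand: its array
    may hold values from an earlier evaluation of the same subformula, while [phi0] has to see an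
    empty relation. *)
Fixpoint compile (d v : nat) (phi : fm) : prog :=
  match phi with
  | FRel q t x y =>
      Seq (Addr (ev t) (ev x) (ev y)) (Test (relA q).*2.+1 2 (Put 0 0 true) (Put 0 0 false))
  | FLt x y =>
      Seq (Put 0 0 false) (For 3 (ev y) (Test (ev x).*2 3 (Put 0 0 true) nop))
  | FNot phi => Seq (compile d v phi) (Test 1 0 (Put 0 0 false) (Put 0 0 true))
  | FAnd phi psi => Seq (compile d v phi) (Test 1 0 (compile d v psi) nop)
  | FEx phi =>
      Seq (Put (accA v) 0 false)
     (Seq (For (ev v) 1 (Seq (compile d v.+1 phi) (Test 1 0 (Put (accA v) 0 true) nop)))
          (Test (accA v).*2.+1 0 (Put 0 0 true) (Put 0 0 false)))
  | FIt phi0 phi psi =>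
      Seq (Fill d v (Put 0 0 false))
     (Seq (Fill d v (compile d.+1 v.+3 phi0))
     (Seq (For (ev v) 1 (Fill d v.+1 (compile d.+1 v.+4 phi)))
          (compile d.+1 v psi)))
  end.

Record encodes (N d v : nat) (rho : nat -> rel3 N) (eta : nat -> 'I_N) (s : store) : Prop := Encodes {
  enc_0 : vals s 0 = 0;
  enc_1 : vals s 1 = N;
  enc_b : bounded (N ^ 3) s;
  enc_ev : forall j, j < v -> vals s (ev j) = eta j;
  enc_rel : forall j (t x y : 'I_N), j < d -> arrs s (relA j) (ad N t x y) = rho j t x y }.

Lemma encodes_frame N d v rho eta s s' : bounded (N ^ 3) s' -> frame d v s s' ->
  @encodes N d v rho eta s -> encodes d v rho eta s'.
Proof.
move=> b' [a1 a2 a3 a4 a5 a6] [e1 e2 e3 e4 e5].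
split=> // [||j lt_j|j t x y lt_j]; first by rewrite a1. by rewrite a2.
- by rewrite a3 ?e4. - by rewrite a4 ?e5.
Qed.

Lemma encodes_upd N d v rho eta s (a : 'I_N) : @encodes N d v rho eta s ->
  vals s (ev v) = a -> encodes d v.+1 rho (upd eta v a) s.
Proof.
move=> [e1 e2 e3 e4 e5] va; split=> // j; rewrite ltnS leq_eqVlt /upd.
by case: eqP => [->|_] //= /e4.
Qed.

Lemma encodes_rel N d v rho eta s (q : rel3 N) : @encodes N d v rho eta s ->
  (forall t x y : 'I_N, arrs s (relA d) (ad N t x y) = q t x y) -> encodes d.+1 v (upd rho d q) eta s.
Proof.
move=> [e1 e2 e3 e4 e5] va; split=> // j t x y; rewrite ltnS leq_eqVlt /upd.
by case: eqP => [->|_] //= /e5.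
Qed.

Definition evalpost N d v (b : bool) s r s' (r' : seq sym) :=
  [/\ r' = r, frame d v s s', bounded (N ^ 3) s' & flag s' = b].

Lemma frame_flag d v s b : frame d v s (setarr s 0 0 b).
Proof. by apply: frame_setarr => j lt_j; rewrite /relA /tmpA /accA; lia. Qed.

Lemma frame_accA d v s b : frame d v s (setarr s (accA v) 0 b).
Proof. by apply: frame_setarr => j lt_j; rewrite /relA /tmpA /accA; lia. Qed.

Lemma wp_put0 N a b (Q : store -> seq sym -> Prop) s r : a.*2.+1 < w -> vals s 0 = 0 ->
  bounded (N ^ 3) s -> Q (setarr s a 0 b) r -> wp (Put a 0 b) (pc (N ^ 3)) Q s r.
Proof.
move=> lt_a s0 bs Qs; apply: (@wp_le _ _ (pc (vals s 0))); first exact: pc_le.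
by apply: wp_put; [lia|lia|rewrite s0].
Qed.

Lemma wp_flag N p q T (Q : store -> seq sym -> Prop) s r : 20 <= w ->
  vals s 0 = 0 -> bounded (N ^ 3) s ->
  (flag s = true -> wp p T Q s r) -> (flag s = false -> wp q T Q s r) ->
  wp (Test 1 0 p q) (pc (N ^ 3) + T) Q s r.
Proof.
move=> le_w s0 bs wp1 wp2; apply: (@wp_le _ _ (pc (vals s 0) + T)).
  by rewrite leq_add2r; apply: pc_le.
apply: wp_test; [lia|lia| |]; rewrite s0 (@cell_arr s 0 0) -/(flag s) => fl; first exact: wp1.
by apply: wp2; apply: negbTE.
Qed.

(** [T] is chosen before the universe, so the polynomial belongs to the formula and to the number of
    tracks, not to the structure in which it is evaluated. *)
Lemma compile_spec phi d v : wf d v phi -> 60 + 12 * depth d v phi <= w ->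
  exists2 T, poly T & forall N rho eta s r, 0 < N -> @encodes N d v rho eta s ->
    wp (compile d v phi) (T N) (evalpost N d v (sem d v phi rho eta) s r) s r.
Proof.
have p_pc := poly_pc; have p_a := poly_acost.
elim: phi d v => [q t x y|x y|phi IH|phi IH1 psi IH2|phi IH|phi0 IH0 phi IH1 psi IH2] d v /=.
- move=> /and4P[lt_q lt_t lt_x lt_y] le_w.
  exists (fun N => acost N + (pc (N ^ 3) + pc (N ^ 3))); first by poly_tac.
  move=> N rho eta s r N0 [e0 e1 eb ee er]; apply: wp_seq.
  apply: wp_addr => //; rewrite ?ee // /ev; try lia; move=> s1 sc b1 v1.
  have f1 : frame d v s s1 by apply: frame_scratch.
  have e10 : vals s1 0 = 0 by rewrite (frame_0 f1).
  apply: (@wp_le _ _ (pc (vals s1 2) + pc (N ^ 3))); first by rewrite leq_add2r; apply: pc_le.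
  have := er q (eta t) (eta x) (eta y) lt_q; rewrite -(frame_rel f1) // => er1.
  apply: wp_test; [lia|rewrite /relA; lia| |]; rewrite v1 cell_arr er1 => fl.
    by apply: wp_put0 => //; first lia; split=> //; apply: frame_trans f1 (frame_flag _ _ _ _).
  apply: wp_put0 => //; first lia.
  by split=> //; [apply: frame_trans f1 (frame_flag _ _ _ _)|rewrite (negbTE fl)].
- move=> /andP[lt_x lt_y] le_w.
  exists (fun N => pc (N ^ 3) + (2 * pc (N ^ 3) + N.+1 * ((pc (N ^ 3) + pc (N ^ 3)) + 2 * pc (N ^ 3)))).
    by poly_tac.
  move=> N rho eta s r N0 [e0 e1 eb ee er]; apply: wp_seq.
  apply: wp_put0 => //; first lia; set s1 := setarr _ _ _ _.
  have f1 : frame d v s s1 by apply: frame_flag.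
  have b1 : bounded (N ^ 3) s1 by [].
  have N_3 : N <= N ^ 3 by case: (N) N0 => // n _; rewrite expnS leq_pmulr // expn_gt0.
  have le_y := ltn_ord (eta y).
  apply: (@wp_le _ _ (pc 0 + pc (vals s1 3) + (eta y).+1 * ((pc (N ^ 3) + pc (N ^ 3)) + 2 * pc (eta y)))).
    have := pc_le (leq0n (N ^ 3)); have := pc_le (b1 3).
    have : pc (eta y) <= pc (N ^ 3) by apply: pc_le; lia.
    by nia.
  pose I i s2 r2 := [/\ r2 = r, frame d v s s2, bounded (N ^ 3) s2, vals s2 3 = i & flag s2 = (eta x < i)].
  have ev2 i s2 r2 j : j < v -> I i s2 r2 -> vals s2 (ev j) = eta j.
    by move=> lt_j [_ f2 _ _ _]; rewrite (frame_ev f2) // ee.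
  apply: (@wp_for _ _ _ _ _ _ I) => //.
  + by lia.
  + by rewrite /ev; lia.
  + split=> //; last exact: bounded_setval.
    exact: frame_trans f1 (frame_scratch _ _ (scratch_setval _ _ _)).
  + move=> i s2 r2 lt_i I2; have [-> f2 b2 v3 fl2] := I2; split=> //; first exact: ev2 I2.
    have e20 : vals s2 0 = 0 by rewrite (frame_0 f2).
    apply: (@wp_le _ _ (pc (vals s2 3) + pc (N ^ 3))); first by rewrite leq_add2r; apply: pc_le.
    have fs s3 : frame d v s s3 -> bounded (N ^ 3) s3 -> flag s3 = (eta x < i.+1) ->
        I i.+1 (setval s3 3 i.+1) r.
      move=> f3 b3 fl3; split=> //.
        exact: frame_trans f3 (frame_scratch _ _ (scratch_setval _ _ _)).
      by apply: bounded_setval => //; lia.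
    apply: wp_test; [lia|rewrite /ev; lia| |]; rewrite cell_val v3 (ev2 _ _ _ _ _ I2) // => ix.
      apply: wp_put0 => //; first lia; split=> //; apply: fs => //.
        exact: frame_trans f2 (frame_flag _ _ _ _).
      by rewrite /flag /= /upd /=; lia.
    apply: (@wp_le _ _ 1); first exact: pc_gt0.
    by apply: wp_nop; split=> //; apply: fs => //; rewrite fl2; lia.
  + move=> s2 r2 I2; have [-> f2 b2 v3 fl2] := I2.
    by split=> //; exact: ev2 I2.
- move=> wf_p le_w; have [T pT wpT] := IH d v wf_p le_w.
  have := depth_ge d v phi => dg.
  exists (fun N => T N + (pc (N ^ 3) + pc (N ^ 3))); first by poly_tac.
  move=> N rho eta s r N0 en; apply: wp_seq; apply: wp_mono (wpT _ _ _ s r N0 en) => //.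
  move=> s1 _ [-> f1 b1 fl1]; have e10 : vals s1 0 = 0 by rewrite (frame_0 f1) (enc_0 en).
  apply: (@wp_flag N) => //; first lia; rewrite fl1 => ->;
    (apply: wp_put0 => //; first lia); split=> //;
    exact: frame_trans f1 (frame_flag _ _ _ _).
- move=> /andP[wf1 wf2] le_w.
  have := depth_ge d v phi => dg.
  have [|T1 pT1 wpT1] := IH1 d v wf1; first lia.
  have [|T2 pT2 wpT2] := IH2 d v wf2; first lia.
  exists (fun N => T1 N + (pc (N ^ 3) + (T2 N).+1)); first by poly_tac.
  move=> N rho eta s r N0 en; apply: wp_seq; apply: wp_mono (wpT1 _ _ _ s r N0 en) => //.
  move=> s1 _ [-> f1 b1 fl1]; have e10 : vals s1 0 = 0 by rewrite (frame_0 f1) (enc_0 en).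
  apply: (@wp_flag N) => //; first lia; rewrite fl1 => fl; rewrite fl /=.
    apply: wp_mono (wpT2 _ _ _ s1 r N0 (encodes_frame b1 f1 en)) => //.
    by move=> s2 r2 [-> f2 b2 fl2]; split=> //; exact: frame_trans f1 f2.
  by apply: (@wp_le _ _ 1) => //; apply: wp_nop; split=> //; rewrite fl1.
- move=> wf_p le_w; have dg := depth_ge d v.+1 phi.
  have [|T pT wpT] := IH d v.+1 wf_p; first lia.
  exists (fun N => pc (N ^ 3) + (fcost (T N + (pc (N ^ 3) + pc (N ^ 3))) N + (pc (N ^ 3) + pc (N ^ 3)))).
    have pf : poly (fun N => fcost (T N + (pc (N ^ 3) + pc (N ^ 3))) N) by apply: poly_fcost; poly_tac.
    by poly_tac.
  move=> N rho eta s r N0 en; have [e0 e1 eb ee er] := en.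
  have N_3 : N <= N ^ 3 by case: (N) N0 => // n _; rewrite expnS leq_pmulr // expn_gt0.
  apply: wp_seq; apply: wp_put0 => //; first by rewrite /accA; lia.
  set s1 := setarr _ _ _ _; have f1 : frame d v s s1 by apply: frame_accA.
  pose I i s2 := [/\ frame d v s s2, bounded (N ^ 3) s2 &
    arrs s2 (accA v) 0 = [exists a : 'I_N, (a < i) && sem d v.+1 phi rho (upd eta v a)]].
  apply: wp_seq; apply: (@wp_fore N v _ _ I) => //.
  + by lia.
  + by rewrite /ev; lia.
  + by move=> m s2 [f2 b2 _]; rewrite (frame_1 f2).
  + split; last by rewrite /= /upd eqxx /=; apply/esym/existsP => -[a].
      exact: frame_trans f1 (frame_setval _ _ _ (leqnn _)).
    exact: bounded_setval.
  + move=> i s2 lt_i [f2 b2 ac2] vi; apply: wp_seq.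
    have en2 := encodes_upd (encodes_frame b2 f2 en) (vi : vals s2 (ev v) = Ordinal lt_i).
    apply: wp_mono (wpT _ _ _ s2 r N0 en2) => // s3 _ [-> f3 b3 fl3].
    have e30 : vals s3 0 = 0 by rewrite (frame_0 f3) (frame_0 f2).
    have vi3 : vals s3 (ev v) = i by rewrite (frame_ev f3).
    have f03 : frame d v s s3 by apply: frame_trans f2 (frame_le _ _ f3).
    have acS : [exists a : 'I_N, (a < i.+1) && sem d v.+1 phi rho (upd eta v a)] =
        flag s3 || arrs s3 (accA v) 0.
      rewrite fl3 (frame_acc f3) // ac2; apply/existsP/orP => [[a /andP[]]|].
        rewrite ltnS leq_eqVlt => /orP[/eqP e sa|lt_a sa].
          by left; rewrite -(_ : a = Ordinal lt_i) //; apply: val_inj.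
        by right; apply/existsP; exists a; rewrite lt_a.
      case=> [sa|/existsP[a /andP[lt_a sa]]]; first by exists (Ordinal lt_i); rewrite /= ltnSn.
      by exists a; rewrite ltnS ltnW.
    apply: (@wp_flag N) => //; first lia; move=> fl.
      apply: wp_put0 => //; first by rewrite /accA; lia.
      split=> //; split.
      * apply: frame_trans f03 (frame_trans (frame_accA _ _ _ _) (frame_setval _ _ _ (leqnn _))).
      * by apply: bounded_setval => //; lia.
      * by rewrite acS fl /= /upd eqxx.
    apply: (@wp_le _ _ 1); first exact: pc_gt0.
    apply: wp_nop; split=> //; split.
    * exact: frame_trans f03 (frame_setval _ _ _ (leqnn _)).
    * by apply: bounded_setval => //; lia.
    * by rewrite acS fl.
  move=> s2 [f2 b2 ac2].
  have e20 : vals s2 0 = 0 by rewrite (frame_0 f2).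
  apply: (@wp_le _ _ (pc (vals s2 0) + pc (N ^ 3))); first by rewrite leq_add2r; apply: pc_le.
  have {}ac2 : arrs s2 (accA v) 0 = [exists a : 'I_N, sem d v.+1 phi rho (upd eta v a)].
    by rewrite ac2; apply: eq_existsb => a; rewrite ltn_ord.
  apply: wp_test; [lia|rewrite /accA; lia| |]; rewrite e20 cell_arr ac2 => fl.
    by apply: wp_put0 => //; first lia; split=> //; exact: frame_trans f2 (frame_flag _ _ _ _).
  apply: wp_put0 => //; first lia.
  by split=> //; [exact: frame_trans f2 (frame_flag _ _ _ _)|rewrite (negbTE fl)].
- move=> /and3P[wf0 wf1 wf2] le_w; have dg0 := depth_ge d.+1 v.+3 phi0.
  have [|T0 pT0 wpT0] := IH0 d.+1 v.+3 wf0; first lia.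
  have [|T1 pT1 wpT1] := IH1 d.+1 v.+4 wf1; first lia.
  have [|T2 pT2 wpT2] := IH2 d.+1 v wf2; first lia.
  exists (fun N => fillcost (pc (N ^ 3)) N + (fillcost (T0 N) N + (fcost (fillcost (T1 N) N) N + T2 N))).
    have pf1 : poly (fun N => fillcost (pc (N ^ 3)) N) by apply: poly_fillcost.
    have pf2 : poly (fun N => fillcost (T0 N) N) by apply: poly_fillcost.
    have pf3 : poly (fun N => fcost (fillcost (T1 N) N) N) by apply: poly_fcost; apply: poly_fillcost.
    by poly_tac.
  move=> N rho eta s r N0 en; have [e0 e1 eb ee er] := en.
  have N_3 : N <= N ^ 3 by case: (N) N0 => // n _; rewrite expnS leq_pmulr // expn_gt0.
  set q0 := (X in itr X _); set F := (X in itr _ X).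
  apply: wp_seq; apply: (@wp_fill N d v _ _ (fun _ _ _ => false)) => //; first lia.
    move=> s1 t x y f1 b1 _ vt vx vy; apply: wp_put0 => //; first lia.
      by rewrite (frame_0 f1).
    by split=> //; exact: frame_flag.
  move=> s1 f1 b1 q1; apply: wp_seq.
  have en1 := encodes_rel (encodes_frame b1 f1 en) q1; have [e10 e11 _ _ _] := en1.
  apply: (@wp_fill N d v _ _ q0) => //; first lia.
    move=> s2 t x y f2 b2 eq2 vt vx vy.
    have q2 (t' x' y' : 'I_N) : arrs s2 (relA d) (ad N t' x' y') = (fun _ _ _ => false) t' x' y'.
      by rewrite eq2 q1.
    have en2 := encodes_rel (encodes_frame b2 (frame_trans f1 f2) en) q2.
    apply: wpT0 => //; do 3!(apply: encodes_upd => //).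
  move=> s2 f2 b2 q2; apply: wp_seq.
  pose I i s3 := [/\ frame d v s s3, bounded (N ^ 3) s3 &
    forall t x y : 'I_N, arrs s3 (relA d) (ad N t x y) =
      foldl (fun q i => F i q) q0 (take i (enum 'I_N)) t x y].
  have f02 := frame_trans f1 f2.
  apply: (@wp_fore N v _ _ I) => //.
  + by lia.
  + by rewrite /ev; lia.
  + by rewrite (frame_0 f02).
  + by move=> m s3 [f3 b3 _]; rewrite (frame_1 f3).
  + split; last by rewrite take0.
      exact: frame_trans f02 (frame_setval _ _ _ (leqnn _)).
    exact: bounded_setval.
  + move=> i s3 lt_i [f3 b3 q3] vi; set q := foldl _ _ _ in q3.
    have en3 := encodes_upd (encodes_rel (encodes_frame b3 f3 en) q3) (vi : vals s3 (ev v) = Ordinal lt_i).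
    have [e30 e31 _ _ _] := en3.
    apply: (@wp_fill N d v.+1 _ _ (F (Ordinal lt_i) q)) => //; first lia.
      move=> s4 t x y f4 b4 eq4 vt vx vy.
      have q4 (t' x' y' : 'I_N) : arrs s4 (relA d) (ad N t' x' y') = q t' x' y'.
        by rewrite eq4 q3.
      have f04 : frame d v s s4 by apply: frame_trans f3 (frame_le _ _ f4).
      have en4 := encodes_rel (encodes_frame b4 f04 en) q4.
      apply: wpT1 => //; do 3!(apply: encodes_upd => //); apply: encodes_upd en4 _.
      by rewrite (frame_ev f4).
    move=> s4 f4 b4 q4; split=> //; first by rewrite (frame_ev f4).
    split.
    * apply: frame_trans f3 (frame_trans (frame_le _ _ f4) (frame_setval _ _ _ (leqnn _))) => //.
    * by apply: bounded_setval => //; lia.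
    * move=> t x y; rewrite /= q4 (take_nth (Ordinal lt_i)) ?size_enum_ord //.
      rewrite foldl_rcons (_ : nth _ _ _ = Ordinal lt_i) //.
      by apply: val_inj; rewrite /= nth_enum_ord.
  move=> s3 [f3 b3 q3].
  have en3 := encodes_rel (encodes_frame b3 f3 en) q3.
  apply: wp_mono (wpT2 _ _ _ s3 r N0 en3) => // s4 r4 [-> f4 b4 fl4]; split=> //.
    by apply: frame_trans f3 (frame_le _ _ f4).
  by rewrite fl4 take_oversize // size_enum_ord.
Qed.

End Compile.

(** * Reading the input *)

Section Parse.
Variable w : nat.
Hypothesis le_w : 60 <= w.

Local Notation pc := (pc w).
Local Notation wp := (wp w).
Local Notation For := (For w).
Local Notation Put := (Put w).
Local Notation Test := (Test w).
Local Notation Inc := (Inc w).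
Local Notation Cpy := (Cpy w).

Definition changes (P : pred nat) (s s' : store) :=
  arrs s' = arrs s /\ forall z, ~~ P z -> vals s' z = vals s z.

Lemma changes_setval (P : pred nat) s s' x v : changes P s s' -> P x -> changes P s (setval s' x v).
Proof.
case=> ea ev x_in; split=> // z z_out; rewrite /= /upd; case: eqP => [e|_]; last exact: ev.
by rewrite e x_in in z_out.
Qed.

Lemma changes_trans (P P' : pred nat) s1 s2 s3 : changes P s1 s2 -> changes P' s2 s3 ->
  (forall x, P' x -> P x) -> changes P s1 s3.
Proof.
move=> [e1 h1] [e2 h2] sub; split=> [|z z_out]; first by rewrite e2.
by rewrite h2 ?h1 //; apply: contra z_out; apply: sub.
Qed.

Definition Addv y x := For 3 x (Inc y).

Lemma wp_addv B y x (Q : store -> seq sym -> Prop) s r :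
  y.*2 < w -> x.*2 < w -> x != y -> x != 3 -> y != 3 -> 0 < y ->
  vals s 0 = 0 -> bounded B s -> vals s y + vals s x <= B ->
  (forall s', changes (pred2 3 y) s s' -> bounded B s' -> vals s' y = vals s y + vals s x -> Q s' r) ->
  wp (Addv y x) (5 * (B.+1 * pc B)) Q s r.
Proof.
move=> lt_y lt_x ne_xy ne_x3 ne_y3 y0 s0 bs le_B Qs; set a := vals s x.
have c0 : 0 < pc B := pc_gt0 _ _.
have pcB (v : nat) : v <= B -> pc v <= pc B by exact: pc_le.
have aB : a <= B by apply: bs.
apply: (@wp_le _ _ (pc 0 + pc (vals s 3) + a.+1 * (pc B + 2 * pc a))).
  by have := pcB _ (bs 3); have := pcB 0 isT; have := pcB _ aB; nia.
pose I i s' (r' : seq sym) := [/\ r' = r, changes (pred2 3 y) s s', bounded B s', vals s' 3 = i &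
  vals s' y = vals s y + i].
have ev_x i s' r' : I i s' r' -> vals s' x = a.
  by case=> _ [_ evs] _ _ _; rewrite evs //= (negbTE ne_x3) (negbTE ne_xy).
apply: (@wp_for _ _ _ _ _ _ I) => //; first lia.
- split=> //.
  + exact: changes_setval.
  + exact: bounded_setval.
  + by rewrite /= /upd (negbTE ne_y3) addn0.
- move=> i s' r' lt_i I'; have [-> ch b' e3 ey] := I'; split=> //; first exact: ev_x I'.
  apply: (@wp_le _ _ (pc (vals s' y))); first exact: pcB.
  apply: wp_inc => //; rewrite ey; split; first by rewrite /= /upd; case: eqP => //; lia.
  split=> //.
  + by do 2!(apply: changes_setval => //); rewrite /= eqxx ?orbT.
  + by apply: bounded_setval; [apply: bounded_setval => //|]; lia.
  + by rewrite /= /upd (negbTE ne_y3) eqxx addnS.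
- by move=> s' r' I'; have [-> ch b' e3 ey] := I'; split=> //; [exact: ev_x I'|apply: Qs].
Qed.

Definition Exp y x :=
  Seq (Cpy y 0) (Seq (Inc y) (For 5 x (Seq (Cpy 4 y) (Addv y 4)))).

Definition ecost B := 40 * (B.+1 * B.+1 * pc B).

Lemma wp_exp B y x (Q : store -> seq sym -> Prop) s r :
  y.*2 < w -> x.*2 < w -> x != y -> 5 < x -> 5 < y ->
  vals s 0 = 0 -> bounded B s -> 2 ^ vals s x <= B ->
  (forall s', changes (fun z => (2 < z < 6) || (z == y)) s s' -> bounded B s' ->
    vals s' y = 2 ^ vals s x -> Q s' r) ->
  wp (Exp y x) (ecost B) Q s r.
Proof.
move=> lt_y lt_x ne_xy x5 y5 s0 bs le_B Qs; set a := vals s x; set P := (fun z => _) in Qs.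
have c0 : 0 < pc B := pc_gt0 _ _.
have pcB (v : nat) : v <= B -> pc v <= pc B by exact: pc_le.
have aB : a <= B by apply: bs.
have [Px P0] : ~~ P x /\ ~~ P 0 by rewrite /P; lia.
have [[P3 P4] P5 Py] : [/\ P 3 /\ P 4, P 5 & P y] by rewrite /P eqxx ?orbT.
apply: (@wp_le _ _ (2 * pc B + (pc B + (2 * pc B + B.+1 * (2 * pc B + 5 * (B.+1 * pc B) + 2 * pc B))))).
  by rewrite /ecost; nia.
have B0 : 0 < B by apply: leq_trans le_B; rewrite expn_gt0.
apply: wp_seq; apply: (@wp_le _ _ (pc (vals s 0) + pc (vals s y))).
  by have := pcB _ (bs 0); have := pcB _ (bs y); lia.
apply: wp_cpy => //; first lia.
set s1 := setval _ _ _; have b1 : bounded B s1 by apply: bounded_setval => //; rewrite s0.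
have v1 : vals s1 y = 0 by rewrite /= /upd eqxx s0.
apply: wp_seq; apply: (@wp_le _ _ (pc (vals s1 y))); first exact: pcB.
apply: wp_inc => //; set s2 := setval _ _ _.
have b2 : bounded B s2 by apply: bounded_setval => //; rewrite v1.
have v2 : vals s2 y = 1 by rewrite /= /upd eqxx s0.
have ch2 : changes P s s2 by do 2!(apply: changes_setval => //).
apply: (@wp_le _ _ (pc 0 + pc (vals s2 5) + a.+1 * (2 * pc B + 5 * (B.+1 * pc B) + 2 * pc a))).
  by have := pcB _ (b2 5); have := pcB 0 isT; have := pcB _ aB; nia.
pose I i s' (r' : seq sym) := [/\ r' = r, changes P s s', bounded B s', vals s' 5 = i &
  vals s' y = 2 ^ i].
apply: (@wp_for _ _ _ _ _ _ I) => //; first lia.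
- by rewrite /zeroV; case: ch2 => _ ->.
- split=> //.
  + exact: changes_setval.
  + exact: bounded_setval.
  + by rewrite /= /upd; case: eqP => //; lia.
- move=> i s' r' lt_i [-> ch b' e3 ey]; have [_ evs] := ch.
  split=> //; first exact: evs.
  apply: wp_seq; apply: (@wp_le _ _ (pc (vals s' y) + pc (vals s' 4))).
    by have := pcB _ (b' y); have := pcB _ (b' 4); lia.
  apply: wp_cpy => //; try lia.
  have le_i : 2 ^ i.+1 <= B by apply: leq_trans le_B; rewrite leq_exp2l.
  set s3 := setval _ _ _; have b3 : bounded B s3.
    by apply: bounded_setval => //; rewrite ey; move: le_i; rewrite expnS; lia.
  have v3 : vals s3 y = 2 ^ i by rewrite /= /upd; case: eqP => //; lia.
  have v34 : vals s3 4 = 2 ^ i by rewrite /= /upd /= ey.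
  have v35 : vals s3 5 = i by rewrite /= /upd /=.
  apply: (@wp_addv B) => //; rewrite ?v3 ?v34 //; try lia.
  + by rewrite -/s3 /s3 /= /upd /= evs.
  + by rewrite expnS in le_i; lia.
  + move=> s4 ch4 b4 v4; split; first by case: ch4 => _ -> //=; lia.
    split=> //.
    * apply: changes_setval => //.
      apply: (changes_trans (changes_setval (s' := s') _ ch P4) ch4) => z /=.
      by rewrite /P /=; lia.
    * by apply: bounded_setval => //; lia.
    * by rewrite /= /upd; case: eqP; rewrite ?v4 ?v3 ?v34 ?expnS; lia.
- move=> s' r' [-> ch b' e3 ey]; have [_ evs] := ch; split=> //; first exact: evs.
  exact: Qs.
Qed.

(** * Walking over the input *)

Definition wx (p : prog) (T : nat) (Post : tape -> Prop) (t : tape) : Prop :=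
  exists t' n, [/\ n <= T, Ex p t t' n & Post t'].

Lemma wx_mono p T T' (Q Q' : tape -> Prop) t : T <= T' -> (forall t, Q t -> Q' t) ->
  wx p T Q t -> wx p T' Q' t.
Proof.
by move=> le_T QQ [t' [n [le_n ex Qt]]]; exists t', n; split=> //; [lia|apply: QQ].
Qed.

Lemma wx_le p T T' Q t : T <= T' -> wx p T Q t -> wx p T' Q t.
Proof. by move=> le_T; apply: wx_mono. Qed.

Lemma wx_seq p q T1 T2 Q t : wx p T1 (wx q T2 Q) t -> wx (Seq p q) (T1 + T2) Q t.
Proof.
move=> [t1 [n1 [le1 ex1 [t2 [n2 [le2 ex2 Q2]]]]]]; exists t2, (n1 + n2); split=> //.
  exact: leq_add.
exact: ExSeq ex1 ex2.
Qed.

Lemma wx_act f d (Q : tape -> Prop) t : Q (act f d t) -> wx (Act f d) 1 Q t.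
Proof. by move=> Qt; exists (act f d t), 1; split=> //; apply: ExAct. Qed.

Lemma wx_if (a : sym -> bool) p q T Q t :
  (a (hd t) -> wx p T Q t) -> (~~ a (hd t) -> wx q T Q t) -> wx (If a p q) T.+1 Q t.
Proof.
move=> wp1 wp2; have [a_t|a_t] := boolP (a (hd t)).
  have [t' [n [le_n ex Qt]]] := wp1 a_t.
  by exists t', n.+1; split=> //; apply: ExIfT.
have [t' [n [le_n ex Qt]]] := wp2 a_t.
by exists t', n.+1; split=> //; apply: ExIfF.
Qed.

Lemma wx_while (a : sym -> bool) p T n (I : nat -> tape -> Prop) (Q : tape -> Prop) t :
  I 0 t ->
  (forall i t, i < n -> I i t -> a (hd t) /\ wx p T (I i.+1) t) ->
  (forall t, I n t -> ~~ a (hd t) /\ Q t) ->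
  wx (While a p) (n * T.+1).+1 Q t.
Proof.
move=> I0 IS In.
suff main d i t1 : i + d = n -> I i t1 -> wx (While a p) (d * T.+1).+1 Q t1.
  exact: (main n 0).
elim: d i t1 => [|d IH] i t1 i_n Ii.
  rewrite addn0 in i_n; rewrite i_n in Ii; have [a_h Qt] := In _ Ii.
  by exists t1, 1; split=> //; apply: ExWhF.
have [|a_h [t2 [n2 [le2 ex2 I2]]]] := IS i t1 _ Ii; first lia.
have [|t3 [n3 [le3 ex3 Q3]]] := IH i.+1 t2 _ I2; first lia.
by exists t3, (n2 + n3).+1; split=> //; [lia|apply: ExWhT ex2 ex3].
Qed.

Definition at_home (s : store) (r : seq sym) (t : tape) : Prop :=
  exists f l, [/\ rep w f s, forall j, nth Blank l j = f j.+1 & t = (l, Hash, r)].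

Lemma wx_wp p T (Q : store -> seq sym -> Prop) s r t : wp p T Q s r -> at_home s r t ->
  wx p T (fun t' => exists s' r', at_home s' r' t' /\ Q s' r') t.
Proof.
move=> wp_p [f [l [rep_f nth_l ->]]]; have [f0 _ _] := rep_f.
have at_t : At f 0 r (l, Hash, r) by split=> //= j; rewrite add0n.
have [t' [n [f' [m' [r' [le_n ex at' [e [s' rep' Qs]]]]]]]] := wp_p f rep_f _ at_t.
exists t', n; split=> //; exists s', r'; split=> //; exists f'; have [f'0 _ _] := rep'.
move: at'; rewrite e; case: t' {ex} => [[l' h'] r''] [-> nth' ->] /=.
by exists l'; split=> //; rewrite f'0.
Qed.

Lemma wp_wx p T (Q : store -> seq sym -> Prop) s r :
  (forall t, at_home s r t -> wx p T (fun t' => exists s' r', at_home s' r' t' /\ Q s' r') t) ->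
  wp p T Q s r.
Proof.
move=> wx_p f rep_f [[l h] r0] [-> nth_l /= ->]; have [f0 _ _] := rep_f.
have [|t' [n [le_n ex [s' [r' [[f' [l' [rep' nth' e]]] Qs]]]]]] := wx_p (l, f 0, r).
  by exists f, l; split=> //; rewrite f0.
have [f'0 _ _] := rep'; rewrite e in ex.
exists (l', Hash, r'), n, f', 0, r'; split=> //.
by split=> //; exists s'.
Qed.

(** The head stands in the input, to the right of the origin, where [wp] says nothing: [pre] lies
    between the origin and the head, [ys] begins under the head, and the store waits on the left. *)
Definition scanned (s : store) (pre ys : seq sym) (t : tape) : Prop :=
  exists f l, [/\ rep w f s, forall j, nth Blank l j = f j.+1 &
    t = (rev pre ++ Hash :: l, head Blank ys, behead ys)].

Lemma scanned_hd s pre ys t : scanned s pre ys t -> hd t = head Blank ys.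
Proof. by case=> f [l [_ _ ->]]. Qed.

Lemma scanned_nil s pre t : scanned s pre [::] t -> scanned s pre [:: Blank] t.
Proof. by []. Qed.

Lemma wx_start s r (Q : tape -> Prop) t : at_home s r t -> (forall t, scanned s [::] r t -> Q t) ->
  wx MR 1 Q t.
Proof.
move=> [f [l [rep_f nth_l ->]]] QQ; apply: wx_act; apply: QQ; exists f, l; split=> //.
by rewrite /act /=; case: r.
Qed.

Lemma wx_right s pre y ys (Q : tape -> Prop) t : scanned s pre (y :: ys) t ->
  (forall t, scanned s (rcons pre y) ys t -> Q t) -> wx MR 1 Q t.
Proof.
move=> [f [l [rep_f nth_l ->]]] QQ; apply: wx_act; apply: QQ; exists f, l; split=> //.
by rewrite /act /= rev_rcons; case: ys.
Qed.

Lemma wx_left s pre z y ys (Q : tape -> Prop) t : scanned s (rcons pre z) (y :: ys) t ->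
  (forall t, scanned s pre (z :: y :: ys) t -> Q t) -> wx ML 1 Q t.
Proof.
move=> [f [l [rep_f nth_l ->]]] QQ; apply: wx_act; apply: QQ; exists f, l; split=> //.
by rewrite /act /= rev_rcons.
Qed.

Lemma wx_left0 s y ys (Q : tape -> Prop) t : scanned s [::] (y :: ys) t ->
  (forall t, at_home s (y :: ys) t -> Q t) -> wx ML 1 Q t.
Proof.
by move=> [f [l [rep_f nth_l ->]]] QQ; apply: wx_act; apply: QQ; exists f, l; split.
Qed.

Lemma wx_write x s pre ys (Q : tape -> Prop) t : scanned s pre ys t ->
  (forall t, scanned s pre (x :: behead ys) t -> Q t) -> wx (Wr x) 1 Q t.
Proof.
by move=> [f [l [rep_f nth_l ->]]] QQ; apply: wx_act; apply: QQ; exists f, l; split.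
Qed.

Lemma wx_skip (a : sym -> bool) xs s pre ys (Q : tape -> Prop) t : scanned s pre (xs ++ ys) t ->
  all a xs -> ~~ a (head Blank ys) ->
  (forall t, scanned s (pre ++ xs) ys t -> Q t) -> wx (While a MR) (size xs * 2).+1 Q t.
Proof.
move=> sc all_a na QQ.
apply: (@wx_while _ _ 1 _ (fun i => scanned s (pre ++ take i xs) (drop i xs ++ ys))).
- by rewrite take0 cats0 drop0.
- move=> i t1 lt_i sc1; have [x x_i] : exists x, nth Blank xs i = x by eexists.
  have a_x : a x by rewrite -x_i; apply: (allP all_a); apply: mem_nth.
  rewrite (drop_nth Blank) // x_i cat_cons in sc1; split; first by rewrite (scanned_hd sc1).
  by apply: (wx_right sc1) => t2; rewrite rcons_cat (take_nth Blank) // x_i.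
- by move=> t1; rewrite take_size drop_size => sc1; split; [rewrite (scanned_hd sc1)|apply: QQ].
Qed.

Definition rewind := While (fun x => x != Hash) ML.

(* Going back to the last separator in the part already scanned. *)
Lemma wx_rewind s pre mid ys y (Q : tape -> Prop) t : scanned s (pre ++ Hash :: mid) (y :: ys) t ->
  y != Hash -> Hash \notin mid ->
  (forall t, scanned s pre (Hash :: mid ++ y :: ys) t -> Q t) -> wx rewind ((size mid).+1 * 2).+1 Q t.
Proof.
move=> sc ne_y mid_h QQ.
elim/last_ind: mid ys y t sc ne_y mid_h QQ => [|mid z IH] ys y t sc ne_y mid_h QQ.
  apply: (@wx_while _ _ 1 1 (fun i => if i is 0 then scanned s (rcons pre Hash) (y :: ys)
    else scanned s pre (Hash :: y :: ys))).
  - by move: sc; rewrite cats1.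
  - move=> [|//] t1 _ sc1; split; first by rewrite (scanned_hd sc1).
    exact: (wx_left sc1).
  - by move=> t1 sc1; split; [rewrite (scanned_hd sc1)|apply: QQ].
rewrite size_rcons; move: mid_h; rewrite mem_rcons inE negb_or => /andP[ne_z mid_h].
have sc' : scanned s (rcons (pre ++ Hash :: mid) z) (y :: ys) t.
  by move: sc; rewrite -rcons_cons -rcons_cat.
have [t1 [n1 [le1 ex1 sc1]]] : wx ML 1 (scanned s (pre ++ Hash :: mid) (z :: y :: ys)) t.
  exact: (wx_left sc').
have [||t2|t2 [n2 [le2 ex2 Q2]]] := IH _ _ _ sc1; [by rewrite eq_sym|by []| |].
  by move=> sc2; apply: QQ; rewrite cat_rcons.
exists t2, (n1 + n2).+1; split=> //; first by lia.
by apply: ExWhT ex1 ex2; rewrite (scanned_hd sc).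
Qed.

Lemma wx_rewind_home s pre ys y (Q : tape -> Prop) t : scanned s pre (y :: ys) t ->
  y != Hash -> Hash \notin pre ->
  (forall t, at_home s (pre ++ y :: ys) t -> Q t) -> wx rewind ((size pre).+1 * 2).+1 Q t.
Proof.
move=> sc ne_y mid_h QQ.
elim/last_ind: pre ys y t sc ne_y mid_h QQ => [|mid z IH] ys y t sc ne_y mid_h QQ.
  apply: (@wx_while _ _ 1 1 (fun i => if i is 0 then scanned s [::] (y :: ys)
    else at_home s (y :: ys))) => //.
  - move=> [|//] t1 _ sc1; split; first by rewrite (scanned_hd sc1).
    exact: (wx_left0 sc1).
  - by move=> t1 sc1; split; [case: sc1 => f [l [_ _ ->]]|apply: QQ].
rewrite size_rcons; move: mid_h; rewrite mem_rcons inE negb_or => /andP[ne_z mid_h].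
have [t1 [n1 [le1 ex1 sc1]]] : wx ML 1 (scanned s mid (z :: y :: ys)) t.
  exact: (wx_left sc).
have [||t2|t2 [n2 [le2 ex2 Q2]]] := IH _ _ _ sc1; [by rewrite eq_sym|by []| |].
  by move=> sc2; apply: QQ; rewrite cat_rcons.
exists t2, (n1 + n2).+1; split=> //; first by lia.
by apply: ExWhT ex1 ex2; rewrite (scanned_hd sc).
Qed.

(** On a separator [rewind] would stop at once, hence the first step to the left. *)
Definition leave := Seq ML rewind.

Lemma wx_leave s pre mid ys y (Q : tape -> Prop) t : scanned s (pre ++ Hash :: mid) (y :: ys) t ->
  Hash \notin mid ->
  (forall t, scanned s pre (Hash :: mid ++ y :: ys) t -> Q t) -> wx leave ((size mid).+1 * 2 + 2) Q t.
Proof.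
move=> sc; elim/last_ind: mid sc => [|mid z _] sc mid_h QQ.
  apply: (@wx_le _ (1 + 1)) => //; apply: wx_seq.
  rewrite cats1 in sc; apply: (wx_left sc) => t1 sc1.
  by exists t1, 1; split=> //; [apply: ExWhF; rewrite (scanned_hd sc1)|apply: QQ].
rewrite size_rcons; move: mid_h; rewrite mem_rcons inE negb_or => /andP[ne_z mid_h].
apply: (@wx_le _ (1 + ((size mid).+1 * 2).+1)); first lia; apply: wx_seq.
rewrite -rcons_cons -rcons_cat in sc; apply: (wx_left sc) => t1 sc1.
apply: (wx_rewind sc1) => //; try by rewrite eq_sym.
by move=> t2 sc2; apply: QQ; rewrite cat_rcons.
Qed.

Lemma wx_leave_home s pre ys y (Q : tape -> Prop) t : scanned s pre (y :: ys) t ->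
  Hash \notin pre ->
  (forall t, at_home s (pre ++ y :: ys) t -> Q t) -> wx leave ((size pre).+1 * 2 + 2) Q t.
Proof.
move=> sc; elim/last_ind: pre sc => [|mid z _] sc mid_h QQ.
  apply: (@wx_le _ (1 + 1)) => //; apply: wx_seq.
  apply: (wx_left0 sc) => t1 sc1.
  by exists t1, 1; split=> //; [apply: ExWhF; case: sc1 => f [l [_ _ ->]]|apply: QQ].
rewrite size_rcons; move: mid_h; rewrite mem_rcons inE negb_or => /andP[ne_z mid_h].
apply: (@wx_le _ (1 + ((size mid).+1 * 2).+1)); first lia; apply: wx_seq.
apply: (wx_left sc) => t1 sc1.
apply: (wx_rewind_home sc1) => //; try by rewrite eq_sym.
by move=> t2 sc2; apply: QQ; rewrite cat_rcons.
Qed.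

Definition is_sym (x y : sym) := x == y.

(* Copies a block of 1s next to the origin, which gets erased, into the variable [v]. *)
Definition ReadN v :=
  Seq MR (Seq (While (is_sym Blank) MR) (Seq
    (While (is_sym S1) (Seq (Wr Blank) (Seq rewind (Seq (Inc v) (Seq MR (While (is_sym Blank) MR))))))
    leave)).

Definition rncost n B := 1 + (1 + ((n * (1 + (n.+2 * 2 + (pc B + (1 + n.+2 * 2)))).+1).+1 + n.+3 * 2)).

Lemma notin_nseq (x y : sym) n : x != y -> x \notin nseq n y.
Proof. by move=> ne; rewrite mem_nseq negb_and ne orbT. Qed.

Lemma wp_readN v n rest B (Q : store -> seq sym -> Prop) s : v.*2 < w -> vals s v = 0 -> n <= B ->
  (forall s', arrs s' = arrs s -> (forall x, vals s' x = upd (vals s) v n x) ->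
     Q s' (nseq n Blank ++ Hash :: rest)) ->
  wp (ReadN v) (rncost n B) Q s (nseq n S1 ++ Hash :: rest).
Proof.
move=> lt_v v0 n_B Qs; apply: wp_wx => t home_t.
apply: wx_seq; apply: (wx_start home_t) => t1 sc1.
have ne_b : ~~ is_sym Blank (head Blank (nseq n S1 ++ Hash :: rest)) by case: (n).
apply: wx_seq; apply: (@wx_skip _ [::] _ _ _ _ _ sc1) => // t2 sc2.
pose I i t := exists s', [/\ arrs s' = arrs s, (forall x, vals s' x = upd (vals s) v i x) &
  scanned s' (nseq i Blank) (nseq (n - i) S1 ++ Hash :: rest) t].
apply: wx_seq; apply: (@wx_while _ _ _ n I).
- exists s; rewrite subn0; split=> // x.
  by rewrite /upd; case: eqP => [->|].
- move=> i t3 lt_i [s' [ea ev' sc3]]; have e : n - i = (n - i.+1).+1 by lia.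
  rewrite e /= in sc3; split; first by rewrite (scanned_hd sc3).
  apply: wx_seq; apply: (wx_write sc3) => t4 /= sc4.
  apply: wx_seq; apply: (@wx_le _ ((size (nseq i Blank)).+1 * 2).+1); first by rewrite size_nseq; lia.
  apply: (wx_rewind_home sc4) => //; first exact: notin_nseq.
  move=> t5 home5; apply: wx_seq.
  have vi : vals s' v = i by rewrite ev' /upd eqxx.
  have wpi : wp (Inc v) (pc B) (fun s2 r2 => s2 = setval s' v i.+1 /\ r2 = nseq i Blank ++ Blank :: nseq (n - i.+1) S1 ++ Hash :: rest)
      s' (nseq i Blank ++ Blank :: nseq (n - i.+1) S1 ++ Hash :: rest).
    apply: (@wp_le _ _ (pc (vals s' v))); first by apply: pc_le; lia.
    by apply: wp_inc => //; rewrite vi.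
  apply: wx_mono (wx_wp wpi home5) => // t6 [s6 [r6 [home6 [e6 er6]]]].
  rewrite er6 -cat_rcons in home6.
  apply: wx_seq; apply: (wx_start home6) => t7 sc7.
  have e_rc : rcons (nseq i Blank) Blank = nseq i.+1 Blank by elim: (i) => //= j ->.
  rewrite e_rc in sc7.
  apply: (@wx_le _ (size (nseq i.+1 Blank) * 2).+1); first by rewrite size_nseq; lia.
  apply: (wx_skip sc7); first by rewrite all_nseq orbT.
    by case: (n - i.+1).
  move=> t8 sc8; exists s6; split=> //; first by rewrite e6.
  by move=> x; rewrite e6 /= /upd; case: eqP => // /eqP ne; rewrite ev' /upd (negbTE ne).
- move=> t3 [s' [ea ev' sc3]]; rewrite subnn /= in sc3; rewrite (scanned_hd sc3); split=> //.
  apply: (@wx_le _ ((size (nseq n Blank)).+1 * 2 + 2)); first by rewrite size_nseq; lia.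
  apply: (wx_leave_home sc3); first exact: notin_nseq.
  by move=> t4 home4; exists s', (nseq n Blank ++ Hash :: rest); split=> //; apply: Qs.
Qed.

Lemma nseq_rcons (A : Type) (a : A) i ys : nseq i a ++ a :: ys = nseq i.+1 a ++ ys.
Proof. by elim: i => //= i ->. Qed.

Definition Go :=
  Seq MR (Seq (While (is_sym Blank) MR) (Seq MR (Seq (While (fun x => x != Hash) MR)
    (Seq MR (While (is_sym S0) MR))))).

(** Two separators lie between the third block and the origin: [rewind] reaches the nearer one, and
    each [leave] crosses one more block. *)
Definition Return := Seq rewind (Seq leave leave).

(** The symbols already counted are turned into [S0], which [Go] skips on the next trip. *)
Definition ReadK v :=
  Seq Go (Seq (While (is_sym S1) (Seq (Wr S0) (Seq Return (Seq (Inc v) Go)))) Return).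

Definition travel n m i := 10 * (n + m + i + 5).

Lemma wx_go s n bits i ys (Q : tape -> Prop) t : Hash \notin bits ->
  at_home s (nseq n Blank ++ Hash :: bits ++ Hash :: nseq i S0 ++ ys) t ->
  ~~ is_sym S0 (head Blank ys) ->
  (forall t, scanned s (nseq n Blank ++ Hash :: bits ++ Hash :: nseq i S0) ys t -> Q t) ->
  wx Go (travel n (size bits) i) Q t.
Proof.
move=> no_h home_t ne_y QQ.
apply: (@wx_le _ (1 + ((size (nseq n Blank) * 2).+1 + (1 + ((size bits * 2).+1 +
  (1 + (size (nseq i S0) * 2).+1)))))); first by rewrite /travel !size_nseq; lia.
apply: wx_seq; apply: (wx_start home_t) => t1 sc1.
apply: wx_seq; apply: (wx_skip sc1) => //; first by rewrite all_nseq orbT.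
move=> t2 sc2; apply: wx_seq; apply: (wx_right sc2) => t3 sc3.
apply: wx_seq; apply: (wx_skip sc3) => //.
  by apply/allP => x x_in; apply: contraNneq no_h => <-.
move=> t4 sc4; apply: wx_seq; apply: (wx_right sc4) => t5 sc5.
apply: (wx_skip sc5) => //; first by rewrite all_nseq orbT.
move=> t6; rewrite /= -cats1 -!cats1 -!catA /=; apply: QQ.
Qed.

Lemma wx_return s n bits i y ys (Q : tape -> Prop) t : Hash \notin bits ->
  scanned s (nseq n Blank ++ Hash :: bits ++ Hash :: nseq i S0) (y :: ys) t -> y != Hash ->
  (forall t, at_home s (nseq n Blank ++ Hash :: bits ++ Hash :: nseq i S0 ++ y :: ys) t -> Q t) ->
  wx Return (travel n (size bits) i) Q t.
Proof.
move=> no_h sc ne_y QQ.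
apply: (@wx_le _ (((size (nseq i S0)).+1 * 2).+1 + (((size bits).+1 * 2 + 2) +
  ((size (nseq n Blank)).+1 * 2 + 2)))); first by rewrite /travel !size_nseq; lia.
rewrite -cat_cons catA in sc; apply: wx_seq; apply: (wx_rewind sc) => //; first exact: notin_nseq.
move=> t1 sc1; apply: wx_seq; apply: (wx_leave sc1) => // t2 sc2.
apply: (wx_leave_home sc2) => //; first exact: notin_nseq.
Qed.

Definition rkcost n m k B :=
  travel n m k + ((k * (1 + (travel n m k + (pc B + travel n m k))).+1).+1 + travel n m k).

Lemma travel_le n m i k : i <= k -> travel n m i <= travel n m k.
Proof. by rewrite /travel; lia. Qed.

Lemma wp_readK v n bits k B (Q : store -> seq sym -> Prop) s : v.*2 < w -> vals s v = 0 -> k <= B ->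
  Hash \notin bits ->
  (forall s', arrs s' = arrs s -> (forall x, vals s' x = upd (vals s) v k x) ->
     Q s' (nseq n Blank ++ Hash :: bits ++ Hash :: nseq k S0 ++ [:: Blank])) ->
  wp (ReadK v) (rkcost n (size bits) k B) Q s (nseq n Blank ++ Hash :: bits ++ Hash :: nseq k S1).
Proof.
move=> lt_v v0 k_B no_h Qs; apply: wp_wx => t home_t; set m := size bits.
apply: wx_seq; apply: (@wx_le _ (travel n m 0)); first exact: travel_le.
apply: (@wx_go s n bits 0 (nseq k S1)) => //; first by case: (k).
move=> t1 sc1.
pose I i t := exists s', [/\ arrs s' = arrs s, (forall x, vals s' x = upd (vals s) v i x) &
  scanned s' (nseq n Blank ++ Hash :: bits ++ Hash :: nseq i S0) (nseq (k - i) S1) t].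
apply: wx_seq; apply: (@wx_while _ _ _ k I).
- exists s; rewrite subn0; split=> // x.
  by rewrite /upd; case: eqP => [->|].
- move=> i t3 lt_i [s' [ea ev' sc3]]; have e : k - i = (k - i.+1).+1 by lia.
  rewrite e /= in sc3; split; first by rewrite (scanned_hd sc3).
  apply: wx_seq; apply: (wx_write sc3) => t4 /= sc4.
  apply: wx_seq; apply: (@wx_le _ (travel n m i)); first by apply: travel_le; lia.
  apply: (wx_return _ sc4) => // t5 home5; apply: wx_seq.
  have vi : vals s' v = i by rewrite ev' /upd eqxx.
  set r5 := (nseq n Blank ++ _) in home5.
  have wpi : wp (Inc v) (pc B) (fun s2 r2 => s2 = setval s' v i.+1 /\ r2 = r5) s' r5.
    apply: (@wp_le _ _ (pc (vals s' v))); first by apply: pc_le; lia.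
    by apply: wp_inc => //; rewrite vi.
  apply: wx_mono (wx_wp wpi home5) => // t6 [s6 [r6 [home6 [e6 er6]]]].
  have e_rc : nseq i S0 ++ S0 :: nseq (k - i.+1) S1 = nseq i.+1 S0 ++ nseq (k - i.+1) S1.
    exact: nseq_rcons.
  rewrite er6 /r5 e_rc in home6.
  apply: (@wx_le _ (travel n m i.+1)); first by apply: travel_le; lia.
  apply: (wx_go _ home6) => //; first by case: (k - i.+1).
  move=> t8 sc8; exists s6; split=> //; first by rewrite e6.
  by move=> x; rewrite e6 /= /upd; case: eqP => // /eqP ne; rewrite ev' /upd (negbTE ne).
- move=> t3 [s' [ea ev' sc3]]; rewrite subnn /= in sc3; rewrite (scanned_hd sc3); split=> //.
  apply: (wx_return _ (scanned_nil sc3)) => // t4 home4.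
  by exists s', (nseq n Blank ++ Hash :: bits ++ Hash :: nseq k S0 ++ [:: Blank]); split=> //; apply: Qs.
Qed.

(** Once the first separator is erased, the adjacency bits follow the blanks directly, and [ReadBit]
    finds the next unread bit by skipping blanks. *)
Definition Kill := Seq MR (Seq (While (is_sym Blank) MR) (Seq (Wr Blank) rewind)).

Lemma wp_kill n rest (Q : store -> seq sym -> Prop) s :
  Q s (nseq n.+1 Blank ++ rest) -> wp Kill (4 * n + 10) Q s (nseq n Blank ++ Hash :: rest).
Proof.
move=> Qs; apply: wp_wx => t home_t.
apply: (@wx_le _ (1 + ((size (nseq n Blank) * 2).+1 + (1 + ((size (nseq n Blank)).+1 * 2).+1)))).
  by rewrite !size_nseq; lia.
apply: wx_seq; apply: (wx_start home_t) => t1 sc1.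
apply: wx_seq; apply: (wx_skip sc1) => //; first by rewrite all_nseq orbT.
move=> t2 sc2; apply: wx_seq; apply: (wx_write sc2) => t3 sc3.
apply: (wx_rewind_home sc3) => //; first exact: notin_nseq.
by move=> t4 home4; exists s, (nseq n.+1 Blank ++ rest); rewrite nseq_rcons in home4.
Qed.

Definition ReadBit :=
  Seq MR (Seq (While (is_sym Blank) MR) (If (is_sym S1)
    (Seq (Wr Blank) (Seq rewind (Put 0 0 true))) (Seq (Wr Blank) (Seq rewind (Put 0 0 false))))).

Lemma wp_readbit n b rest (Q : store -> seq sym -> Prop) s : vals s 0 = 0 ->
  b \in [:: S0; S1] -> Q (setarr s 0 0 (b == S1)) (nseq n.+1 Blank ++ rest) ->
  wp ReadBit (4 * n + 10 + pc 0) Q s (nseq n Blank ++ b :: rest).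
Proof.
move=> s0 b01 Qs; apply: wp_wx => t home_t.
apply: (@wx_le _ (1 + ((size (nseq n Blank) * 2).+1 + (1 + (((size (nseq n Blank)).+1 * 2).+1 + pc 0)).+1))).
  by rewrite !size_nseq; lia.
apply: wx_seq; apply: (wx_start home_t) => t1 sc1.
apply: wx_seq; apply: (wx_skip sc1) => //; first by rewrite all_nseq orbT.
  by move: b01; rewrite !inE => /orP[] /eqP->.
rewrite cat0s => t2 sc2.
have main c : c = (b == S1) -> wx (Seq (Wr Blank) (Seq rewind (Put 0 0 c)))
    (1 + (((size (nseq n Blank)).+1 * 2).+1 + pc 0))
    (fun t' => exists s' r', at_home s' r' t' /\ Q s' r') t2.
  move=> ->; apply: wx_seq; apply: (wx_write sc2) => t3 sc3.
  apply: wx_seq; apply: (wx_rewind_home sc3) => //; first exact: notin_nseq.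
  move=> t4 home4; rewrite nseq_rcons in home4; apply: wx_wp home4.
  apply: (@wp_le _ _ (pc (vals s 0))); first by rewrite s0.
  by apply: wp_put; [lia|lia|rewrite s0].
apply: wx_if; rewrite (scanned_hd sc2) /= => e; apply: main; first by rewrite eq_sym.
by apply/esym/negbTE; rewrite eq_sym.
Qed.

Definition nV := ev 10.
Definition xV := ev 8.
Definition yV := ev 9.

Definition ReadBits :=
  For xV nV (For yV nV (Seq ReadBit (Test 1 0
    (Seq (Cpy 2 0) (Seq (Muladd w xV) (Seq (Muladd w yV) (Put (relA 0) 2 true)))) nop))).

Definition bitcost N := 4 * (N.+1 + N * N) + 10 + 5 * pc (N ^ 3) + 2 * mcost w (N ^ 3).

Definition bitscost N :=
  2 * pc (N ^ 3) + N.+1 * ((2 * pc (N ^ 3) + N.+1 * (bitcost N + 2 * pc (N ^ 3))) + 2 * pc (N ^ 3)).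

Definition keeps (s s' : store) :=
  forall z, (z < 2) || (5 < z) -> z != xV -> z != yV -> vals s' z = vals s z.

Lemma wp_readbits n N bs rest (Q : store -> seq sym -> Prop) s : (ev 15).*2 < w ->
  vals s 0 = 0 -> vals s 1 = N -> vals s nV = n -> n <= N -> bounded (N ^ 3) s ->
  size bs = n * n -> all (mem [:: S0; S1]) bs -> (forall i, arrs s (relA 0) i = false) ->
  (forall s' r', keeps s s' -> bounded (N ^ 3) s' ->
     (forall t x y : 'I_N, arrs s' (relA 0) (ad N t x y) =
        [&& t == 0 :> nat, x < n, y < n & nth Blank bs (x * n + y) == S1]) -> Q s' r') ->
  wp ReadBits (bitscost N) Q s (nseq n.+1 Blank ++ bs ++ rest).
Proof.
move=> lt_w s_0 s_1 s_n n_N bs_ size_bs all_bs arr0 Qs.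
have [N_3 N23] : N <= N ^ 3 /\ N * N <= N ^ 3.
  rewrite !expnS expn0 muln1; case: (N) => // N1; split; nia.
have c0 : 0 < pc (N ^ 3) := pc_gt0 _ _.
have pcB (v : nat) : v <= N ^ 3 -> pc v <= pc (N ^ 3) by exact: pc_le.
pose J m s' (r' : seq sym) := [/\ r' = nseq (n.+1 + m) Blank ++ drop m bs ++ rest,
  keeps s s', bounded (N ^ 3) s' & forall t x y : 'I_N, arrs s' (relA 0) (ad N t x y) =
        [&& t == 0 :> nat, x < n, y < n, x * n + y < m & nth Blank bs (x * n + y) == S1]].
have J_set m s' r' z v : J m s' r' -> z \in [:: xV; yV] -> v <= N ^ 3 -> J m (setval s' z v) r'.
  move=> [er kp b' ar] z_in le_v; split=> //; last exact: bounded_setval.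
  move=> z' lt_z' nx ny; rewrite /= /upd; case: eqP => [e|_]; last exact: kp.
  by move: z_in; rewrite -e !inE (negbTE nx) (negbTE ny).
have Jv m s' r' : J m s' r' -> [/\ vals s' 0 = 0, vals s' 1 = N & vals s' nV = n].
  by move=> [er kp b' ar]; rewrite !kp.
apply: (@wp_le _ _ (pc 0 + pc (vals s xV) + n.+1 * ((2 * pc (N ^ 3) + N.+1 * (bitcost N + 2 * pc (N ^ 3))) + 2 * pc n))).
  rewrite /bitscost; have := pcB _ (bs_ xV); have := pcB 0 isT; have : pc n <= pc (N ^ 3) by apply: pcB; lia.
  by nia.
apply: (@wp_for _ _ _ _ _ _ (fun i s' r' => J (i * n) s' r' /\ vals s' xV = i)); rewrite ?s_0 //.
- by rewrite /xV /ev in lt_w *; lia.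
- by rewrite /nV /ev in lt_w *; lia.
- split=> //; apply: J_set => //.
  split=> //; first by rewrite addn0 drop0.
  by move=> t x y; rewrite arr0; apply/esym/negbTE; rewrite !negb_and; do 3!(apply/orP; right); rewrite -leqNgt.
- move=> i s1 r1 lt_i [J1 vx]; have [v0 v1 vn] := Jv _ _ _ J1; split=> //.
  have b1 : bounded (N ^ 3) s1 by case: J1.
  apply: (@wp_le _ _ (pc 0 + pc (vals s1 yV) + n.+1 * (bitcost N + 2 * pc n))).
    have := pcB _ (b1 yV); have := pcB 0 isT; have : pc n <= pc (N ^ 3) by apply: pcB; lia.
    by nia.
  apply: (@wp_for _ _ _ _ _ _ (fun j s' r' => [/\ J (i * n + j) s' r', vals s' xV = i & vals s' yV = j])) => //.
  + by rewrite /yV /ev in lt_w *; lia.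
  + by rewrite /nV /ev in lt_w *; lia.
  + by split=> //; apply: J_set => //; rewrite addn0.
  + move=> j s2 r2 lt_j [J2 vx2 vy2]; have [v02 v12 vn2] := Jv _ _ _ J2; split=> //.
    set m := i * n + j.
    have lt_m : m < n * n.
      by apply: (@leq_trans (i.+1 * n)); [rewrite mulSn /m; lia|rewrite leq_mul2r lt_i orbT].
    have [-> kp2 b2 ar2] := J2; rewrite (drop_nth Blank) ?size_bs // cat_cons.
    have b01 : nth Blank bs m \in [:: S0; S1] by apply: (allP all_bs); rewrite mem_nth ?size_bs.
    apply: (@wp_le _ _ ((4 * (n.+1 + m) + 10 + pc 0) + (pc 0 + (2 * pc (N ^ 3) + (mcost w (N ^ 3) + (mcost w (N ^ 3) + pc (N ^ 3))))))).
      have mN : m <= N * N by apply: leq_trans (ltnW lt_m) _; apply: leq_mul.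
      by rewrite /bitcost; have := pcB 0 isT; lia.
    apply: wp_seq; apply: wp_readbit => //; set s3 := setarr _ _ _ _.
    set r3 := nseq _ Blank ++ _ ++ _.
    have e_r3 : r3 = nseq (n.+1 + m.+1) Blank ++ drop m.+1 bs ++ rest by rewrite /r3 addnS.
    have v03 : vals s3 0 = 0 by [].
    have fin s4 : keeps s s4 -> bounded (N ^ 3) s4 -> vals s4 xV = i -> vals s4 yV = j ->
        (forall p, arrs s4 (relA 0) p = if (p == ad N 0 i j) && (nth Blank bs m == S1) then true
           else arrs s2 (relA 0) p) ->
        vals s4 yV = j /\ [/\ J (i * n + j.+1) (setval s4 yV j.+1) r3,
           vals (setval s4 yV j.+1) xV = i & vals (setval s4 yV j.+1) yV = j.+1].
      move=> kp4 b4 vx4 vy4 ar4; split=> //; split.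
      - apply: J_set; [|by []|by lia].
        split=> //; first by rewrite [i * n + j.+1]addnS -/m; exact: e_r3.
        move=> t x y; rewrite ar4 ar2.
        have [e|ne] := eqVneq (ad N t x y) (ad N 0 i j); rewrite /=.
          have [||-> -> ->] := ad_inj (ltn_ord x) (ltn_ord y) _ _ e; [lia|lia|].
          rewrite eqxx lt_i lt_j /= addnS ltnSn ltnn /= -/m.
          by case: eqP.
        rewrite addnS ltnS [x * n + y <= _]leq_eqVlt; case: (t =P 0 :> nat) => //= t0.
        case: (ltnP x n) => //= lt_xn; case: (ltnP y n) => //= lt_yn.
        have [e|ne2] := eqVneq (x * n + y) (i * n + j); last by [].
        have [_ ex ey] := @ad_inj n 0 x y 0 i j lt_xn lt_yn lt_i lt_j e.
        by move: ne; rewrite /ad ex ey t0 eqxx.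
      - by rewrite /= /upd.
      - by rewrite /= /upd eqxx.
    apply: (@wp_le _ _ (pc (vals s3 0) + (2 * pc (N ^ 3) + (mcost w (N ^ 3) + (mcost w (N ^ 3) + pc (N ^ 3)))))).
      by rewrite v03.
    apply: wp_test; [lia|lia| |]; rewrite v03 (@cell_arr s3 0 0) /= /upd /= ?v02 /= => e1.
      apply: wp_seq; apply: (@wp_le _ _ (pc (vals s3 0) + pc (vals s3 2))).
        by have := pcB _ (b2 0); have := pcB _ (b2 2); rewrite /=; lia.
      apply: wp_cpy => //; [lia|lia|]; set s4 := setval _ _ _.
      have b4 : bounded (N ^ 3) s4 by apply: bounded_setval => //; rewrite v03.
      have ij_N : i * N + j < N * N.
        by apply: (@leq_trans (i.+1 * N)); [rewrite mulSn; lia|rewrite leq_mul2r; apply/orP; right; lia].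
      apply: wp_seq; apply: (@wp_muladd _ _ 0 i N) => //; [lia|rewrite /xV /ev; lia|by lia|].
      move=> s5 [ea5 ev5] b5 v5; apply: wp_seq; apply: (@wp_muladd _ _ i j N) => //.
      * by lia.
      * by rewrite /yV /ev; lia.
      * by rewrite ev5; [|left].
      * by rewrite ev5; [|left].
      * by rewrite ev5; [|right].
      * by lia.
      move=> s6 [ea6 ev6] b6 v6; apply: (@wp_le _ _ (pc (vals s6 2))); first exact: pcB.
      apply: wp_put; [lia|rewrite /relA; lia|]; rewrite v6; apply: fin => //.
      * move=> z z_ok nx ny; rewrite /= ev6; last by lia.
        rewrite ev5; last by lia.
        rewrite /= /upd; case: eqP => [ez|_]; first by lia.
        exact: kp2.
      * by rewrite /= ev6 ?ev5 //; right.
      * by rewrite /= ev6 ?ev5 //; right.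
      * by move=> p; rewrite /= ea6 ea5 /= /upd /= e1 andbT /ad; case: eqP.
    apply: (@wp_le _ _ 1); first by rewrite /mcost; lia.
    by apply: wp_nop; apply: fin => // p; rewrite /= /upd /= (negbTE e1) andbF.
  + move=> s2 r2 [J2 vx2 vy2]; have [v02 v12 vn2] := Jv _ _ _ J2; split=> //; split=> //.
    split; last by rewrite /= /upd eqxx.
    apply: J_set; [|by []|by lia].
    by rewrite mulSn addnC.
- move=> s1 r1 [J1 vx]; have [v0 v1 vn] := Jv _ _ _ J1; split=> //.
  have [_ kp1 b1 ar1] := J1; apply: Qs => // t x y; rewrite ar1.
  case: (t =P 0 :> nat) => //= _; case: ltnP => //= lt_x; case: ltnP => //= lt_y.
  rewrite (_ : x * n + y < n * n) //.
  by apply: (@leq_trans (x.+1 * n)); [rewrite mulSn; lia|rewrite leq_mul2r lt_x orbT].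
Qed.

(** * Computing the constants *)

(** Level 1 serves as [Q], level 4 as [P], level 5 as the number [L] of bits of a guess, and level 6
    as the padding [2 ^ L]. The 6 in the base gives [8 * k.+1 ^ 2 <= 64 * 2 ^ k], the bound required
    of [Q]. *)
Fixpoint tow (k i : nat) : nat := if i is i'.+1 then 2 ^ tow k i' else k + 6.

Lemma tow_ltS k i : tow k i < tow k i.+1.
Proof. by rewrite /= ltn_expl. Qed.

Lemma tow_le k i j : i <= j -> tow k i <= tow k j.
Proof.
move=> /subnK <-; elim: (j - i) => // d IH; rewrite addSn.
exact: leq_trans IH (ltnW (tow_ltS _ _)).
Qed.

Lemma double_le_exp t : 0 < t -> t + t <= 2 ^ t.
Proof. by case: t => // t _; rewrite expnS; have := ltn_expl t (isT : 1 < 2); lia. Qed.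

Definition Consts :=
  Seq (Cpy (ev 11) (ev 0)) (Seq (pow (Inc (ev 11)) 6)
 (Seq (Exp (ev 1) (ev 11)) (Seq (Exp (ev 12) (ev 1)) (Seq (Exp (ev 13) (ev 12))
 (Seq (Exp (ev 3) (ev 13)) (Seq (Exp (ev 14) (ev 3)) (Seq (Exp (ev 15) (ev 14))
 (Seq (Cpy (ev 2) (ev 1)) (Seq (Addv (ev 2) (ev 1))
 (Seq (Cpy 1 (ev 15)) (Addv 1 (ev 10)))))))))))).

Definition ccost B := 6 * ecost B + 20 * pc B + 10 * (B.+1 * pc B) + 7.

Lemma wp_pow p m T (I : nat -> store -> Prop) (Q : store -> seq sym -> Prop) s r :
  I 0 s -> (forall i s, i < m -> I i s -> wp p T (fun s' r' => I i.+1 s' /\ r' = r) s r) ->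
  (forall s, I m s -> Q s r) -> wp (pow p m) (m * T).+1 Q s r.
Proof.
elim: m I s => [|m IH] I s I0 IS In /=; first by apply: wp_nop; apply: In.
rewrite mulSn -addnS; apply: wp_seq; apply: wp_mono (IS 0 s isT I0) => // s1 _ [I1 ->].
by apply: (IH (fun i => I i.+1)) => // i s2 lt_i I2; apply: IS.
Qed.

Lemma wp_consts k n (Q : store -> seq sym -> Prop) s r :
  let N := tow k 6 + n in
  (ev 15).*2 < w -> vals s 0 = 0 -> vals s (ev 0) = k -> vals s nV = n -> bounded (N ^ 3) s ->
  (forall s', arrs s' = arrs s -> bounded (N ^ 3) s' -> vals s' 0 = 0 -> vals s' 1 = N ->
     vals s' nV = n -> vals s' (ev 0) = k -> vals s' (ev 1) = tow k 1 ->
     vals s' (ev 2) = 2 * tow k 1 -> vals s' (ev 3) = tow k 4 -> Q s' r) ->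
  wp Consts (ccost (N ^ 3)) Q s r.
Proof.
set N := tow k 6 + n; set B := N ^ 3 => /= lt_w s0 sk sn bs Qs.
have NB : N <= B by rewrite /B !expnS expn0 muln1; case: (N) => // N'; rewrite leq_pmulr // muln_gt0.
have towB i : i <= 6 -> tow k i <= B.
  by move=> le_i; apply: leq_trans NB; apply: leq_trans (leq_addr _ _); apply: tow_le.
have c0 : 0 < pc B := pc_gt0 _ _.
have pcB (v : nat) : v <= B -> pc v <= pc B by exact: pc_le.
apply: (@wp_le _ _ (2 * pc B + ((6 * pc B).+1 + (ecost B + (ecost B + (ecost B + (ecost B + (ecost B
  + (ecost B + (2 * pc B + (5 * (B.+1 * pc B) + (2 * pc B + 5 * (B.+1 * pc B))))))))))))).
  by rewrite /ccost; move: (B.+1 * pc B) (ecost B) (pc B) => *; lia.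
have evw j : j <= 15 -> (ev j).*2 < w by rewrite /ev in lt_w *; lia.
have cpyB s' x y : bounded B s' -> pc (vals s' x) + pc (vals s' y) <= 2 * pc B.
  by move=> b'; have := pcB _ (b' x); have := pcB _ (b' y); lia.
apply: wp_seq; apply: wp_le (cpyB _ (ev 0) (ev 11) bs) _; apply: wp_cpy; [exact: evw|exact: evw|by []|].
rewrite sk; set s1 := setval _ _ _.
have kB : k + 6 <= B := towB 0 isT.
have b1 : bounded B s1 by apply: bounded_setval => //; lia.
have ch1 : changes (pred1 (ev 11)) s s1 by apply: changes_setval => //=.
apply: wp_seq; apply: (@wp_pow _ _ _ (fun i s' =>
    [/\ changes (pred1 (ev 11)) s s', bounded B s' & vals s' (ev 11) = k + i])).
- by split=> //; rewrite /= /upd /= addn0.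
- move=> i s2 lt_i [ch2 b2 v2]; apply: (@wp_le _ _ (pc (vals s2 (ev 11)))); first exact: pcB.
  apply: wp_inc; first exact: evw.
  rewrite v2; split=> //; split.
  + by apply: changes_setval => //=.
  + by apply: bounded_setval => //; lia.
  + by rewrite /= /upd eqxx addnS.
move=> s2 [[ea2 ev2] b2 v2].
have z2 : vals s2 0 = 0 by rewrite ev2.
apply: wp_seq; apply: (@wp_exp B); rewrite ?evw //; first by rewrite v2; exact: (towB 1).
rewrite v2 => s3 [ea3 ev3] b3 v3; have z3 : vals s3 0 = 0 by rewrite ev3.
apply: wp_seq; apply: (@wp_exp B); rewrite ?evw //; first by rewrite v3; exact: (towB 2).
rewrite v3 => s4 [ea4 ev4] b4 v4; have z4 : vals s4 0 = 0 by rewrite ev4.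
apply: wp_seq; apply: (@wp_exp B); rewrite ?evw //; first by rewrite v4; exact: (towB 3).
rewrite v4 => s5 [ea5 ev5] b5 v5; have z5 : vals s5 0 = 0 by rewrite ev5.
apply: wp_seq; apply: (@wp_exp B); rewrite ?evw //; first by rewrite v5; exact: (towB 4).
rewrite v5 => s6 [ea6 ev6] b6 v6; have z6 : vals s6 0 = 0 by rewrite ev6.
apply: wp_seq; apply: (@wp_exp B); rewrite ?evw //; first by rewrite v6; exact: (towB 5).
rewrite v6 => s7 [ea7 ev7] b7 v7; have z7 : vals s7 0 = 0 by rewrite ev7.
apply: wp_seq; apply: (@wp_exp B); rewrite ?evw //; first by rewrite v7; exact: (towB 6).
rewrite v7 => s8 [ea8 ev8] b8 v8; have z8 : vals s8 0 = 0 by rewrite ev8.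
have q8 : vals s8 (ev 1) = tow k 1 by rewrite ev8 ?ev7 ?ev6 ?ev5 ?ev4 ?v3.
have p8 : vals s8 (ev 3) = tow k 4 by rewrite ev8 ?ev7 ?v6.
apply: wp_seq; apply: wp_le (cpyB _ (ev 1) (ev 2) b8) _; apply: wp_cpy; [exact: evw|exact: evw|by []|].
rewrite q8; set s9 := setval _ _ _.
have b9 : bounded B s9 by apply: bounded_setval => //; exact: (towB 1).
have q9 : vals s9 (ev 1) = tow k 1 by [].
have q92 : vals s9 (ev 2) = tow k 1 by [].
have qq : tow k 1 + tow k 1 <= B.
  by apply: leq_trans (towB 2 isT); apply: double_le_exp; rewrite /= expn_gt0.
apply: wp_seq; apply: (@wp_addv B); rewrite ?evw //.
  by rewrite q9 q92.
rewrite q9 q92 => s10 [ea10 ev10] b10 v10; have z10 : vals s10 0 = 0 by rewrite ev10.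
have v15 : vals s10 (ev 15) = tow k 6 by rewrite ev10.
have w1 : 1.*2 < w by lia.
apply: wp_seq; apply: wp_le (cpyB _ (ev 15) 1 b10) _; apply: wp_cpy; [exact: evw|exact: w1|by []|].
rewrite v15; set s11 := setval _ _ _.
have b11 : bounded B s11 by apply: bounded_setval => //; exact: (towB 6).
have n11 : vals s11 nV = n.
  have -> : vals s11 nV = vals s10 nV by [].
  rewrite ev10 // (_ : vals s9 nV = vals s8 nV) //.
  by rewrite ev8 // ev7 // ev6 // ev5 // ev4 // ev3 // ev2.
have k11 : vals s11 (ev 0) = k.
  have -> : vals s11 (ev 0) = vals s10 (ev 0) by [].
  rewrite ev10 // (_ : vals s9 (ev 0) = vals s8 (ev 0)) //.
  by rewrite ev8 // ev7 // ev6 // ev5 // ev4 // ev3 // ev2.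
have v11 : vals s11 1 = tow k 6 by [].
apply: (@wp_addv B); rewrite ?evw //; first by rewrite v11 n11.
rewrite v11 n11 => s12 [ea12 ev12] b12 v12; apply: Qs => //.
- by rewrite ea12 /= ea10 /= ea8 ea7 ea6 ea5 ea4 ea3 ea2.
- by rewrite ev12.
- by rewrite ev12.
- by rewrite ev12.
- by rewrite ev12 // (_ : vals s11 (ev 1) = vals s10 (ev 1)) // ev10.
- by rewrite ev12 // (_ : vals s11 (ev 2) = vals s10 (ev 2)) // v10 mul2n addnn.
- by rewrite ev12 // (_ : vals s11 (ev 3) = vals s10 (ev 3)) // ev10.
Qed.

Definition zero_store := Store (fun=> 0) (fun _ _ => false).

(** The origin is placed just left of the input. The marks at odd positions are the even tracks of
    block 0, so every variable starts at 0, and the blanks around them are empty arrays. *)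
Definition Start m := Seq ML (Seq (Wr Hash) (Seq (pow (Seq ML (Seq (Wr S1) ML)) m) home)).

Lemma wx_start_up m x xs : w = m.*2 ->
  wx (Start m) (10 * w + 10) (at_home zero_store (x :: xs)) ([::], x, xs).
Proof.
move=> ew; apply: (@wx_le _ (1 + (1 + ((m * 3).+1 + (2 * m.*2).+1)))); first lia.
apply: wx_seq; apply: wx_act; apply: wx_seq; apply: wx_act.
pose f m j := if j == 0 then Hash else if odd j && (j < m.*2) then S1 else Blank.
have at0 : At (f 0) 0 (x :: xs) ([::], Hash, x :: xs).
  by split=> //= j; rewrite nth_nil /f ltn0 andbF.
suff wpm : wpa (Seq (pow (Seq ML (Seq (Wr S1) ML)) m) home) ((m * 3).+1 + (2 * m.*2).+1)
    (fun f' m' r' => [/\ f' =1 f m, m' = 0 & r' = x :: xs]) (f 0) 0 (x :: xs).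
  have [[[l h] r'] [n [f' [m' [r0 [le_n ex at' [ef em er]]]]]]] := wpm _ at0.
  exists (l, h, r'), n; split=> //; exists (f m), l.
  move: at'; rewrite em er => -[-> nth_l ->]; split=> //.
  - split=> // [j|c i lt_c]; first by rewrite /f; case: ifP.
    rewrite /f /cell /zero_store /=; case: (boolP (odd c)) => odd_c.
      by rewrite oddD oddM ew odd_double odd_c.
    rewrite oddD oddM ew odd_double (negbTE odd_c) /=.
    case: i => [|i] /=; first by rewrite muln0 add0n; case: ltnP => //; lia.
    by case: ltnP => //; nia.
  - by move=> j; rewrite nth_l add0n ef.
  - by rewrite ef.
apply: wpa_seq.
suff wp1 d p f0 : p + d = m -> f0 =1 f p -> wpa (pow (Seq ML (Seq (Wr S1) ML)) d) (d * 3).+1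
    (fun f' m' r' => [/\ f' =1 f m, m' = m.*2 & r' = x :: xs]) f0 p.*2 (x :: xs).
  apply: wpa_mono (wp1 m 0 (f 0) _ _) => // f1 m1 r1 [ef -> ->].
  apply: wpa_home; rewrite ?ef // => j; rewrite ef /f; by case: ifP.
elim: d p f0 => [|d IH] p f0 e_p ef /=.
  by apply: wpa_nop; rewrite -e_p addn0.
have -> : (d.+1 * 3).+1 = (1 + (1 + 1)) + (d * 3).+1 by lia.
apply: wpa_seq; apply: wpa_seq; apply: wpa_ML; apply: wpa_seq; apply: wpa_Wr; apply: wpa_ML.
rewrite -doubleS; apply: IH; first by rewrite addSnnS.
move=> j; rewrite /upd ef /f; case: eqP => [->|ne] /=; first by rewrite odd_double /= doubleS ltnSn.
case: (j =P 0) => // j0; case: (boolP (odd j)) => //= odd_j.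
congr (if _ then _ else _); have := odd_double_half j; rewrite odd_j; lia.
Qed.

Lemma wx_flag s r t (b : bool) : vals s 0 = 0 -> flag s = b -> at_home s r t ->
  wx (at_cell w 1 0) (pc 0) (fun t' => (hd t' == S1) = b) t.
Proof.
move=> s0 fl [f [l [rep_f nth_l ->]]]; have [f0 _ _] := rep_f.
have at_t : At f 0 r (l, Hash, r) by split=> //= j; rewrite add0n.
have [lt0 lt1] : 0.*2 < w /\ 1 < w by split; lia.
have wpa1 := @wpa_at_cell w 1 0 (fun f' m' _ => f' = f /\ m' = (w * vals s 0 + 1).+1)
  f s r lt0 lt1 rep_f (conj erefl erefl).
have [t' [n [f' [m' [r' [le_n ex at' [e1 e2]]]]]]] := wpa1 _ at_t.
exists t', n; split=> //; first by apply: leq_trans le_n _; rewrite s0 /pc; lia.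
have [_ _ f_s] := rep_f.
by rewrite (At_hd at') e1 e2 f_s ?(@cell_arr s 0) ?s0 //; lia.
Qed.

End Parse.

(** Stated on numbers, so that it can be read in the padded universe, where the indices from [n] on
    are isolated. *)
Definition extrel (n : nat) (e : rel 'I_n) (x y : nat) : bool :=
  [exists i : 'I_n, exists j : 'I_n, [&& i == x :> nat, j == y :> nat & e i j]].

Lemma nth_allpairs (A B C : Type) (f : A -> B -> C) s t a0 b0 c0 a b : a < size s -> b < size t ->
  nth c0 [seq f x y | x <- s, y <- t] (a * size t + b) = f (nth a0 s a) (nth b0 t b).
Proof.
move=> + lt_b; elim: s a => // x s IH [|a] lt_a /=; rewrite nth_cat size_map.
  by rewrite mul0n add0n lt_b (nth_map b0).
by rewrite mulSn -addnA ltnNge leq_addr /= addKn IH.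
Qed.

(** The machine, [K] and [c] come from the formula alone; the parameter is seen only through the
    four elements and the size of the universe. *)
Theorem formula_machine (phi : fm) : wf 1 4 phi ->
  exists m (M : TM m) K c, forall n (e : rel 'I_n) k rho (eta : nat -> 'I_(tow k 6 + n)),
    (forall t x y, rho 0 t x y = (t == 0 :> nat) && extrel e x y) ->
    [/\ eta 0 = k :> nat, eta 1 = tow k 1 :> nat, eta 2 = 2 * tow k 1 :> nat & eta 3 = tow k 4 :> nat] ->
    exists2 cf, run M (K * (tow k 6 + n).+2 ^ c) (init m (encode e k)) = Some cf &
      accepting M (cfg_state cf) = sem 1 4 phi rho eta.
Proof.
move=> wf_phi; pose W := 60 + 12 * depth 1 4 phi; pose w := W.*2.
have le_w : 60 <= w by rewrite /w /W; lia.
have [|Tc pTc wp_c] := @compile_spec w phi 1 4 wf_phi; first by rewrite /w /W; lia.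
(* The parameter is read before the adjacency bits: the address at which a bit is stored depends on
   [N], hence on [k]. *)
pose body := Seq (ReadN w nV) (Seq (ReadK w (ev 0)) (Seq (Consts w) (Seq Kill
   (Seq (ReadBits w) (compile w 1 4 phi))))).
pose main := Seq (Start W) (Seq body (at_cell w 1 0)).
pose Tb N := rncost w N (N ^ 3) + (rkcost w N (N * N) N (N ^ 3) + (ccost w (N ^ 3) +
   ((4 * N + 10) + (bitscost w N + Tc N)))).
pose Tm N := (10 * w + 10) + (Tb N + pc w 0).
have pTm : poly (fun N => (Tm N).+1).
  have p_pc := poly_pc w; have p_a := poly_acost w.
  rewrite /Tm /Tb /rncost /rkcost /travel /ccost /ecost /bitscost /bitcost /mcost.
  by poly_tac.
have [K [c le_T]] := pTm.
exists (plen main).+1, (pTM main), K, c => n e k rho eta rho0 [eta0 eta1 eta2 eta3].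
set N := tow k 6 + n in rho eta rho0 eta0 eta1 eta2 eta3 *.
have tow6 : k + 6 <= tow k 6 by exact: (@tow_le k 0 6).
have N0 : 0 < N by rewrite /N; lia.
have kN : k <= N by rewrite /N; lia.
have nN : n <= N by rewrite /N; lia.
have NB : N <= N ^ 3 by rewrite !expnS expn0 muln1; case: (N) => // N'; rewrite leq_pmulr // muln_gt0.
set bits := [seq (if e i j then S1 else S0) | i <- enum 'I_n, j <- enum 'I_n].
have size_bits : size bits = n * n by rewrite size_allpairs -cardE card_ord.
have nth_bits x y : x < n -> y < n -> (nth Blank bits (x * n + y) == S1) = extrel e x y.
  move=> lt_x lt_y.
  have -> : x * n + y = x * size (enum 'I_n) + y by rewrite size_enum_ord.
  rewrite /bits (nth_allpairs _ (Ordinal lt_x) (Ordinal lt_y)) ?size_enum_ord //.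
  have := @nth_ord_enum n (Ordinal lt_x) (Ordinal lt_x) => /= ->.
  have := @nth_ord_enum n (Ordinal lt_y) (Ordinal lt_y) => /= ->.
  have -> : (if e (Ordinal lt_x) (Ordinal lt_y) then S1 else S0) == S1 = e (Ordinal lt_x) (Ordinal lt_y).
    by case: (e _ _).
  apply/idP/existsP => [e_xy|[i /existsP[j /and3P[/eqP ei /eqP ej]]]].
    by exists (Ordinal lt_x); apply/existsP; exists (Ordinal lt_y); rewrite !eqxx.
  by congr (e _ _); apply: val_inj.
have no_h : Hash \notin bits.
  by apply/negP => /allpairsPdep[i [j [_ _]]]; case: (e i j).
have all_bits : all (mem [:: S0; S1]) bits.
  by apply/allP => b /allpairsPdep[i [j [_ _ ->]]]; case: (e i j).
have wp_body : wp w body (Tb N) (fun s _ => vals s 0 = 0 /\ flag s = sem 1 4 phi rho eta)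
    zero_store (encode e k).
  have evw j : j <= 15 -> (ev j).*2 < w by rewrite /ev /w /W; lia.
  apply: wp_seq.
  apply: (@wp_le _ _ (rncost w n (N ^ 3))); first by rewrite /rncost; nia.
  apply: wp_readN => //; try (by apply: evw); try lia.
  move=> s1 ea1 ev1; apply: wp_seq.
  apply: (@wp_le _ _ (rkcost w n (size bits) k (N ^ 3))).
    have le_t : travel n (size bits) k <= travel N (N * N) N by rewrite /travel size_bits; nia.
    by rewrite /rkcost; nia.
  apply: wp_readK => //; try (by apply: evw); try lia.
  move=> s2 ea2 ev2; apply: wp_seq; apply: wp_consts => //; try (by rewrite ev2 /upd /= ?ev1).
    move=> x; rewrite ev2 /upd; case: eqP => _; first lia.
    by rewrite ev1 /upd; case: eqP => //; lia.
  move=> s3 ea3 b3 s30 s31 s3n s3k s3q s3q2 s3p; apply: wp_seq.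
  apply: (@wp_le _ _ (4 * n + 10)); first lia.
  apply: wp_kill => //; apply: wp_seq.
  apply: (@wp_readbits w le_w n N) => //; first by rewrite ea3 ea2 ea1.
  move=> s4 r4 kp4 b4 ar4.
  have en4 : encodes 1 4 rho eta s4.
    split=> //; first by rewrite kp4. by rewrite kp4.
    - case=> [|[|[|[|]]]] // _; rewrite kp4 //.
      by rewrite s3k. by rewrite s3q. by rewrite s3q2. by rewrite s3p.
    - case=> // t x y _; rewrite ar4 rho0; case: (t == 0 :> nat) => //=.
      case: ltnP => [lt_x|le_x]; first case: ltnP => [lt_y|le_y] /=; first exact: nth_bits.
        by apply/esym/existsP => -[i /existsP[j /and3P[_ /eqP ej]]]; have := ltn_ord j; lia.
      by apply/esym/existsP => -[i /existsP[j /and3P[/eqP ej]]]; have := ltn_ord i; lia.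
  apply: wp_mono (wp_c N rho eta s4 r4 N0 en4) => // s5 r5 [_ f5 _ fl5]; split=> //.
  by rewrite (frame_0 f5) kp4.
have [x [xs e_w]] : exists x xs, encode e k = x :: xs by rewrite /encode; case: (nseq n S1) => [|a b]; do 2!eexists.
have wx_main : wx main (Tm N) (fun t => (hd t == S1) = sem 1 4 phi rho eta) ([::], x, xs).
  apply: wx_seq; apply: wx_mono (wx_start_up le_w x xs (erefl : w = W.*2)) => // t1; rewrite -e_w => home1.
  apply: wx_seq; apply: wx_mono (wx_wp wp_body home1) => // t2 [s2 [r2 [home2 [s20 fl2]]]].
  exact: (wx_flag le_w s20 fl2 home2).
have [t' [nt [le_nt ex hd_t]]] := wx_main.
have pl : placed main 0 (plen main) (code main 0 (plen main)) by split; rewrite ?size_code.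
have reach := Reach_Ex ex pl.
have lt_f : nt < K * N.+2 ^ c by apply: leq_trans (le_T N); rewrite ltnS.
have [cf run_cf acc] := @run_Reach main nt (0, ([::], x, xs)) (plen main, t') _ (leq0n _) reach erefl lt_f.
exists cf; last by rewrite acc.
rewrite -run_cf e_w /= /cfg_of /=; congr (run _ _ (_, _, _, _)).
by apply: val_inj; rewrite /= inordK.
Qed.

(** * Definable predicates *)

(** A context is given semantically, for all universes at once, so that [definable] asks for one
    formula valid in every universe. Contexts are extended by pairing, and bound variables become
    projections. *)
Record ctx := Ctx {
  car : nat -> Type;
  rels : forall N, car N -> nat -> rel3 N;
  elts : forall N, car N -> nat -> 'I_N;
  nd : nat;
  nv : nat }.

(* Families of types whose values can be stored as a ternary relation. *)
Record shape := Shape {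
  sort : nat -> Type;
  emb : forall N, sort N -> rel3 N;
  bot : forall N, sort N;
  emb_bot : forall N, emb (bot N) = fun _ _ _ => false }.

Definition cel (G : ctx) : ctx := {|
  car := fun N => (car G N * 'I_N)%type;
  rels := fun N p => rels p.1;
  elts := fun N p => upd (elts p.1) (nv G) p.2;
  nd := nd G;
  nv := (nv G).+1 |}.

Definition crel (S : shape) (G : ctx) : ctx := {|
  car := fun N => (car G N * sort S N)%type;
  rels := fun N p => upd (rels p.1) (nd G) (emb p.2);
  elts := fun N p => elts p.1;
  nd := (nd G).+1;
  nv := nv G |}.

Definition pred_in (G : ctx) := forall N, car G N -> bool.

Definition definable (G : ctx) (f : pred_in G) : Prop :=
  exists2 phi, wf (nd G) (nv G) phi &
    forall N (c : car G N), sem (nd G) (nv G) phi (rels c) (elts c) = f N c.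

Definition elt_in (G : ctx) (t : forall N, car G N -> 'I_N) : Prop :=
  exists2 j, j < nv G & forall N (c : car G N), elts c j = t N c.

Definition rel_in (S : shape) (G : ctx) (s : forall N, car G N -> sort S N) : Prop :=
  exists2 j, j < nd G & forall N (c : car G N), rels c j = emb (s N c).

Lemma elt_last G : elt_in (G := cel G) (fun N p => p.2).
Proof. by exists (nv G) => //= N c; rewrite /upd eqxx. Qed.

Lemma elt_wk_el G (t : forall N, car (cel G) N -> 'I_N) t' :
  (forall N p, t N p = t' N p.1) -> elt_in (G := G) t' -> elt_in t.
Proof.
move=> tt' [j lt_j ej]; exists j; first exact: ltnW.
by move=> N c; rewrite tt' -ej /= /upd; case: eqP => // e; rewrite e ltnn in lt_j.
Qed.

Lemma elt_wk_rel S G (t : forall N, car (crel S G) N -> 'I_N) t' :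
  (forall N p, t N p = t' N p.1) -> elt_in (G := G) t' -> elt_in t.
Proof. by move=> tt' [j lt_j ej]; exists j => // N c; rewrite tt' -ej. Qed.

Lemma rel_last S G : rel_in (S := S) (G := crel S G) (fun N p => p.2).
Proof. by exists (nd G) => //= N c; rewrite /upd eqxx. Qed.

Lemma rel_wk_el S G (t : forall N, car (cel G) N -> sort S N) t' :
  (forall N p, t N p = t' N p.1) -> rel_in (G := G) t' -> rel_in t.
Proof. by move=> tt' [j lt_j ej]; exists j => // N c; rewrite tt' -ej. Qed.

Lemma rel_wk_rel S S' G (t : forall N, car (crel S' G) N -> sort S N) t' :
  (forall N p, t N p = t' N p.1) -> rel_in (G := G) t' -> rel_in t.
Proof.
move=> tt' [j lt_j ej]; exists j; first exact: ltnW.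
by move=> N c; rewrite tt' -ej /= /upd; case: eqP => // e; rewrite e ltnn in lt_j.
Qed.

Lemma def_ext G (f g : pred_in G) : (forall N c, f N c = g N c) -> definable g -> definable f.
Proof. by move=> fg [phi wf_phi sem_phi]; exists phi => // N c; rewrite sem_phi. Qed.

Lemma def_rel3 S G s (t x y : forall N, car G N -> 'I_N) :
  rel_in (S := S) s -> elt_in t -> elt_in x -> elt_in y ->
  definable (fun N c => emb (s N c) (t N c) (x N c) (y N c)).
Proof.
move=> [q lt_q eq_q] [t' lt_t et] [x' lt_x ex] [y' lt_y ey].
exists (FRel q t' x' y') => [/=|N c /=]; first by rewrite lt_q lt_t lt_x lt_y.
by rewrite eq_q et ex ey.
Qed.

Lemma def_lt G (x y : forall N, car G N -> 'I_N) : elt_in x -> elt_in y ->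
  definable (fun N c => x N c < y N c).
Proof.
move=> [x' lt_x ex] [y' lt_y ey]; exists (FLt x' y') => [/=|N c /=]; first by rewrite lt_x lt_y.
by rewrite ex ey.
Qed.

Lemma def_not G (f : pred_in G) : definable f -> definable (fun N c => ~~ f N c).
Proof. by move=> [phi wf1 sem1]; exists (FNot phi) => // N c /=; rewrite sem1. Qed.

Lemma def_and G (f g : pred_in G) : definable f -> definable g -> definable (fun N c => f N c && g N c).
Proof.
move=> [phi wf1 sem1] [psi wf2 sem2]; exists (FAnd phi psi) => [/=|N c /=]; first by rewrite wf1.
by rewrite sem1 sem2.
Qed.

Lemma def_or G (f g : pred_in G) : definable f -> definable g -> definable (fun N c => f N c || g N c).
Proof.
move=> df dg; apply: (def_ext (g := fun N c => ~~ (~~ f N c && ~~ g N c))).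
  by move=> N c; rewrite negb_and !negbK.
by apply: def_not; apply: def_and; apply: def_not.
Qed.

Lemma def_imp G (f g : pred_in G) : definable f -> definable g -> definable (fun N c => f N c ==> g N c).
Proof.
move=> df dg; apply: (def_ext (g := fun N c => ~~ f N c || g N c)).
  by move=> N c; rewrite implybE.
by apply: def_or dg; apply: def_not.
Qed.

Lemma def_eqb G (f g : pred_in G) : definable f -> definable g -> definable (fun N c => f N c == g N c).
Proof.
move=> df dg; apply: (def_ext (g := fun N c => (f N c ==> g N c) && (g N c ==> f N c))).
  by move=> N c; case: (f N c); case: (g N c).
by apply: def_and; apply: def_imp.
Qed.

Lemma def_addb G (f g : pred_in G) : definable f -> definable g -> definable (fun N c => f N c (+) g N c).
Proof.
move=> df dg; apply: (def_ext (g := fun N c => ~~ (f N c == g N c))).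
  by move=> N c; case: (f N c); case: (g N c).
by apply/def_not/def_eqb.
Qed.

Lemma def_if G (b f g : pred_in G) : definable b -> definable f -> definable g ->
  definable (fun N c => if b N c then f N c else g N c).
Proof.
move=> db df dg; apply: (def_ext (g := fun N c => (b N c && f N c) || (~~ b N c && g N c))).
  by move=> N c; case: (b N c); rewrite ?orbF.
by apply: def_or; apply: def_and => //; apply: def_not.
Qed.

Lemma def_false G : definable (fun N (c : car G N) => false).
Proof.
exists (FEx (FLt (nv G) (nv G))) => [/=|N c /=]; first by rewrite ltnSn.
by apply/existsP => -[a]; rewrite ltnn.
Qed.

Definition exb (N : nat) (f : 'I_N -> bool) : bool := [exists x, f x].
Definition allb (N : nat) (f : 'I_N -> bool) : bool := [forall x, f x].

Arguments exb : simpl never.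
Arguments allb : simpl never.

Lemma exbP N (f : 'I_N -> bool) : reflect (exists x, f x) (exb f).
Proof. exact: existsP. Qed.

Lemma allbP N (f : 'I_N -> bool) : reflect (forall x, f x) (allb f).
Proof. exact: forallP. Qed.

Lemma def_ex G (f : forall N, car G N -> 'I_N -> bool) :
  definable (G := cel G) (fun N p => f N p.1 p.2) -> definable (fun N c => exb (f N c)).
Proof.
move=> [phi wf1 sem1]; exists (FEx phi) => // N c /=; apply: eq_existsb => a.
exact: (sem1 N (c, a)).
Qed.

Lemma def_all G (f : forall N, car G N -> 'I_N -> bool) :
  definable (G := cel G) (fun N p => f N p.1 p.2) -> definable (fun N c => allb (f N c)).
Proof.
move=> df; apply: (def_ext (g := fun N c => ~~ exb (fun a => ~~ f N c a))).
  by move=> N c; rewrite /exb negb_exists; apply: eq_forallb => a; rewrite negbK.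
by apply: def_not; apply: def_ex; apply: def_not.
Qed.

(* The contexts for defining a stored value, without and with the loop index. *)
Definition cinit (S : shape) (G : ctx) := cel (cel (cel (crel S G))).
Definition cstep (S : shape) (G : ctx) := cel (cel (cel (cel (crel S G)))).

(** The embedding commutes with the rounds of the iteration, so a value of any shape can be iterated
    as if it were a relation. *)
Lemma def_itr S G (s0 : forall N, car G N -> sort S N)
    (F : forall N, car G N -> 'I_N -> sort S N -> sort S N)
    (f : forall N, car G N -> sort S N -> bool) :
  definable (G := cinit S G) (fun N p => emb (s0 N p.1.1.1.1) p.1.1.2 p.1.2 p.2) ->
  definable (G := cstep S G)
    (fun N p => emb (F N p.1.1.1.1.1 p.1.1.1.2 p.1.1.1.1.2) p.1.1.2 p.1.2 p.2) ->
  definable (G := crel S G) (fun N p => f N p.1 p.2) ->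
  definable (fun N c => f N c (itr (s0 N c) (F N c))).
Proof.
move=> [phi0 wf0 sem0] [phi1 wf1 sem1] [psi wf2 sem2].
exists (FIt phi0 phi1 psi) => [/=|N c]; first by rewrite wf0 wf1.
rewrite [LHS]/=; set q0 := (X in itr X _); set F0 := (X in itr _ X).
have e0 : q0 = emb (s0 N c).
  do 3!apply: functional_extensionality => ?.
  by rewrite /q0 -[fun _ _ _ : 'I_N => false](emb_bot S); apply: (sem0 N (c, bot S N, _, _, _)).
have eF i s : F0 i (emb s) = emb (F N c i s).
  do 3!apply: functional_extensionality => ?.
  exact: (sem1 N (c, s, i, _, _, _)).
have -> : itr q0 F0 = emb (itr (s0 N c) (F N c)).
  by rewrite e0 /itr; elim: (enum _) (s0 N c) => //= i l IH s; rewrite eF IH.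
exact: (sem2 N (c, _)).
Qed.

(** A term over an extended context either is the last component or does not mention it; matching on
    the abstracted body decides which, and in the second case the search goes on in the smaller
    context. *)
Ltac elt_tac := cbv beta;
  lazymatch goal with
  | |- @elt_in (cinit _ _) _ => unfold cinit; elt_tac
  | |- @elt_in (cstep _ _) _ => unfold cstep; elt_tac
  | |- @rel_in _ (cinit _ _) _ => unfold cinit; elt_tac
  | |- @rel_in _ (cstep _ _) _ => unfold cstep; elt_tac
  | |- @elt_in (cel ?G) ?t =>
      let b := constr:(fun N (env : car G N) (val_ : 'I_N) =>
        ltac:(let b := eval cbn [fst snd] in (t N (env, val_)) in exact b)) in
      lazymatch b with
      | fun N c a => a => exact (elt_last G)
      | fun N c a => @?t' N c => refine (@elt_wk_el G t t' (fun N p => erefl) _); elt_tac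
      end
  | |- @elt_in (crel ?S ?G) ?t =>
      let b := constr:(fun N (env : car G N) (val_ : sort S N) =>
        ltac:(let b := eval cbn [fst snd] in (t N (env, val_)) in exact b)) in
      lazymatch b with
      | fun N c a => @?t' N c => refine (@elt_wk_rel S G t t' (fun N p => erefl) _); elt_tac
      end
  | |- @rel_in ?S (cel ?G) ?t =>
      let b := constr:(fun N (env : car G N) (val_ : 'I_N) =>
        ltac:(let b := eval cbn [fst snd] in (t N (env, val_)) in exact b)) in
      lazymatch b with
      | fun N c a => @?t' N c => refine (@rel_wk_el S G t t' (fun N p => erefl) _); elt_tac
      end
  | |- @rel_in ?S (crel ?S' ?G) ?t =>
      let b := constr:(fun N (env : car G N) (val_ : sort S' N) =>
        ltac:(let b := eval cbn [fst snd] in (t N (env, val_)) in exact b)) in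
      lazymatch b with
      | fun N c a => a => exact (rel_last S G)
      | fun N c a => @?t' N c => refine (@rel_wk_rel S S' G t t' (fun N p => erefl) _); elt_tac
      end
  | _ => assumption
  end.

(** An iteration whose step is the identity stores a value as a named relation. Operators that
    expect such a relation can then be applied to any definable argument. *)
Lemma def_let S G (r : forall N, car G N -> sort S N) (f : forall N, car G N -> sort S N -> bool) :
  definable (G := cinit S G) (fun N p => emb (r N p.1.1.1.1) p.1.1.2 p.1.2 p.2) ->
  definable (G := crel S G) (fun N p => f N p.1 p.2) ->
  definable (fun N c => f N c (r N c)).
Proof.
move=> dr df; have e N (s : sort S N) : itr s (fun _ s => s) = s by rewrite /itr; elim: (enum _).
apply: (def_ext (g := fun N c => f N c (itr (r N c) (fun _ s => s)))).
  by move=> N c; rewrite e.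
apply: def_itr => //; apply: def_rel3; elt_tac.
Qed.

Program Definition shape1 : shape := {|
  sort := fun N => 'I_N -> bool;
  emb := fun N s _ _ y => s y;
  bot := fun N _ => false |}.

Program Definition shape2 : shape := {|
  sort := fun N => 'I_N -> 'I_N -> bool;
  emb := fun N s _ x y => s x y;
  bot := fun N _ _ => false |}.

(** Two sets in one relation, told apart by whether the first argument is 0. The growth process
    updates two sets together, while an iteration stores one relation. *)
Program Definition shape12 : shape := {|
  sort := fun N => (('I_N -> bool) * ('I_N -> bool))%type;
  emb := fun N s t _ y => if t == 0 :> nat then s.1 y else s.2 y;
  bot := fun N => (fun=> false, fun=> false) |}.
Next Obligation. by do 3!apply: functional_extensionality => ?; case: ifP. Qed.

Lemma def_app1 G (s : forall N, car G N -> 'I_N -> bool) (x : forall N, car G N -> 'I_N) :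
  rel_in (S := shape1) s -> elt_in x -> definable (fun N c => s N c (x N c)).
Proof. by move=> rs ex; apply: (def_rel3 rs ex ex ex). Qed.

Lemma def_app2 G (s : forall N, car G N -> 'I_N -> 'I_N -> bool) (x y : forall N, car G N -> 'I_N) :
  rel_in (S := shape2) s -> elt_in x -> elt_in y -> definable (fun N c => s N c (x N c) (y N c)).
Proof. by move=> rs ex ey; apply: (def_rel3 rs ex ex ey). Qed.

Lemma def_eq G (x y : forall N, car G N -> 'I_N) : elt_in x -> elt_in y ->
  definable (fun N c => x N c == y N c).
Proof.
move=> ex ey; apply: (def_ext (g := fun N c => ~~ (x N c < y N c) && ~~ (y N c < x N c))).
  by move=> N c; rewrite -!leqNgt -val_eqE /= eqn_leq andbC.
by apply: def_and; apply: def_not; apply: def_lt.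
Qed.

Definition isz (N : nat) (x : 'I_N) : bool := ~~ exb (fun y : 'I_N => y < x).

Lemma iszE N (x : 'I_N) : isz x = (x == 0 :> nat).
Proof.
apply/idP/eqP => [|x0]; last by apply/exbP => -[y]; rewrite x0.
case e : (x : nat) => [//|m] /exbP[].
have lt0 : 0 < N by apply: leq_ltn_trans (ltn_ord x).
by exists (Ordinal lt0); rewrite /= e.
Qed.

Lemma def_isz0 G (x : forall N, car G N -> 'I_N) : elt_in x -> definable (fun N c => isz (x N c)).
Proof. by move=> ex; apply: def_not; apply: def_ex; apply: def_lt; elt_tac. Qed.

Lemma def_isz G (x : forall N, car G N -> 'I_N) : elt_in x ->
  definable (fun N c => x N c == 0 :> nat).
Proof. by move=> ex; apply: def_ext (def_isz0 ex) => N c; rewrite iszE. Qed.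

Ltac def_step :=
  cbv beta;
  match goal with
  | H : definable ?f |- definable ?f => exact: H
  | |- @definable ?G (fun N c => @?f N c && @?g N c) => apply: (@def_and G f g)
  | |- @definable ?G (fun N c => @?f N c || @?g N c) => apply: (@def_or G f g)
  | |- @definable ?G (fun N c => @?f N c ==> @?g N c) => apply: (@def_imp G f g)
  | |- @definable ?G (fun N c => @?f N c (+) @?g N c) => apply: (@def_addb G f g)
  | |- definable (fun N c => false) => exact: def_false
  | |- @definable ?G (fun N c => ~~ @?f N c) => apply: (@def_not G f)
  | |- @definable ?G (fun N c => exb (@?f N c)) => apply: (@def_ex G f)
  | |- @definable ?G (fun N c => allb (@?f N c)) => apply: (@def_all G f)
  | |- @definable ?G (fun N c => isz (@?x N c)) => apply: (@def_isz0 G x); elt_tac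
  | |- @definable ?G (fun N c => nat_of_ord (@?x N c) == 0) => apply: (@def_isz G x); elt_tac
  | |- @definable ?G (fun N c => nat_of_ord (@?x N c) < nat_of_ord (@?y N c)) =>
      apply: (@def_lt G x y); elt_tac
  | |- @definable ?G (fun N c => @?x N c == @?y N c) =>
      first [apply: (@def_eq G x y); elt_tac | apply: (@def_eqb G x y)]
  | |- @definable _ (fun N c => if _ then _ else _) => apply: def_if
  | |- @definable ?G ?f =>
      let y := constr:(fun N (env : car G N) => ltac:(let b := eval cbv beta in (f N env) in
        match b with _ ?y => exact y end)) in
      let h := constr:(fun N (env : car G N) => ltac:(let b := eval cbv beta in (f N env) in
        match b with ?h _ => exact h end)) in
      first
      [ apply: (@def_app1 G h y); solve [elt_tac]
      | let s := constr:(fun N (env : car G N) => ltac:(let b := eval cbv beta in (h N env) in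
          match b with ?s _ => exact s end)) in
        let x := constr:(fun N (env : car G N) => ltac:(let b := eval cbv beta in (h N env) in
          match b with _ ?x => exact x end)) in
        apply: (@def_app2 G s x y); solve [elt_tac] ]
  end.

Ltac def_tac := cbn [emb sort shape1 shape2 fst snd]; repeat def_step.

(* The definability premises of operators that bind one or two elements. *)
Notation lam1 G s := (definable (G := cinit shape1 G) (fun N p => s N p.1.1.1.1 p.2)).
Notation lam2 G r := (definable (G := cinit shape2 G) (fun N p => r N p.1.1.1.1 p.1.2 p.2)).

(** * Connectivity and counting by iteration *)

Definition conn (N : nat) (r : 'I_N -> 'I_N -> bool) : 'I_N -> 'I_N -> bool := connect r.

(** After [k] rounds the relation holds exactly between the ends of paths with fewer than [k] arcs,
    and a path without repetition has fewer than [N]. *)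
Lemma connE N (r : 'I_N -> 'I_N -> bool) x y :
  conn r x y = itr (fun _ _ => false)
    (fun (_ : 'I_N) (q : 'I_N -> 'I_N -> bool) x y => (x == y) || exb (fun z => q x z && r z y)) x y.
Proof.
set F := (X in itr _ X); pose I k (q : 'I_N -> 'I_N -> bool) :=
  forall x y, q x y <-> exists2 p, path r x p /\ size p < k & last x p = y.
suff: I N (itr (fun _ _ => false) F).
  move=> /(_ x y) [q1 q2]; apply/idP/idP.
    move=> /connectP[p pp ey]; case: (shortenP pp) ey => p' pp' up' _ ey.
    apply: q2; exists p' => //; split=> //.
    by have := max_card (mem (x :: p')); rewrite (card_uniqP up') card_ord.
  by move=> /q1[p [pp _] <-]; apply/connectP; exists p.
apply: itr_ind => [x1 y1|i q Iq x1 y1]; first by split=> // -[p []].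
rewrite /F; split.
  move=> /orP[/eqP<-|/exbP[z /andP[/Iq[p [pp sz] e] rzy]]]; first by exists [::].
  by exists (rcons p y1); rewrite ?last_rcons // rcons_path pp e rzy size_rcons.
case; elim/last_ind => [|p z _] [pp sz] /=; first by move->; rewrite eqxx.
rewrite last_rcons => <-; apply/orP; right; apply/exbP; exists (last x1 p).
move: pp sz; rewrite rcons_path size_rcons ltnS => /andP[pp ->] sz; rewrite andbT.
by apply/Iq; exists p.
Qed.

Lemma def_conn_var G (r : forall N, car G N -> 'I_N -> 'I_N -> bool) (x y : forall N, car G N -> 'I_N) :
  rel_in (S := shape2) r -> elt_in x -> elt_in y ->
  definable (fun N c => conn (r N c) (x N c) (y N c)).
Proof.
move=> dr dx dy; apply: def_ext (fun N c => connE _ _ _) _.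
apply: (@def_itr shape2 G (fun N c _ _ => false)
  (fun N c _ q x y => (x == y) || exb (fun z => q x z && r N c z y))
  (fun N c q => q (x N c) (y N c))); def_tac.
Qed.

Lemma def_conn G (r : forall N, car G N -> 'I_N -> 'I_N -> bool) (x y : forall N, car G N -> 'I_N) :
  lam2 G r -> elt_in x -> elt_in y ->
  definable (fun N c => conn (r N c) (x N c) (y N c)).
Proof.
move=> dr dx dy; apply: (@def_let shape2 G r (fun N c q => conn q (x N c) (y N c))); def_tac.
by apply: def_conn_var; elt_tac.
Qed.

Definition succ N (x y : 'I_N) := (x < y) && ~~ exb (fun z : 'I_N => (x < z) && (z < y)).

Lemma succE N (x y : 'I_N) : succ x y = (y == x.+1 :> nat).
Proof.
apply/andP/eqP => [[lt_xy /exbP no_z]|e]; last first.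
  by rewrite e ltnSn; split=> //; apply/exbP => -[z /andP[]]; lia.
apply/eqP; rewrite eqn_leq lt_xy andbT leqNgt; apply/negP => lt_x.
have lt_N : x.+1 < N by apply: leq_ltn_trans (ltn_ord y); apply: ltnW.
by apply: no_z; exists (Ordinal lt_N); rewrite /= ltnSn.
Qed.

Lemma def_succ G (x y : forall N, car G N -> 'I_N) : elt_in x -> elt_in y ->
  definable (fun N c => succ (x N c) (y N c)).
Proof. by move=> dx dy; rewrite /succ; def_tac. Qed.

(* Sets of the form [{j | j < m}] serve as counters. *)
Definition bump_if N (b : bool) (s : 'I_N -> bool) : 'I_N -> bool :=
  fun j => if b then isz j || exb (fun l => succ l j && s l) else s j.

Lemma bump_ifE N b (s : 'I_N -> bool) m : (forall j, s j = (j < m)) ->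
  forall j, bump_if b s j = (j < m + b).
Proof.
move=> sm j; rewrite /bump_if; case: b; last by rewrite addn0.
rewrite addn1 ltnS iszE; case e : (nat_of_ord j) => [|i] //=.
have lt_N : i < N by have := ltn_ord j; rewrite e => /ltnW.
apply/exbP/idP => [[l /andP[]]|lt_i].
  by rewrite succE sm e eqSS => /eqP->.
by exists (Ordinal lt_N); rewrite succE sm e /= eqxx.
Qed.

Definition count1 N (s : 'I_N -> bool) : 'I_N -> bool := itr (fun=> false) (fun i => bump_if (s i)).

Lemma card_ltS N (s : 'I_N -> bool) (i : 'I_N) :
  #|[pred x : 'I_N | (x < i.+1) && s x]| = #|[pred x : 'I_N | (x < i) && s x]| + s i.
Proof.
rewrite (cardD1 i) inE /= ltnSn /= addnC; congr (_ + _); apply: eq_card => x.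
rewrite !inE ltnS leq_eqVlt -val_eqE /=; case: (x =P i :> nat) => [->|] //=.
by rewrite ltnn.
Qed.

Lemma count1E N (s : 'I_N -> bool) j : count1 s j = (j < #|[pred x | s x]|).
Proof.
suff -> : #|[pred x | s x]| = #|[pred x : 'I_N | (x < N) && s x]|.
  pose I i (q : 'I_N -> bool) := forall j, q j = (j < #|[pred x : 'I_N | (x < i) && s x]|).
  suff: I N (count1 s) by apply.
  apply: itr_ind.
    by move=> j1; rewrite eq_card0.
  by move=> i q Iq j1; rewrite (bump_ifE _ Iq) card_ltS.
by apply: eq_card => x; rewrite !inE ltn_ord.
Qed.

Definition cardle N (s : 'I_N -> bool) (m : 'I_N) : bool := #|[pred x | s x]| <= m.

Lemma def_bump_if G (b : pred_in G) (s : forall N, car G N -> 'I_N -> bool) (x : forall N, car G N -> 'I_N) :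
  definable b -> rel_in (S := shape1) s -> elt_in x ->
  definable (fun N c => bump_if (b N c) (s N c) (x N c)).
Proof.
move=> db ds dx; rewrite /bump_if /succ; apply: def_if => //; def_tac.
Qed.

Lemma def_cardle_var G (s : forall N, car G N -> 'I_N -> bool) (m : forall N, car G N -> 'I_N) :
  rel_in (S := shape1) s -> elt_in m -> definable (fun N c => cardle (s N c) (m N c)).
Proof.
move=> ds dm; apply: (def_ext (g := fun N c => ~~ count1 (s N c) (m N c))).
  by move=> N c; rewrite count1E -leqNgt.
apply: def_not; apply: (@def_itr shape1 G (fun N c _ => false)
  (fun N c i q => bump_if (s N c i) q) (fun N c q => q (m N c))); def_tac.
by apply: def_bump_if; def_tac; elt_tac.
Qed.

Lemma def_cardle G (s : forall N, car G N -> 'I_N -> bool) (m : forall N, car G N -> 'I_N) :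
  lam1 G s -> elt_in m -> definable (fun N c => cardle (s N c) (m N c)).
Proof.
move=> ds dm; apply: (@def_let shape1 G s (fun N c q => cardle q (m N c))); def_tac.
by apply: def_cardle_var; elt_tac.
Qed.

Definition card2le N (r : 'I_N -> 'I_N -> bool) (m : 'I_N) : bool :=
  #|[pred p : 'I_N * 'I_N | r p.1 p.2]| <= m.

Definition count2 N (r : 'I_N -> 'I_N -> bool) : 'I_N -> bool :=
  itr (fun=> false) (fun a s => itr s (fun b => bump_if (r a b))).

Lemma card_pairs (T : finType) (r : T -> T -> bool) :
  #|[pred p : T * T | r p.1 p.2]| = \sum_a #|[pred b | r a b]|.
Proof.
rewrite -sum1_card (eq_bigr (fun a => \sum_(b | r a b) 1)).
  by rewrite pair_big_dep /=; apply: eq_bigl => -[].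
by move=> a _; rewrite -sum1_card.
Qed.

(** A counter is a set of elements and saturates at [N], though there may be more pairs than that;
    its comparison with an element remains exact. *)
Lemma count2E N (r : 'I_N -> 'I_N -> bool) j :
  count2 r j = (j < #|[pred p : 'I_N * 'I_N | r p.1 p.2]|).
Proof.
rewrite card_pairs.
have -> : \sum_a #|[pred b | r a b]| = \sum_(a < N | a < N) #|[pred b | r a b]|.
  by apply: eq_bigl => a; rewrite ltn_ord.
pose I i (q : 'I_N -> bool) := forall j, q j = (j < \sum_(a < N | a < i) #|[pred b | r a b]|).
suff: I N (count2 r) by apply.
apply: itr_ind => [j1|]; first by rewrite big_pred0.
move=> a q Iq.
have e_sum : \sum_(a0 < N | a0 < a.+1) #|[pred b | r a0 b]| =
    \sum_(a0 < N | a0 < a) #|[pred b | r a0 b]| + #|[pred b : 'I_N | (b < N) && r a b]|.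
  rewrite (bigD1 a) ?ltnSn //= addnC; congr (_ + _).
    apply: eq_bigl => a0; rewrite ltnS leq_eqVlt -val_eqE /=.
    by case: (a0 =P a :> nat) => [->|] //=; rewrite ?ltnn ?andbT.
  by apply: eq_card => b; rewrite !inE ltn_ord.
move=> j1; rewrite e_sum; pose J i (q' : 'I_N -> bool) := forall j, q' j =
  (j < \sum_(a0 < N | a0 < a) #|[pred b | r a0 b]| + #|[pred b : 'I_N | (b < i) && r a b]|).
suff: J N (itr q (fun b => bump_if (r a b))) by apply.
apply: itr_ind => [j2|]; first by rewrite [X in _ + X]eq_card0 ?addn0.
by move=> i q' Iq' j2; rewrite (bump_ifE _ Iq') card_ltS addnA.
Qed.

Lemma def_card2le_var G (r : forall N, car G N -> 'I_N -> 'I_N -> bool) (m : forall N, car G N -> 'I_N) :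
  rel_in (S := shape2) r -> elt_in m -> definable (fun N c => card2le (r N c) (m N c)).
Proof.
move=> ds dm; apply: (def_ext (g := fun N c => ~~ count2 (r N c) (m N c))).
  by move=> N c; rewrite count2E -leqNgt.
apply: def_not; apply: (@def_itr shape1 G (fun N c _ => false)
  (fun N c a q => itr q (fun b => bump_if (r N c a b))) (fun N c q => q (m N c))); def_tac.
apply: (@def_itr shape1 (cstep shape1 G) (fun N p => p.1.1.1.1.2)
  (fun N p b q => bump_if (r N p.1.1.1.1.1 p.1.1.1.2 b) q) (fun N p q => q p.2)); def_tac.
by apply: def_bump_if; def_tac; elt_tac.
Qed.

Lemma def_card2le G (r : forall N, car G N -> 'I_N -> 'I_N -> bool) (m : forall N, car G N -> 'I_N) :
  lam2 G r -> elt_in m -> definable (fun N c => card2le (r N c) (m N c)).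
Proof.
move=> ds dm; apply: (@def_let shape2 G r (fun N c q => card2le q (m N c))); def_tac.
by apply: def_card2le_var; elt_tac.
Qed.

(** * Rank of a graph *)

Section Rank.
Variable N : nat.
Implicit Types (F G C : 'I_N -> 'I_N -> bool) (U : 'I_N -> bool) (x y z a b : 'I_N).

Definition nonmin C x : bool := exb (fun y => (y < x) && C x y).

Record equivr C : Prop := Equivr {
  equivr_refl : forall x, C x x;
  equivr_sym : forall x y, C x y = C y x;
  equivr_trans : forall y x z, C x y -> C y z -> C x z }.

Arguments nonmin : simpl never.

Lemma nonminP C x : reflect (exists2 y : 'I_N, y < x & C x y) (nonmin C x).
Proof. by apply: (iffP (exbP _)) => [[y /andP[]]|[y lt_y Cxy]]; exists y => //; rewrite lt_y. Qed.

Lemma least_rep C x : equivr C -> exists2 y, C x y & ~~ nonmin C y.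
Proof.
case=> C1 C2 C3; have [m] := ubnP (x : nat); elim: m x => // m IH x; rewrite ltnS => le_x.
have [/nonminP[y lt_y Cxy]|no_x] := boolP (nonmin C x); last by exists x.
have [|z Cyz no_z] := IH y; first exact: leq_trans le_x.
by exists z => //; apply: C3 Cxy Cyz.
Qed.

Lemma least_unique C x y : equivr C -> C x y -> ~~ nonmin C x -> ~~ nonmin C y -> x = y.
Proof.
move=> [C1 C2 C3] Cxy /nonminP no_x /nonminP no_y; apply/val_inj/eqP; rewrite /= eqn_leq.
rewrite leqNgt; apply/andP; split.
  by apply/negP => lt; apply: no_x; exists y.
by rewrite leqNgt; apply/negP => lt; apply: no_y; exists x => //; rewrite C2.
Qed.

Lemma conn_equivr F : symmetric F -> equivr (conn F).
Proof.
by move=> symF; split; [exact: connect0|exact: sym_connect_sym|exact: connect_trans].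
Qed.

Lemma conn_sub F G : (forall x y, F x y -> conn G x y) -> forall x y, conn F x y -> conn G x y.
Proof.
move=> FG x y /connectP[p]; elim: p x => [|z p IH] x /=; first by move=> _ ->; apply: connect0.
by move=> /andP[Fxz pp] ey; apply: connect_trans (FG _ _ Fxz) (IH _ pp ey).
Qed.

Lemma eq_conn F G : F =2 G -> conn F =2 conn G.
Proof. exact: eq_connect. Qed.

(** For symmetric [F] each component has exactly one minimal vertex, so this is the number of
    vertices minus the number of components: the rank of the graphic matroid, in a form that only
    needs counting. *)
Definition rk F : nat := #|[pred x | nonmin (conn F) x]|.

Lemma eq_rk F G : F =2 G -> rk F = rk G.
Proof.
by move=> FG; apply: eq_card => x; apply: eq_existsb => y; rewrite (eq_conn FG).
Qed.

Lemma rk_le F G : (forall x y, F x y -> conn G x y) -> rk F <= rk G.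
Proof.
move=> FG; apply/subset_leq_card/subsetP => x; rewrite !inE => /nonminP[y lt_y /(conn_sub FG) Gxy].
by apply/nonminP; exists y.
Qed.

Definition addedge F a b x y : bool :=
  [|| F x y, (x == a) && (y == b) | (x == b) && (y == a)].

Lemma conn_addedge F a b x y : symmetric F ->
  conn (addedge F a b) x y =
  [|| conn F x y, conn F x a && conn F b y | conn F x b && conn F a y].
Proof.
move=> symF; have [C1 C2 C3] := conn_equivr symF; set G := addedge F a b.
have FG u v : conn F u v -> conn G u v.
  by apply: conn_sub => u' v' Fuv; apply: connect1; rewrite /G /addedge Fuv.
have Gab : conn G a b by apply: connect1; rewrite /G /addedge !eqxx orbT.
have Gba : conn G b a by apply: connect1; rewrite /G /addedge !eqxx !orbT.
apply/idP/or3P => [|[xy|/andP[xa by_]|/andP[xb ay]]]; last 3 first.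
- exact: FG.
- exact: connect_trans (FG _ _ xa) (connect_trans Gab (FG _ _ by_)).
- exact: connect_trans (FG _ _ xb) (connect_trans Gba (FG _ _ ay)).
- move=> /connectP[p]; elim: p x => [|z p IH] x /=; first by move=> _ ->; constructor 1; apply: connect0.
  move=> /andP[Gxz pp] ey; have := IH _ pp ey.
  case/or3P: Gxz => [Fxz|/andP[/eqP-> /eqP->]|/andP[/eqP-> /eqP->]].
  + have Cxz : conn F x z by apply: connect1.
    case=> [zy|/andP[za by_]|/andP[zb ay]].
    * by constructor 1; apply: C3 Cxz zy.
    * by constructor 2; rewrite by_ (C3 _ _ _ Cxz za).
    * by constructor 3; rewrite ay (C3 _ _ _ Cxz zb).
  + case=> [zy|/andP[za by_]|/andP[zb ay]].
    * by constructor 2; rewrite C1.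
    * by constructor 1; apply: C3 by_; rewrite C2.
    * by constructor 1.
  + case=> [zy|/andP[za by_]|/andP[zb ay]].
    * by constructor 3; rewrite C1.
    * by constructor 1.
    * by constructor 1; apply: C3 ay; rewrite C2.
Qed.

(** An edge inside a component changes nothing. Otherwise two components merge, and the larger [rb]
    of their minima is the one vertex that stops being minimal. *)
Lemma rk_addedge F a b : symmetric F -> rk (addedge F a b) = rk F + ~~ conn F a b.
Proof.
move=> symF; have eF := conn_equivr symF; have [C1 C2 C3] := eF.
have [Fab|nFab] := boolP (conn F a b); rewrite /= ?addn0.
  apply/eqP; rewrite eqn_leq; apply/andP; split; last first.
    by apply: rk_le => x y Fxy; apply: connect1; rewrite /addedge Fxy.
  apply: rk_le => x y /or3P[|/andP[/eqP-> /eqP->]|/andP[/eqP-> /eqP->]] //.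
    exact: connect1.
  by rewrite C2.
wlog [ra [rb [ara nra brb nrb lt_r]]] : a b nFab / exists ra rb,
    [/\ conn F a ra, ~~ nonmin (conn F) ra, conn F b rb, ~~ nonmin (conn F) rb & (ra < rb)].
  move=> W; have [ra ara nra] := least_rep a eF; have [rb brb nrb] := least_rep b eF.
  have [lt|lt|e] := ltngtP ra rb.
  - by apply: W => //; exists ra, rb.
  - rewrite (@eq_rk _ (addedge F b a)); last by move=> x y; rewrite /addedge [X in _ || X]orbC.
    by apply: W; [rewrite C2|exists rb, ra].
  - by case/negP: nFab; apply: C3 ara _; rewrite (val_inj e) C2.
rewrite /rk (cardD1 rb) inE [X in nat_of_bool X](_ : _ = true); last first.
  apply/nonminP; exists ra => //; rewrite conn_addedge //; apply/or3P; constructor 3.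
  by rewrite C2 brb.
rewrite addnC; congr (_ + _); apply: eq_card => x; rewrite !inE.
apply/andP/idP => [[ne_x /nonminP[y lt_y]]|/nonminP[y lt_y Fxy]].
  rewrite conn_addedge // => /or3P[Fxy|/andP[xa by_]|/andP[xb ay]]; first by apply/nonminP; exists y.
    have [//|nx] := boolP (nonmin (conn F) x); have ex : x = ra.
      by apply: (least_unique eF) => //; apply: C3 xa ara.
    have /nonminP[] : ~~ nonmin (conn F) rb by [].
    exists y; last by apply: C3 by_; rewrite C2.
    by apply: leq_trans lt_y _; rewrite ex ltnW.
  have [//|nx] := boolP (nonmin (conn F) x); case/negP: ne_x; apply/eqP.
  by apply: (least_unique eF) => //; apply: C3 xb brb.
split; first by apply/eqP => e; case/negP: nrb; rewrite -e; apply/nonminP; exists y.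
by apply/nonminP; exists y => //; rewrite conn_addedge // Fxy.
Qed.

(** Graphs as lists of edges, for inductions that add one edge at a time. *)
Definition srels (s : seq ('I_N * 'I_N)) x y : bool := ((x, y) \in s) || ((y, x) \in s).

Definition unionr F G x y : bool := F x y || G x y.

Lemma srels_sym s : symmetric (srels s).
Proof. by move=> x y; rewrite /srels orbC. Qed.

Lemma unionr_sym F G : symmetric F -> symmetric G -> symmetric (unionr F G).
Proof. by move=> sF sG x y; rewrite /unionr sF sG. Qed.

Lemma srels_cons F a b s :
  unionr F (srels ((a, b) :: s)) =2 addedge (unionr F (srels s)) a b.
Proof.
move=> x y; rewrite /unionr /addedge /srels !inE !xpair_eqE.
by case: (F x y); case: (x == a); case: (y == b); case: (x == b); case: (y == a);
  case: ((x, y) \in s); case: ((y, x) \in s).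
Qed.

Lemma srels_enum F : symmetric F -> F =2 srels (enum [pred p | F p.1 p.2]).
Proof. by move=> sF x y; rewrite /srels !mem_enum !inE /= [F y x]sF orbb. Qed.

(* Whether an edge outside [U] joins two components only depends on the trace
   on the boundary of the components of the graph inside [U]. *)
Lemma rk_glue F1 G1 F2 U (B : 'I_N -> bool) :
  symmetric F1 -> symmetric G1 -> symmetric F2 ->
  (forall x y, F1 x y -> U x) -> (forall x y, G1 x y -> U x) ->
  (forall x y, F2 x y -> U x -> B x) ->
  (forall x y, B x -> B y -> conn F1 x y = conn G1 x y) ->
  rk F1 = rk G1 -> rk (unionr F1 F2) = rk (unionr G1 F2).
Proof.
move=> sF1 sG1 sF2 UF UG BF2 eqB eq_rk1; pose out x := ~~ U x || B x.
have out1 F x y : symmetric F -> (forall x y, F x y -> U x) -> ~~ U x -> conn F x y = (x == y).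
  move=> sF UF' nU; apply/idP/eqP => [/connectP[[|z p] /= pp ->] //|->]; last exact: connect0.
  by case/andP: pp => /UF' Ux; rewrite Ux in nU.
suff main s : {in s, forall p, out p.1 && out p.2} ->
    rk (unionr F1 (srels s)) = rk (unionr G1 (srels s)) /\
    (forall x y, out x -> out y -> conn (unionr F1 (srels s)) x y = conn (unionr G1 (srels s)) x y).
  have [|e _] := main (enum [pred p | F2 p.1 p.2]).
    move=> [x y]; rewrite mem_enum inE /= => Fxy; rewrite /out.
    by apply/andP; split; rewrite -implybE; apply/implyP; [apply: BF2 Fxy|apply: BF2; rewrite sF2; exact: Fxy].
  rewrite (eq_rk (G := unionr F1 (srels (enum [pred p | F2 p.1 p.2])))); last first.
    by move=> x y; rewrite /unionr -srels_enum.
  rewrite e; apply: eq_rk => x y; by rewrite /unionr -srels_enum.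
elim: s => [_|[a b] s IH out_s].
  have nilE F : unionr F (srels [::]) =2 F by move=> x y; rewrite /unionr orbF.
  split; first by rewrite !(eq_rk (nilE _)).
  move=> x y out_x out_y; rewrite !(eq_conn (nilE _)).
  have [Ux|nUx] := boolP (U x); last by rewrite !out1.
  have [Uy|nUy] := boolP (U y).
    by apply: eqB; [move: out_x|move: out_y]; rewrite /out ?Ux ?Uy.
  have [_ C2 _] := conn_equivr sF1; have [_ C2' _] := conn_equivr sG1.
  by rewrite C2 C2' !out1.
have [|e1 e2] := IH; first by move=> p p_s; apply: out_s; rewrite inE p_s orbT.
have /andP[/= out_a out_b] : out (a, b).1 && out (a, b).2 by apply: out_s; rewrite inE eqxx.
have sF : symmetric (unionr F1 (srels s)) by apply: unionr_sym => //; apply: srels_sym.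
have sG : symmetric (unionr G1 (srels s)) by apply: unionr_sym => //; apply: srels_sym.
split; first by rewrite !(eq_rk (srels_cons _ _ _ _)) !rk_addedge // e1 e2.
by move=> x y out_x out_y; rewrite !(eq_conn (srels_cons _ _ _ _)) !conn_addedge // !e2.
Qed.

Lemma rk_nil : rk (srels [::]) = 0.
Proof.
apply: eq_card0 => x; rewrite !inE; apply/nonminP => -[y lt_y /connectP[[|z p] //=]].
by move=> _ e; rewrite e ltnn in lt_y.
Qed.

Lemma srels_cons0 a b s : srels ((a, b) :: s) =2 addedge (srels s) a b.
Proof. exact: (srels_cons (fun _ _ => false)). Qed.

Lemma rk_size s : rk (srels s) <= size s.
Proof.
elim: s => [|[a b] s IH]; first by rewrite rk_nil.
rewrite (eq_rk (srels_cons0 _ _ _)) rk_addedge; last exact: srels_sym.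
by rewrite /= -addn1 leq_add //; case: conn.
Qed.

Lemma spanning_forest (s : seq ('I_N * 'I_N)) : exists t,
  [/\ {subset t <= s}, size t <= rk (srels s) & conn (srels t) =2 conn (srels s)].
Proof.
elim: s => [|[a b] s [t [ts le_t et]]]; first by exists [::].
have ss := srels_sym s; have st := srels_sym t.
rewrite (eq_rk (srels_cons0 _ _ _)) rk_addedge //; have [ab|nab] := boolP (conn (srels s) a b).
  exists t; split=> [p p_t||x y]; first by rewrite inE ts ?orbT.
    by rewrite addn0.
  have [_ C2 C3] := conn_equivr ss.
  rewrite et (eq_conn (srels_cons0 _ _ _)) conn_addedge //; apply/idP/or3P => [|[|/andP[xa by_]|/andP[xb ay]]] //.
  - by constructor 1.
  - by apply: C3 xa (C3 _ _ _ ab by_).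
  - by apply: C3 xb (C3 _ _ _ _ ay); rewrite C2.
exists ((a, b) :: t); split=> [p|/=|x y].
- by rewrite !inE => /orP[->|/ts->] //; rewrite orbT.
- by rewrite addn1.
- by rewrite !(eq_conn (srels_cons0 _ _ _)) !conn_addedge // !et.
Qed.

(* Each touched component has a non-minimal vertex, and its only minimal one. *)
Lemma touched_le F : symmetric F -> irreflexive F -> #|[pred x | exb (F x)]| <= 2 * rk F.
Proof.
move=> sF iF; have eF := conn_equivr sF; have [C1 C2 C3] := eF.
rewrite mul2n -addnn -(cardID (nonmin (conn F)) [pred x | exb (F x)]); apply: leq_add.
  by apply/subset_leq_card/subsetP => x; rewrite !inE => /andP[].
pose other x := odflt x [pick y | F x y].
have otherP x : exb (F x) -> F x (other x).
  by rewrite /other; case: pickP => //= no /exbP[y]; rewrite no.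
rewrite -(card_in_image (f := other)).
  apply/subset_leq_card/subsetP => y /imageP[x]; rewrite !inE => /andP[nx /otherP Fx] ->.
  have [//|no] := boolP (nonmin (conn F) (other x)); have e : x = other x.
    by apply: (least_unique eF) => //; apply: connect1.
  by rewrite -e iF in Fx.
move=> x y; rewrite !inE => /andP[nx /otherP Fx] /andP[ny /otherP Fy] e.
apply: (least_unique eF) => //; apply: (C3 (other x)); first exact: connect1.
by rewrite C2 e; apply: connect1.
Qed.

(** An edge is a pair of touched vertices; since a component may be dense, the bound is a square. *)
Lemma edges_le F : symmetric F -> irreflexive F ->
  #|[pred p : 'I_N * 'I_N | F p.1 p.2]| <= (2 * rk F) ^ 2.
Proof.
move=> sF iF; apply: (@leq_trans (#|[pred x | exb (F x)]| ^ 2)); last first.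
  by rewrite leq_sqr; exact: touched_le.
rewrite -mulnn -cardX; apply/subset_leq_card/subsetP => -[x y]; rewrite !inE /= => Fxy.
by apply/andP; split; apply/exbP; [exists y|exists x; rewrite sF].
Qed.

Definition monochr F (c : 'I_N -> bool) x y : bool := F x y && (c x == c y).

Lemma monochr_sym F c : symmetric F -> symmetric (monochr F c).
Proof. by move=> sF x y; rewrite /monochr sF eq_sym. Qed.

Lemma monochr_irr F c : irreflexive F -> irreflexive (monochr F c).
Proof. by move=> iF x; rewrite /monochr iF. Qed.

End Rank.

(** * Contractions and colorings *)

(** A coloring of the contraction pulls back along [root], and its monochromatic edges lie inside
    components of [S], whence the rank bound. Conversely the set to contract is a spanning forest of
    the monochromatic graph: its components have one color each, so the coloring descends, and an
    edge between two components is not monochromatic. *)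
Lemma contraction_coloring n (e : rel 'I_n) k : simple_graph e ->
  BipartiteContraction e k <-> exists c : 'I_n -> bool, rk (monochr e c) <= k.
Proof.
move=> [sE iE]; split=> [[S [eS [le_k [col colP]]]]|[c le_k]].
  have sS : connect_sym (srel S) by apply: sym_connect_sym => x y; rewrite /srel orbC.
  exists (fun x => col (root (srel S) x)); apply: leq_trans le_k.
  rewrite cardE; apply: leq_trans (rk_size _); apply: rk_le => x y /andP[exy /eqP cxy].
  have -> : conn (srels (enum S)) x y = connect (srel S) x y.
    by apply: eq_connect => u v; rewrite /srels !mem_enum.
  have [/eqP|ne] := eqVneq (root (srel S) x) (root (srel S) y); first by rewrite root_connect.
  have := colP (root (srel S) x) (root (srel S) y).
  rewrite /contr_adj /contr_vertex !root_root // !eqxx ne cxy /= eqxx => /(_ isT isT) W.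
  suff: false by []; apply: W; apply/existsP; exists x; apply/existsP; exists y.
  by rewrite exy !eqxx.
pose F := monochr e c; have sF : symmetric F := monochr_sym c sE.
pose s := enum [pred p : 'I_n * 'I_n | (p.1 < p.2) && F p.1 p.2].
have s_F : srels s =2 F.
  move=> x y; rewrite /srels !mem_enum !inE /= [F y x]sF.
  case: ltngtP => //= xy; first by rewrite orbF.
  by rewrite (val_inj xy) /F /monochr iE.
have [t [ts le_t et]] := spanning_forest s.
exists [set p in t].
have S_t : srel [set p in t] =2 srels t by move=> x y; rewrite /srel /srels !inE.
have t_F x y : srel [set p in t] x y -> F x y.
  by rewrite S_t /srels => /orP[] /ts; rewrite mem_enum inE /= => /andP[_]; rewrite // sF.
have sS : connect_sym (srel [set p in t]).
  by apply: sym_connect_sym => x y; rewrite /srel orbC.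
split; [|split].
- by move=> p; rewrite inE => /ts; rewrite mem_enum inE /= => /andP[-> /andP[->]].
- rewrite cardsE; apply: leq_trans (card_size t) _; apply: leq_trans le_t _.
  by rewrite (eq_rk s_F).
- have c_conn x y : connect (srel [set p in t]) x y -> c x = c y.
    move=> /connectP[p]; elim: p x => [|z p IH] x /=; first by move=> _ ->.
    by move=> /andP[/t_F/andP[_ /eqP->] pp] /(IH _ pp).
  exists c => a b va vb /and4P[_ _ ne_ab /existsP[x /existsP[y /and3P[exy /eqP rx /eqP ry]]]].
  apply: contraNneq ne_ab => cab; rewrite -rx -ry root_connect //.
  rewrite (eq_connect S_t) -/(conn _ x y) et (eq_conn s_F); apply: connect1.
  rewrite /F /monochr exy /= (c_conn x a); last by rewrite -rx connect_root.
  by rewrite (c_conn y b) ?cab // -ry connect_root.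
Qed.

(** * Padding with isolated vertices *)

Section Extension.
Variables (n N : nat) (e : rel 'I_n) (le_nN : n <= N).

Definition extgraph (x y : 'I_N) : bool := extrel e x y.

Local Notation h := (widen_ord le_nN).

Lemma extgraphP x y : reflect (exists i j, [/\ x = h i, y = h j & e i j]) (extgraph x y).
Proof.
apply: (iffP existsP) => [[i /existsP[j /and3P[/eqP ei /eqP ej eij]]]|[i [j [-> -> eij]]]].
  by exists i, j; split=> //; apply: val_inj.
by exists i; apply/existsP; exists j; rewrite !eqxx.
Qed.

Lemma h_inj : injective h.
Proof. by move=> i j /(congr1 val) /= e_ij; apply: val_inj. Qed.

(** The added vertices are isolated, hence minimal in their components, and [h] preserves the order
    on the others. *)
Lemma rk_ext (c : 'I_n -> bool) (c' : 'I_N -> bool) : (forall i, c' (h i) = c i) ->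
  rk (monochr extgraph c') = rk (monochr e c).
Proof.
move=> cc'; set F' := monochr _ c'; set F := monochr e c.
have F'P x y : F' x y -> exists i j, [/\ x = h i, y = h j & F i j].
  move=> /andP[/extgraphP[i [j [-> -> eij]]]]; rewrite !cc' => cij.
  by exists i, j; rewrite /F /monochr eij.
have FF' i j : F i j -> F' (h i) (h j).
  by move=> /andP[eij cij]; apply/andP; rewrite !cc'; split=> //; apply/extgraphP; exists i, j.
have conn1 i j : conn F i j -> conn F' (h i) (h j).
  move=> /connectP[p]; elim: p i => [|z p IH] i /=; first by move=> _ ->; apply: connect0.
  by move=> /andP[/FF' Fiz pp] ej; apply: connect_trans (connect1 Fiz) (IH _ pp ej).
have conn2 x y : conn F' x y -> x = y \/ exists i j, [/\ x = h i, y = h j & conn F i j].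
  move=> /connectP[p]; elim: p x => [|z p IH] x /=; first by left.
  move=> /andP[/F'P[i [j [-> -> Fij]]] pp] ey; right.
  have [e_j|[i' [j' [/h_inj e_j -> Fij']]]] := IH _ pp ey.
    by exists i, j; rewrite -e_j; split=> //; apply: connect1.
  by exists i, j'; split=> //; rewrite -e_j in Fij'; apply: connect_trans (connect1 Fij) Fij'.
rewrite /rk -(card_image h_inj); apply: eq_card => x.
apply/idP/imageP => [|[i]]; rewrite inE; first (move=> /nonminP[y lt_y /conn2[exy|[i [j [ex ey Fij]]]]]).
- by rewrite exy ltnn in lt_y.
- by exists i => //; rewrite inE; apply/nonminP; exists j => //; rewrite ex ey in lt_y.
- move=> /nonminP[j lt_j Fij] ->; rewrite inE; apply/nonminP; exists (h j) => //.
  exact: conn1.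
Qed.

Lemma coloring_ext k : (exists c : 'I_n -> bool, rk (monochr e c) <= k) <->
  exists c : 'I_N -> bool, rk (monochr extgraph c) <= k.
Proof.
split=> [[c le_k]|[c' le_k]]; last by exists (fun i => c' (h i)); rewrite -(rk_ext (c' := c')).
exists (fun x => if insub (val x) is Some i then c i else false).
rewrite (rk_ext (c := c)) // => i; rewrite insubT //= => lt_i.
by congr c; apply: val_inj.
Qed.

Lemma extgraph_sym : symmetric e -> symmetric extgraph.
Proof.
move=> sE x y; apply/extgraphP/extgraphP => -[i [j [-> -> eij]]]; exists j, i; by rewrite sE.
Qed.

Lemma extgraph_irr : irreflexive e -> irreflexive extgraph.
Proof.
by move=> iE x; apply/extgraphP => -[i [j [-> /h_inj -> ]]]; rewrite iE.
Qed.

End Extension.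

(** * Minimum cuts *)

Section Flow.
Variable N : nat.
Implicit Types (r q f p E C : 'I_N -> 'I_N -> bool) (U A B Z X Y : 'I_N -> bool) (x y z a b : 'I_N).

Definition reach r A y : bool := exb (fun x => A x && conn r x y).

Definition joined r A B : bool := exb (fun y => B y && reach r A y).

Definition del q x y u v : bool := q u v && ~~ ((u == x) && (v == y)).

Definition prune A B x y q : 'I_N -> 'I_N -> bool :=
  fun u v => q u v && (joined (del q x y) A B ==> ~~ ((u == x) && (v == y))).

(** Arcs are deleted one by one as long as [A] stays joined to [B]. What remains is the arc set of a
    single simple path: a definable choice of an augmenting path. *)
Definition minpath A B r : 'I_N -> 'I_N -> bool :=
  itr r (fun x q => itr q (fun y => prune A B x y)).

(** Edges inside [U] have unit capacity and the arcs of [C] are free, so the classes of [C] behave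
    like contracted vertices. *)
Definition resid E C U f x y : bool := C x y || [&& U x, U y, E x y & ~~ f x y].

Definition augment C f p x y : bool := (f x y && ~~ p y x) || [&& p x y, ~~ C x y & ~~ f y x].

Definition flow_step E C U A B f : 'I_N -> 'I_N -> bool :=
  fun x y => if joined (resid E C U f) A B then augment C f (minpath A B (resid E C U f)) x y
             else f x y.

(** There is room for [N] augmentations, more than any cut of interest, which has at most [Q < N]
    edges, allows. *)
Definition flow E C U A B : 'I_N -> 'I_N -> bool :=
  itr (fun _ _ => false) (fun _ : 'I_N => flow_step E C U A B).

(** The side of the cut that contains [A]: all that can be reached from [A] in the residual
    graph. *)
Definition sink_side E C U A B : 'I_N -> bool := reach (resid E C U (flow E C U A B)) A.

Lemma joined_sub q r A B : (forall x y, q x y -> r x y) -> joined q A B -> joined r A B.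
Proof.
move=> qr /exbP[y /andP[By /exbP[x /andP[Ax qxy]]]]; apply/exbP; exists y; rewrite By.
apply/exbP; exists x; rewrite Ax; apply: conn_sub qxy => u v /qr; exact: connect1.
Qed.

Lemma eq_joined q r A B : q =2 r -> joined q A B = joined r A B.
Proof. by move=> qr; apply/idP/idP; apply: joined_sub => x y; rewrite qr. Qed.

Lemma pruneE A B x y q : prune A B x y q =2 if joined (del q x y) A B then del q x y else q.
Proof. by move=> u v; rewrite /prune; case: ifP => _ //=; rewrite andbT. Qed.

Lemma minpathP A B r : joined r A B ->
  [/\ forall x y, minpath A B r x y -> r x y, joined (minpath A B r) A B &
      forall x y, minpath A B r x y -> ~~ joined (del (minpath A B r) x y) A B].
Proof.
move=> jr; pose I (done : 'I_N -> 'I_N -> bool) q := [/\ forall x y, q x y -> r x y, joined q A B &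
   forall x y, done x y -> q x y -> ~~ joined (del q x y) A B].
suff: I (fun x _ => x < N) (minpath A B r).
  by case=> m1 m2 m3; split=> // x y; apply: m3.
have I0 : I (fun x _ => x < 0) r by split.
apply: (@itr_ind _ _ _ (fun i => I (fun x _ => x < i)) _ I0) => i q Iq.
pose dn j x y := (x < i) || (x == i) && (y < j).
suff: I (dn N) (itr q (fun y => prune A B i y)).
  case=> m1 m2 m3; split=> // x y lt_x; apply: m3.
  by rewrite /dn -val_eqE /= ltn_ord andbT orbC -leq_eqVlt.
apply: (@itr_ind _ _ _ (fun j => I (dn j))).
  by case: Iq => m1 m2 m3; split=> // x y; rewrite /dn andbF orbF; apply: m3.
move=> j q' [m1 m2 m3]; have sub u v : prune A B i j q' u v -> q' u v by case/andP.
have j' : joined (prune A B i j q') A B.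
  by rewrite (eq_joined _ _ (pruneE A B i j q')); case: ifP.
split=> // [x y /sub/m1 //|x y dn_xy px].
apply: contraTN isT => jd; have dq : joined (del q' x y) A B.
  by apply: joined_sub jd => u v /andP[/sub q_uv ne]; rewrite /del q_uv.
have q'xy := sub _ _ px; have [dn'|ndn] := boolP (dn j x y).
  by have := m3 _ _ dn' q'xy; rewrite dq.
have [ex ey] : x = i /\ y = j.
  move: dn_xy ndn; rewrite /dn ltnS [y <= j]leq_eqVlt => /orP[->//|/andP[/eqP->]].
  rewrite eqxx /= => /orP[/eqP e _|->]; last by rewrite orbT.
  by split=> //; apply: val_inj.
by move: px; rewrite ex ey in dq *; rewrite pruneE dq /del !eqxx andbF.
Qed.

Definition arcs a (l : seq 'I_N) : seq ('I_N * 'I_N) := zip (a :: l) l.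

Lemma arcs_cons a b l : arcs a (b :: l) = (a, b) :: arcs b l.
Proof. by []. Qed.

Lemma arcs_mem a l x y : (x, y) \in arcs a l -> x \in a :: l /\ y \in l.
Proof.
elim: l a => // b l IH a; rewrite arcs_cons !inE => /orP[/eqP[-> ->]|/IH[]].
  by rewrite !eqxx.
by rewrite !inE => -> ->; rewrite !orbT.
Qed.

Lemma arcs_uniq a l : uniq (a :: l) -> uniq (arcs a l).
Proof.
elim: l a => // b l IH a; rewrite arcs_cons => /= /andP[na u]; rewrite IH // andbT.
by apply/negP => /arcs_mem[ab _]; rewrite ab in na.
Qed.

Lemma arcs_antisym a l x y : uniq (a :: l) -> (x, y) \in arcs a l -> (y, x) \notin arcs a l.
Proof.
elim: l a => // b l IH a; rewrite arcs_cons => u; have /= /andP[na u'] := u.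
rewrite !inE !xpair_eqE => /orP[/andP[/eqP-> /eqP->]|xy]; rewrite negb_or.
  apply/andP; split; first by apply: contraNN na => /andP[/eqP-> _]; rewrite inE eqxx.
  by apply: contraNN na => /arcs_mem[_]; rewrite inE orbC => ->.
rewrite IH // andbT; apply: contraNN na => /andP[/eqP <- _].
by rewrite inE orbC; have [_ ->] := arcs_mem xy.
Qed.

Lemma path_arcs r a l : path r a l = all (fun u => r u.1 u.2) (arcs a l).
Proof. by elim: l a => // b l IH a; rewrite arcs_cons /= IH. Qed.

(** Exits from [Z] and entries into [Z] alternate along a path, so their numbers differ only by what
    the two ends account for. *)
Lemma arcs_cross Z a l :
  count (fun u => Z u.1 && ~~ Z u.2) (arcs a l) + Z (last a l) =
  count (fun u => Z u.2 && ~~ Z u.1) (arcs a l) + Z a.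
Proof.
elim: l a => [//|b l IH] a; rewrite arcs_cons /=; have := IH b.
by case: (Z a); case: (Z b); move: (count _ _) (count _ _) => m1 m2 /=; lia.
Qed.

Lemma minpath_arcs A B r : joined r A B -> exists a l,
  [/\ A a, B (last a l), uniq (a :: l), path r a l &
      forall x y, minpath A B r x y = ((x, y) \in arcs a l)].
Proof.
move=> jr; have [m1 m2 m3] := minpathP jr; set q := minpath A B r in m1 m2 m3 *.
have [b /andP[Bb /exbP[a /andP[Aa /connectP[l0 pl0 eb]]]]] := exbP _ m2.
case: (shortenP pl0) eb => l pl ul _ eb.
have pl_arcs := pl; rewrite path_arcs in pl_arcs.
exists a, l; split=> //; first by rewrite -eb.
  by apply: sub_path pl.
move=> x y; apply/idP/idP => [qxy|xy]; last exact: (allP pl_arcs _ xy).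
apply/negPn/negP => nxy; have := m3 _ _ qxy; apply/negP/negPn.
apply/exbP; exists b; rewrite Bb; apply/exbP; exists a; rewrite Aa; apply/connectP; exists l => //.
rewrite path_arcs; apply/allP => -[u v] uv; rewrite /del (allP pl_arcs _ uv) /=.
by apply: contra nxy => /andP[/eqP<- /eqP<-].
Qed.

Variables (E C : 'I_N -> 'I_N -> bool) (U A B : 'I_N -> bool).
Hypotheses (symE : symmetric E) (eqC : equivr C).

Definition compat Z := forall x y, C x y -> Z x = Z y.

Hypotheses (compU : compat U) (AU : forall x, A x -> U x).

Definition separates Z := [/\ compat Z, forall x, A x -> Z x & forall x, B x -> ~~ Z x].

Definition crossing f Z : nat := #|[pred u : 'I_N * 'I_N | f u.1 u.2 && (Z u.1 && ~~ Z u.2)]|.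
Definition entering f Z : nat := #|[pred u : 'I_N * 'I_N | f u.1 u.2 && (Z u.2 && ~~ Z u.1)]|.

Lemma enteringE f Z : entering f Z = crossing (fun x y => f y x) Z.
Proof.
rewrite /entering /crossing -!sum1_card; rewrite (reindex_inj (h := fun u => (u.2, u.1))) //=.
by move=> [x y] [x' y'] /= [-> ->].
Qed.

Lemma crossing_sum f Z : crossing f Z =
  \sum_(u : 'I_N * 'I_N | Z u.1 && ~~ Z u.2) f u.1 u.2.
Proof.
rewrite /crossing -sum1_card [LHS]big_mkcond [RHS]big_mkcond /=.
by apply: eq_bigr => u _; rewrite unfold_in /=; case: (f _ _); case: (Z _); case: (Z _).
Qed.

(** [fi_val] takes the place of conservation at each class: the net flow out of every separating set
    is [k]. *)
Record flow_inv f (k : nat) : Prop := FlowInv {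
  fi_sub : forall x y, f x y -> [/\ U x, U y, E x y & ~~ C x y];
  fi_anti : forall x y, f x y -> ~~ f y x;
  fi_val : forall Z, separates Z -> crossing f Z = entering f Z + k }.

Lemma card_arcs (P : pred ('I_N * 'I_N)) a l : uniq (a :: l) ->
  #|[pred u | (u \in arcs a l) && P u]| = count P (arcs a l).
Proof.
move=> /arcs_uniq ul; rewrite -size_filter -(card_uniqP (filter_uniq P ul)).
by apply: eq_card => u; rewrite !inE mem_filter andbC.
Qed.

Lemma augment_inv f k : flow_inv f k -> joined (resid E C U f) A B ->
  flow_inv (augment C f (minpath A B (resid E C U f))) k.+1.
Proof.
move=> [f1 f2 f3] jr; have [a [l [Aa Bl ul pl ep]]] := minpath_arcs jr.
set p := minpath _ _ _ in ep *.
have pr x y : p x y -> resid E C U f x y.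
  by rewrite ep => xy; rewrite path_arcs in pl; exact: (allP pl _ xy).
have anti x y : p x y -> ~~ p y x by rewrite !ep; apply: arcs_antisym.
have symC x y : C x y = C y x by case: eqC.
split.
- move=> x y /orP[/andP[/f1//]|/and3P[/pr/orP[->//|/and4P[Ux Uy Exy _]] nC _]].
  by split.
- move=> x y; rewrite /augment => /orP[/andP[fxy npyx]|/and3P[pxy nC nf]].
    by rewrite negb_or negb_and (f2 _ _ fxy) /= (negbTE npyx).
  by rewrite negb_or !negb_and (negbTE (anti _ _ pxy)) pxy (negbTE nf).
move=> Z sepZ; have [cZ AZ BZ] := sepZ; have := f3 Z sepZ.
have pout : crossing p Z = count (fun u => Z u.1 && ~~ Z u.2) (arcs a l).
  by rewrite -card_arcs //; apply: eq_card => u; rewrite !inE ep -surjective_pairing.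
have pin : entering p Z = count (fun u => Z u.2 && ~~ Z u.1) (arcs a l).
  by rewrite -card_arcs //; apply: eq_card => u; rewrite !inE ep -surjective_pairing.
have := arcs_cross Z a l; rewrite (negbTE (BZ _ Bl)) (AZ _ Aa) -pout -pin addn0.
rewrite !enteringE !crossing_sum => e1 e2.
(* Out minus in for the new flow is that of [f] plus that of the path, pair by pair; terms change
   sides to avoid truncated subtraction. *)
suff: \sum_(u : 'I_N * 'I_N | Z u.1 && ~~ Z u.2) augment C f p u.1 u.2 +
   (\sum_(u : 'I_N * 'I_N | Z u.1 && ~~ Z u.2) f u.2 u.1 +
    \sum_(u : 'I_N * 'I_N | Z u.1 && ~~ Z u.2) p u.2 u.1) =
   \sum_(u : 'I_N * 'I_N | Z u.1 && ~~ Z u.2) augment C f p u.2 u.1 +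
   (\sum_(u : 'I_N * 'I_N | Z u.1 && ~~ Z u.2) f u.1 u.2 +
    \sum_(u : 'I_N * 'I_N | Z u.1 && ~~ Z u.2) p u.1 u.2) by lia.
rewrite -!big_split /=; apply: eq_bigr => -[x y] /= /andP[Zx nZy].
have nC : ~~ C x y by apply: contra nZy => /cZ <-.
have nC' : ~~ C y x by rewrite symC.
have pf x' y' : p x' y' -> ~~ C x' y' -> ~~ f x' y'.
  by move=> /pr/orP[->//|/and4P[]].
rewrite /augment nC nC' /=.
have b1 : ~~ (p x y && p y x) by rewrite negb_and -implybE; apply/implyP/anti.
have b2 : ~~ (f x y && f y x) by rewrite negb_and -implybE; apply/implyP/f2.
have b3 : ~~ (p x y && f x y) by rewrite negb_and -implybE; apply/implyP => /pf; apply.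
have b4 : ~~ (p y x && f y x) by rewrite negb_and -implybE; apply/implyP => /pf; apply.
move: b1 b2 b3 b4.
by case: (p x y); case: (p y x); case: (f x y); case: (f y x).
Qed.

Definition cut Z : nat := #|[pred u : 'I_N * 'I_N | [&& E u.1 u.2, U u.1 && Z u.1 & U u.2 && ~~ Z u.2]]|.

Lemma flow_value_le f k Z : flow_inv f k -> separates Z -> k <= cut Z.
Proof.
move=> [f1 f2 f3] sepZ; apply: (@leq_trans (crossing f Z)); first by rewrite f3 // leq_addl.
apply/subset_leq_card/subsetP => -[x y]; rewrite !inE /= => /andP[/f1[-> -> ->] _] /andP[-> ->] //.
Qed.

Lemma flow_step_inv f k : flow_inv f k -> joined (resid E C U f) A B ->
  flow_inv (flow_step E C U A B f) k.+1.
Proof.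
move=> fi jr; have [a1 a2 a3] := augment_inv fi jr.
have e x y : flow_step E C U A B f x y = augment C f (minpath A B (resid E C U f)) x y.
  by rewrite /flow_step jr.
split=> [x y|x y|Z /a3 eZ]; rewrite ?e; [exact: a1|exact: a2|].
rewrite /crossing /entering (eq_card (B := [pred u | augment C f (minpath A B (resid E C U f)) u.1 u.2 && (Z u.1 && ~~ Z u.2)])).
  by rewrite -/(crossing _ _) eZ; congr (_ + _); apply: eq_card => u; rewrite !inE e.
by move=> u; rewrite !inE e.
Qed.

(** When [B] is no longer reachable, every edge leaving the reachable set carries flow and no flow
    enters it. Its cut is thus at most the value of the flow, which no separating cut can be smaller
    than. *)
Lemma sink_sideP Q Z : Q < N -> separates Z -> cut Z <= Q ->
  let Z' := sink_side E C U A B in [/\ separates Z', forall x, Z' x -> U x & cut Z' <= Q].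
Proof.
move=> lt_Q sepZ le_Q /=.
have [k [fi stuck]] : exists k, flow_inv (flow E C U A B) k /\
    (~~ joined (resid E C U (flow E C U A B)) A B \/ k = N).
  apply: (@itr_ind _ _ _ (fun i f => exists k, flow_inv f k /\ (~~ joined (resid E C U f) A B \/ k = i))).
    exists 0; split; last by right.
    by split=> // Z' _; rewrite /crossing /entering !eq_card0.
  move=> i f [k [fi st]]; have [jr|nj] := boolP (joined (resid E C U f) A B).
    exists k.+1; split; first exact: flow_step_inv.
    by right; case: st => [/negP[]//|->].
  have e x y : flow_step E C U A B f x y = f x y by rewrite /flow_step (negbTE nj).
  exists k; split; last first.
    left; rewrite (eq_joined (r := resid E C U f)) // => x y.
    by rewrite /resid e.
  case: fi => f1 f2 f3; split=> [x y|x y|Z' /f3 eZ]; rewrite ?e; [exact: f1|exact: f2|].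
  rewrite /crossing /entering (eq_card (B := [pred u | f u.1 u.2 && (Z' u.1 && ~~ Z' u.2)])).
    by rewrite -/(crossing _ _) eZ; congr (_ + _); apply: eq_card => u; rewrite !inE e.
  by move=> u; rewrite !inE e.
have le_k : k <= Q := leq_trans (flow_value_le fi sepZ) le_Q.
case: stuck => [nj|]; last by lia.
set f := flow E C U A B in fi nj *; set Z' := sink_side _ _ _ _ _.
have [C1 C2 C3] := eqC.
have step x y : Z' x -> resid E C U f x y -> Z' y.
  move=> /exbP[a /andP[Aa axy]] rxy; apply/exbP; exists a; rewrite Aa.
  by apply: connect_trans axy (connect1 rxy).
have cZ' : compat Z'.
  move=> x y Cxy; apply/idP/idP => Zx; apply: step Zx _; rewrite /resid ?Cxy //.
  by rewrite C2 Cxy.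
have sepZ' : separates Z'.
  split=> // x; first by move=> Ax; apply/exbP; exists x; rewrite Ax /conn connect0.
  by move=> Bx; apply: contra nj => Zx; apply/exbP; exists x; rewrite Bx.
split=> //.
  move=> y /exbP[x /andP[/AU Ux /connectP[l]]].
  elim: l x Ux => [|z l IH] x Ux /=; first by move=> _ ->.
  move=> /andP[/orP[Cxz|/and4P[_ Uz _ _]] pl]; last exact: IH.
  by apply: IH; rewrite // -(compU Cxz).
apply: leq_trans le_k; have [f1 f2 f3] := fi.
have in0 : entering f Z' = 0.
  apply: eq_card0 => -[x y]; rewrite !inE /=; apply/negbTE/negP => /and3P[fxy Zy /negP]; apply.
  have [Ux Uy Exy nC] := f1 _ _ fxy.
  by apply: (step y) => //; rewrite /resid Uy Ux symE Exy (f2 _ _ fxy) orbT.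
rewrite -[k]add0n -in0 -f3 //; apply/subset_leq_card/subsetP => -[x y]; rewrite !inE /=.
move=> /and3P[Exy /andP[Ux Zx] /andP[Uy nZy]]; rewrite Zx nZy !andbT.
apply: contraNT nZy => nf; apply: step Zx _.
by rewrite /resid Ux Uy Exy nf orbT.
Qed.

End Flow.

(** * Growing sets from bits *)

Section Bits.
Variable N : nat.

(** Row [b] consists of the binary digits of [b], obtained by incrementing the preceding row: a
    digit changes when all lower digits are 1. *)
Definition bit_table : 'I_N -> 'I_N -> bool :=
  itr (fun _ _ => false) (fun (i : 'I_N) (q : 'I_N -> 'I_N -> bool) (b j : 'I_N) =>
    if succ i b then q i j (+) allb (fun l : 'I_N => (l < j) ==> q i l) else q b j).

Definition bit (b j : nat) : bool := odd (b %/ 2 ^ j).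

Lemma bitS b j : bit b.+1 j = bit b j (+) [forall l : 'I_j, bit b l].
Proof.
elim: j b => [|j IH] b.
  rewrite /bit !divn1 /=; have -> : [forall l : 'I_0, odd (b %/ 2 ^ l)] by apply/forallP => -[].
  by rewrite addbT.
have half m : m %/ 2 ^ j.+1 = m %/ 2 %/ 2 ^ j by rewrite expnS divnMA.
have e : [forall l : 'I_j.+1, bit b l] = odd b && [forall l : 'I_j, bit (b %/ 2) l].
  apply/forallP/andP => [h|[ob /forallP h] [[|l] lt_l]].
  - split; first by have := h ord0; rewrite /bit divn1.
    by apply/forallP => l; have := h (lift ord0 l); rewrite /bit lift0 expnS divnMA.
  - by rewrite /bit divn1.
  - by have := h (Ordinal (lt_l : l < j)); rewrite /bit /= expnS divnMA.
rewrite e /bit !half; have eb := odd_double_half b; rewrite -!divn2 in eb *.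
have [ob|nob] := boolP (odd b); last first.
  rewrite addbF; congr (odd (_ %/ _)); lia.
have -> : b.+1 %/ 2 = (b %/ 2).+1 by lia.
exact: IH.
Qed.

Lemma bit_tableE b j : bit_table b j = bit b j.
Proof.
pose I i (q : 'I_N -> 'I_N -> bool) := forall b' j' : 'I_N, b' <= i -> q b' j' = bit b' j'.
suff: I N bit_table by apply; exact: ltnW.
apply: itr_ind.
  by move=> b' j'; rewrite leqn0 => /eqP->; rewrite /bit div0n.
move=> i q Iq b' j' le_b; rewrite succE; case: eqP => [eb|ne]; last by apply: Iq; lia.
rewrite eb bitS Iq //; congr (_ (+) _); apply/allbP/forallP => [h l|h l].
  have lt_l : l < N by apply: ltn_trans (ltn_ord l) _.
  by have /implyP := h (Ordinal lt_l); rewrite Iq // => /(_ (ltn_ord l)).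
by apply/implyP => lt_l; rewrite Iq //; exact: (h (Ordinal lt_l)).
Qed.

Lemma bit_exist (beta : nat -> bool) m : exists2 b, b < 2 ^ m & forall j, bit b j = (j < m) && beta j.
Proof.
elim: m beta => [|m IH] beta; first by exists 0 => // j; rewrite /bit div0n.
have [b lt_b bP] := IH (fun j => beta j.+1); exists (beta 0 + 2 * b) => [|[|j]].
- by rewrite expnS; case: (beta 0); lia.
- by rewrite /bit divn1 oddD mul2n odd_double addbF; case: (beta 0).
- rewrite ltnS -bP /bit expnS divnMA; congr (odd (_ %/ _)).
  by case: (beta 0); lia.
Qed.

Lemma bit_table_exist (beta : nat -> bool) m : 2 ^ m <= N ->
  exists b : 'I_N, forall j, bit_table b j = (j < m) && beta j.
Proof.
move=> le_N; have [b lt_b bP] := bit_exist beta m.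
by exists (Ordinal (leq_trans lt_b le_N)) => j; rewrite bit_tableE bP.
Qed.

End Bits.

(** * The growth process *)

Section Growth.
Variable N : nat.
Implicit Types (E C q : 'I_N -> 'I_N -> bool) (U T A X Y Z : 'I_N -> bool) (x y z v : 'I_N).

Definition clsn C X : nat := #|[pred x | X x && ~~ nonmin C x]|.

Definition cand E U T X Y x : bool :=
  [&& U x, ~~ X x, ~~ Y x & T x || exb (fun y => X y && E y x)].

Definition first_cand E U T X Y x : bool :=
  cand E U T X Y x && ~~ exb (fun y : 'I_N => (y < x) && cand E U T X Y y).

(** One bit decides about the first candidate, which is taken with its whole class or rejected
    alone. The rejected vertices are recorded so that the next bit concerns another vertex. *)
Definition gstep E C U T (b : bool) (s : ('I_N -> bool) * ('I_N -> bool)) :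
    ('I_N -> bool) * ('I_N -> bool) :=
  (fun x => s.1 x || (b && exb (fun y => first_cand E U T s.1 s.2 y && C y x)),
   fun x => s.2 x || (~~ b && first_cand E U T s.1 s.2 x)).

Definition grow_state E C U T (bits : 'I_N -> bool) : ('I_N -> bool) * ('I_N -> bool) :=
  itr (fun=> false, fun=> false) (fun i => gstep E C U T (bits i)).

Definition grow E C U T bits : 'I_N -> bool := (grow_state E C U T bits).1.

Definition restr E C A x y : bool := [&& A x, A y & E x y || C x y].

Lemma clsn_le C X Y : (forall x, X x -> Y x) -> clsn C X <= clsn C Y.
Proof.
move=> XY; apply/subset_leq_card/subsetP => x; rewrite !inE => /andP[/XY-> ->] //.
Qed.

Variables (E C : 'I_N -> 'I_N -> bool) (U T A : 'I_N -> bool).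
Hypotheses (symE : symmetric E) (eqC : equivr C) (compA : compat C A) (AU : forall x, A x -> U x).

Local Notation cnd := (cand E U T).
Local Notation pck := (first_cand E U T).
Local Notation gst := (gstep E C U T).

Lemma pick_uniq X Y x y : pck X Y x -> pck X Y y -> x = y.
Proof.
rewrite /first_cand => /andP[cx /negP nx] /andP[cy /negP ny]; apply: ord_inj; apply/eqP.
rewrite eqn_leq; apply/andP; split; rewrite leqNgt; apply/negP => lt.
- by apply: nx; apply/exbP; exists y; rewrite lt cy.
- by apply: ny; apply/exbP; exists x; rewrite lt cx.
Qed.

Lemma pick_exist X Y x : cnd X Y x -> exists y, pck X Y y.
Proof.
move=> cx; have [m] := ubnP (x : nat); elim: m x cx => // m IH x cx; rewrite ltnS => le_x.
have [/exbP[y /andP[lt_y cy]]|nx] := boolP (exb (fun y : 'I_N => (y < x) && cnd X Y y)).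
  by apply: (IH y) => //; apply: leq_trans le_x.
by exists x; rewrite /first_cand cx.
Qed.

(* The run of the growth process that includes a picked vertex iff it is in [A]. *)
Definition follow (s : ('I_N -> bool) * ('I_N -> bool)) := exb (fun v => pck s.1 s.2 v && A v).

Definition orun i := iter i (fun s => gst (follow s) s) (fun=> false, fun=> false).

(** The bits from [m] on are false, and the corresponding rounds only reject. *)
Lemma orun_grow m (beta : 'I_N -> bool) : m <= N ->
  (forall j : 'I_N, beta j = (j < m) && follow (orun j)) -> grow E C U T beta =1 (orun m).1.
Proof.
move=> le_m betaP; suff: (grow_state E C U T beta).1 =1 (orun (minn m N)).1.
  by rewrite (minn_idPl le_m).
pose I i s := (i <= m -> s = orun i) /\ (m <= i -> s.1 =1 (orun m).1).
suff: I N (grow_state E C U T beta).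
  by case=> h1 h2; rewrite (minn_idPl le_m); apply: h2.
apply: itr_ind.
  by split=> //; rewrite leqn0 => /eqP->.
move=> i s [I1 I2]; rewrite betaP; split=> [lt_i|].
  by rewrite lt_i /= I1 // ltnW.
rewrite leq_eqVlt => /orP[/eqP e|lt_m]; first by rewrite e ltnSn /= I1 // -ltnS -e.
move=> x; rewrite ltnNge -ltnS lt_m /= orbF; exact: I2.
Qed.

(** The only vertices that can be rejected while the process follows [A]. *)
Definition fringe := [pred x | [&& U x, ~~ A x & T x || exb (fun y => A y && E y x)]].

(** Until the process is stuck, each round brings a new class into [X] or a new vertex into [Y]. As
    [X] stays in [A] and [Y] in the fringe, the number of useful bits is bounded. *)
Lemma orun_inv i : let: (X, Y) := orun i in
  [/\ forall x, X x -> A x, compat C X, forall x, Y x -> x \in fringe &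
      (forall x, ~~ cnd X Y x) \/ i <= clsn C X + #|[pred x | Y x]|].
Proof.
have [C1 C2 C3] := eqC.
elim: i => [|i IH]; first by split=> //; right.
rewrite /= -/(orun i) /gstep /=; case: (orun i) IH => X Y /= [XA compX YF st].
have [fo|nfo] := boolP (follow (X, Y)).
  have [v /andP[pv Av]] := exbP _ fo; rewrite /= in pv.
  have eX x : X x || exb (fun y => pck X Y y && C y x) = X x || C v x.
    congr (_ || _); apply/exbP/idP => [[y /andP[/(pick_uniq pv) <-]] //|Cvx].
    by exists v; rewrite pv.
  have nXv : ~~ X v by case/andP: pv => /and4P[].
  split=> /=.
  - by move=> x; rewrite eX => /orP[/XA|/compA <-].
  - move=> x y Cxy; rewrite !eX (compX _ _ Cxy); congr (_ || _).
    by apply/idP/idP => [/C3|]; [apply|rewrite C2 in Cxy; move=> /C3; apply].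
  - by move=> x; rewrite orbF; apply: YF.
  - right; have eY : #|[pred x | Y x || false]| = #|[pred x | Y x]| by apply: eq_card => x; rewrite !inE orbF.
    rewrite eY; case: st => [st|st]; first by case/andP: pv; rewrite (negbTE (st v)).
    rewrite -addn1 (leq_trans (leq_add st (leqnn 1))) // addnAC leq_add2r addn1.
    have [r Cvr nr] := least_rep v eqC.
    rewrite /clsn [X in _ <= X](cardD1 r) inE eX Cvr orbT nr /= add1n ltnS.
    apply/subset_leq_card/subsetP => x; rewrite !inE eX => /andP[Xx ->]; rewrite Xx /= andbT.
    by apply: contraNneq nXv => ex; rewrite (compX _ _ Cvr) -ex.
have eX x : X x || (false && exb (fun y => pck X Y y && C y x)) = X x by rewrite orbF.
split=> /=.
- by move=> x; rewrite orbF; apply: XA.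
- by move=> x y Cxy; rewrite !orbF (compX _ _ Cxy).
- move=> x /orP[/YF//|px]; have nAx : ~~ A x.
    by apply: contra nfo => Ax; apply/exbP; exists x; rewrite /= px.
  case/andP: px => /and4P[Ux _ _ Tx] _; rewrite inE Ux nAx /=.
  case/orP: Tx => [->//|/exbP[y /andP[Xy Eyx]]].
  by apply/orP; right; apply/exbP; exists y; rewrite XA.
- have eXn : clsn C (fun x => X x || false) = clsn C X.
    by apply: eq_card => x; rewrite !inE orbF.
  rewrite eXn; case: st => [st|st].
    left => x; apply: contra (st x) => /and4P[Ux nX nY Tx]; apply/and4P; split=> //.
    - by rewrite orbF in nX.
    - by apply: contra nY => ->.
    - case/orP: Tx => [->//|/exbP[y /andP[Xy Eyx]]]; apply/orP; right; apply/exbP; exists y.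
      by rewrite orbF in Xy; rewrite Xy.
  have [/existsP[x cx]|/existsPn no] := boolP [exists x, cnd X Y x].
    have [v pv] := pick_exist cx; right.
    have nYv : ~~ Y v by case/andP: pv => /and4P[].
    rewrite -addn1 (leq_trans (leq_add st (leqnn 1))) // -addnA leq_add2l addn1.
    rewrite [X in _ <= X](cardD1 v) inE pv orbT /= add1n ltnS.
    apply/subset_leq_card/subsetP => y; rewrite !inE => Yy; rewrite Yy /= andbT.
    by apply: contraNneq nYv => <-.
  have np x : pck X Y x = false by rewrite /first_cand (negbTE (no x)).
  left => x; apply: contra (no x) => /and4P[Ux nX nY Tx]; apply/and4P; split=> //.
  - by rewrite orbF in nX.
  - by rewrite np orbF in nY.
  - case/orP: Tx => [->//|/exbP[y /andP[Xy Eyx]]]; apply/orP; right; apply/exbP; exists y.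
    by rewrite orbF in Xy; rewrite Xy.
Qed.

(** When no candidate is left, a vertex of [A] that is a terminal or next to [X] must be in [X]:
    rejected vertices belong to the fringe, which avoids [A]. *)
Lemma stuck_closed X Y v x : (forall x, ~~ cnd X Y x) -> compat C X ->
  (forall x, Y x -> x \in fringe) -> A v -> T v -> conn (restr E C A) v x -> X x.
Proof.
move=> st compX YF Av Tv.
have XY y : A y -> T y || exb (fun z => X z && E z y) -> X y.
  move=> Ay Ty; apply: contraNT (st y) => nXy; apply/and4P; split=> //; first exact: AU.
  by apply/negP => /YF; rewrite !inE Ay andbF.
have Xv : X v by apply: XY => //; rewrite Tv.
move=> /connectP[p]; elim: p v Av Xv {Tv} => [|z p IH] v Av Xv /=; first by move=> _ ->.
move=> /andP[/and3P[_ Az /orP[Evz|Cvz]] pp]; apply: IH => //.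
  by apply: XY => //; apply/orP; right; apply/exbP; exists v; rewrite Xv.
by rewrite -(compX _ _ Cvz).
Qed.

Lemma grow_follow m : 2 ^ m <= N ->
  exists b : 'I_N, grow E C U T (bit_table b) =1 (orun m).1.
Proof.
move=> le_N; have [b bP] := bit_table_exist (fun j => follow (orun j)) le_N.
by exists b; apply: orun_grow => //; apply: leq_trans le_N; apply/ltnW/ltn_expl.
Qed.

Lemma grow_exact m : 2 ^ m <= N -> clsn C A + #|fringe| < m ->
  (forall x, A x -> exists v, [/\ A v, T v & conn (restr E C A) v x]) ->
  exists b : 'I_N, grow E C U T (bit_table b) =1 A.
Proof.
move=> le_N lt_m AT; have [b bP] := grow_follow le_N; exists b => x; rewrite bP.
have := orun_inv m; case: (orun m) => X Y [XA compX YF st] /=.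
have le_Y : #|[pred x | Y x]| <= #|fringe|.
  by apply/subset_leq_card/subsetP => y; rewrite inE => /YF.
case: st => [st|le_st]; last by have := clsn_le C XA; lia.
by apply/idP/idP => [/XA//|/AT[v [Av Tv]]]; apply: stuck_closed YF Av Tv.
Qed.

(** Here [A] may be arbitrarily large. After [m] rounds the process either is stuck and contains the
    whole piece of [v], or has already taken more than [p] classes. *)
Lemma grow_big m p v : 2 ^ m <= N -> p + #|fringe| < m -> A v -> T v ->
  p < clsn C (fun x => conn (restr E C A) v x) ->
  exists b : 'I_N, let X := grow E C U T (bit_table b) in
    p < clsn C X /\ forall x, X x -> A x.
Proof.
move=> le_N lt_m Av Tv lt_p; have [b bP] := grow_follow le_N; exists b => /=.
have eX : clsn C (grow E C U T (bit_table b)) = clsn C (orun m).1.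
  by apply: eq_card => x; rewrite !inE bP.
have := orun_inv m; rewrite eX; case: (orun m) bP {eX} => X Y /= bP [XA compX YF st].
split=> [|x]; last by rewrite bP; apply: XA.
have le_Y : #|[pred x | Y x]| <= #|fringe|.
  by apply/subset_leq_card/subsetP => y; rewrite inE => /YF.
case: st => [st|le_st]; last by lia.
by apply: leq_trans lt_p _; apply: clsn_le => x; apply: stuck_closed.
Qed.

End Growth.

Lemma grow_sound N (E C : 'I_N -> 'I_N -> bool) (U T bits : 'I_N -> bool) : equivr C ->
  compat C U -> compat C (grow E C U T bits) /\ forall x, grow E C U T bits x -> U x.
Proof.
move=> [C1 C2 C3] compU; rewrite /grow /grow_state.
apply: (@itr_ind _ _ _ (fun _ s => compat C s.1 /\ forall x, s.1 x -> U x)) => //.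
move=> i [X Y] /= [compX XU]; split.
  move=> x y Cxy; rewrite (compX _ _ Cxy); congr (_ || (_ && _)).
  apply/exbP/exbP => -[z /andP[pz Cz]]; exists z; rewrite pz /=.
    exact: C3 Cz Cxy.
  by apply: C3 Cz _; rewrite C2.
move=> x /orP[/XU//|/andP[_ /exbP[y /andP[/andP[/and4P[Uy _ _ _] _] Cyx]]]].
by rewrite -(compU _ _ Cyx).
Qed.

(** * Unbreakable regions *)

Section Shrink.
Variable N : nat.
Implicit Types (E C : 'I_N -> 'I_N -> bool) (U T A B D X Y Z : 'I_N -> bool) (x y z v u b : 'I_N).

Definition clsle C X (m : 'I_N) : bool := cardle (fun x => X x && ~~ nonmin C x) m.

Definition breaks E C (p q : 'I_N) U A B Z : bool :=
  [&& ~~ clsle C A p, ~~ clsle C B p, ~~ exb (fun x => B x && Z x) &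
      card2le (fun x y => [&& E x y, U x && Z x & U y && ~~ Z y]) q].

(** Splits [U] along the cut when both parts keep more than [p] classes. The part inside [Z] is kept
    if its border is small; otherwise [border_split] makes the other border small. *)
Definition shrink_by E C (p q q2 : 'I_N) U A B : 'I_N -> bool :=
  let Z := sink_side E C U A B in
  fun x => U x && (breaks E C p q U A B Z ==>
    (Z x == card2le (fun x y => [&& E x y, U x && Z x & ~~ (U y && Z y)]) q2)).

Definition shrink1 E C (bits : 'I_N -> 'I_N -> bool) (p q q2 : 'I_N) v b1 u b2 U : 'I_N -> bool :=
  shrink_by E C p q q2 U (grow E C U (fun x => x == v) (bits b1))
                         (grow E C U (fun x => x == u) (bits b2)).

Definition shrink_pass E C (bits : 'I_N -> 'I_N -> bool) (p q q2 : 'I_N) U : 'I_N -> bool :=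
  itr U (fun v U => itr U (fun b1 U => itr U (fun u U => itr U (fun b2 =>
    shrink1 E C bits p q q2 v b1 u b2)))).

(** A split can make other splits possible, so the passes over all pairs of guesses are repeated;
    since the region only shrinks, [N] passes reach a fixed point. *)
Definition shrink E C (bits : 'I_N -> 'I_N -> bool) (p q q2 : 'I_N) : 'I_N -> bool :=
  itr (fun=> true) (fun _ : 'I_N => shrink_pass E C bits p q q2).

Definition subp U Z := forall x, U x -> Z x.

Lemma subp_anti U Z : subp U Z -> subp Z U -> U = Z.
Proof. by move=> UZ ZU; apply: functional_extensionality => x; apply/idP/idP => [/UZ|/ZU]. Qed.

Lemma itr_subp (F : 'I_N -> ('I_N -> bool) -> 'I_N -> bool) U :
  (forall i S, subp (F i S) S) -> subp (itr U F) U.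
Proof.
move=> FS; rewrite /itr; elim: (enum _) U => [|i l IH] U x //= /IH; exact: FS.
Qed.

(** As the steps only shrink the set, a pass that returns the set it started from has changed
    nothing at any step. *)
Lemma itr_fix (F : 'I_N -> ('I_N -> bool) -> 'I_N -> bool) U :
  (forall i S, subp (F i S) S) -> itr U F = U -> forall i, F i U = U.
Proof.
move=> FS; rewrite /itr => eU i; have: i \in enum 'I_N by rewrite mem_enum.
have sub l S : subp (foldl (fun s i => F i s) S l) S.
  by elim: l S => [|j l IH] S x //= /IH; apply: FS.
elim: (enum _) eU => // j l IH /= eU; have ej : F j U = U.
  by apply: subp_anti; [exact: FS|rewrite -{1}eU; exact: sub].
by rewrite ej in eU; rewrite inE => /orP[/eqP->|/IH]; [|apply].
Qed.

(** Every round before stability loses a vertex, and a set that has lost [N] of them is empty. *)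
Lemma itr_stable (g : ('I_N -> bool) -> 'I_N -> bool) U : (forall S, subp (g S) S) ->
  g (itr U (fun _ : 'I_N => g)) = itr U (fun _ : 'I_N => g).
Proof.
move=> gS; set S := itr _ _.
have [//|lt] : g S = S \/ #|[pred x | S x]| + N <= N.
  apply: (@itr_ind N _ (fun=> g) (fun i S => g S = S \/ #|[pred x | S x]| + i <= N)).
    by right; rewrite addn0 -[X in _ <= X]card_ord max_card.
  move=> i S' [e|le]; first by left; rewrite e.
  have [e|ne] := eqVneq #|[pred x | g S' x]| #|[pred x | S' x]|.
    left; congr (g _).
    apply: subp_anti; [exact: gS|move=> x S'x].
    have /subset_leqif_card[_ sub] : [pred x | g S' x] \subset [pred x | S' x].
      by apply/subsetP => z; rewrite !inE; apply: gS.
    by move: sub; rewrite e eqxx => /esym/subsetP/(_ x); rewrite !inE; apply.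
  right; have : #|[pred x | g S' x]| < #|[pred x | S' x]|.
    rewrite ltn_neqAle ne; apply/subset_leq_card/subsetP => z; rewrite !inE; exact: gS.
  by lia.
apply: subp_anti; [exact: gS|move=> x Sx]; have /card0_eq/(_ x) : #|[pred x | S x]| = 0 by lia.
by rewrite !inE Sx.
Qed.

Lemma shrink_by_sub E C p q q2 U A B : subp (shrink_by E C p q q2 U A B) U.
Proof. by move=> x /andP[]. Qed.

Lemma shrink_fix E C bits p q q2 v b1 u b2 (U := shrink E C bits p q q2) :
  shrink1 E C bits p q q2 v b1 u b2 U = U.
Proof.
have s1 v' b1' u' b2' S : subp (shrink1 E C bits p q q2 v' b1' u' b2' S) S by exact: shrink_by_sub.
have s2 v' b1' u' S : subp (itr S (fun b2 => shrink1 E C bits p q q2 v' b1' u' b2)) S.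
  exact: itr_subp.
have s3 v' b1' S : subp (itr S (fun u S => itr S (fun b2 => shrink1 E C bits p q q2 v' b1' u b2))) S.
  by apply: itr_subp => *; apply: s2.
have s4 v' S : subp (itr S (fun b1 S => itr S (fun u S => itr S (fun b2 => shrink1 E C bits p q q2 v' b1 u b2)))) S.
  by apply: itr_subp => *; apply: s3.
have fU : shrink_pass E C bits p q q2 U = U.
  by apply: itr_stable => S; apply: itr_subp => *; apply: s4.
have f4 := itr_fix (fun i S => s4 i S) fU v.
have f3 := itr_fix (fun i S => s3 v i S) f4 b1.
have f2 := itr_fix (fun i S => s2 v b1 i S) f3 u.
exact: (itr_fix (fun i S => s1 v b1 u i S) f2 b2).
Qed.

Definition border E U : nat := #|[pred u : 'I_N * 'I_N | [&& E u.1 u.2, U u.1 & ~~ U u.2]]|.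

Definition good E C (p q2 : nat) U := [/\ compat C U, p < clsn C U & border E U <= q2].

(** The edges leaving [U] are shared between the two parts; only the cut counts on both sides. With
    a border of at most [2 Q] and a cut of at most [Q] the sum is at most [4 Q], so one part again
    has border at most [2 Q]. This is where the bound [Q2 = Q + Q] comes from. *)
Lemma border_split E U Z : symmetric E ->
  border E (fun x => U x && Z x) + border E (fun x => U x && ~~ Z x) <= border E U + 2 * cut E U Z.
Proof.
move=> sE; pose e1 := #|[pred u : 'I_N * 'I_N | [&& E u.1 u.2, U u.1 && Z u.1 & ~~ U u.2]]|.
pose e2 := #|[pred u : 'I_N * 'I_N | [&& E u.1 u.2, U u.1 && ~~ Z u.1 & ~~ U u.2]]|.
have le1 : border E (fun x => U x && Z x) <= e1 + cut E U Z.
  rewrite /border -(cardID [pred u : 'I_N * 'I_N | U u.2]) addnC; apply: leq_add;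
    apply/subset_leq_card/subsetP => -[x y]; rewrite !inE /=;
    by case: (E x y); case: (U x); case: (U y); case: (Z x); case: (Z y).
have cutC : cut E U Z = #|[pred u : 'I_N * 'I_N | [&& E u.1 u.2, U u.1 && ~~ Z u.1 & U u.2 && Z u.2]]|.
  rewrite /cut -!sum1_card (reindex_inj (h := fun w : 'I_N * 'I_N => (w.2, w.1))) /=; last by move=> [? ?] [? ?] /= [-> ->].
  by apply: eq_bigl => -[x y]; rewrite !inE /= sE; case: (E x y) => //=; rewrite andbC.
have le2 : border E (fun x => U x && ~~ Z x) <= e2 + cut E U Z.
  rewrite cutC /border -(cardID [pred u : 'I_N * 'I_N | U u.2]) addnC; apply: leq_add;
    apply/subset_leq_card/subsetP => -[x y]; rewrite !inE /=;
    by case: (E x y); case: (U x); case: (U y); case: (Z x); case: (Z y).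
have : e1 + e2 <= border E U.
  rewrite /border -(cardID [pred u : 'I_N * 'I_N | Z u.1] [pred u : 'I_N * 'I_N | [&& E u.1 u.2, U u.1 & ~~ U u.2]]).
  apply: leq_add; apply/subset_leq_card/subsetP => -[x y]; rewrite !inE /=;
    by case: (E x y); case: (U x); case: (U y); case: (Z x); case: (Z y).
lia.
Qed.

Variables (E C bits : 'I_N -> 'I_N -> bool) (p q q2 : 'I_N).
Hypotheses (symE : symmetric E) (eqC : equivr C) (q2E : q2 = q + q :> nat).

Lemma clsleE X m : clsle C X m = (clsn C X <= m).
Proof. by []. Qed.

(** The properties that do not rest on the value of the flow; [shrink] runs over all guesses,
    including those that no small cut separates. *)
Lemma sink_side_sub U A B : compat C U -> subp A U ->
  [/\ compat C (sink_side E C U A B), subp A (sink_side E C U A B) & subp (sink_side E C U A B) U].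
Proof.
move=> compU AU; have [C1 C2 C3] := eqC; set Z := sink_side _ _ _ _ _.
have step x y : Z x -> resid E C U (flow E C U A B) x y -> Z y.
  move=> /exbP[a /andP[Aa axy]] rxy; apply/exbP; exists a; rewrite Aa.
  by apply: connect_trans axy (connect1 rxy).
split.
- move=> x y Cxy; apply/idP/idP => Zx; apply: step Zx _; rewrite /resid ?Cxy //.
  by rewrite C2 Cxy.
- by move=> x Ax; apply/exbP; exists x; rewrite Ax /conn connect0.
move=> y /exbP[x /andP[/AU Ux /connectP[l]]].
elim: l x Ux => [|z l IH] x Ux /=; first by move=> _ ->.
move=> /andP[/orP[Cxz|/and4P[_ Uz _ _]] pl]; last exact: IH.
by apply: IH; rewrite // -(compU _ _ Cxz).
Qed.

Lemma shrink_by_good U A B : compat C A -> subp A U -> subp B U -> good E C p q2 U ->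
  good E C p q2 (shrink_by E C p q q2 U A B).
Proof.
move=> compA AU BU [compU p_U q_U]; rewrite /shrink_by /=; set Z := sink_side _ _ _ _ _.
have [compZ AZ ZU] := sink_side_sub B compU AU; rewrite -/Z in compZ AZ ZU.
have [/and4P[pA pB /exbP BZ cutZ]|nb] := boolP (breaks _ _ _ _ _ _ _ _); last first.
  suff -> : (fun x => U x && (false ==> (Z x == card2le (fun x y => [&& E x y, U x && Z x & ~~ (U y && Z y)]) q2))) = U by [].
  by apply: functional_extensionality => x; rewrite andbT.
rewrite !clsleE -!ltnNge in pA pB.
have le_cut : cut E U Z <= q by [].
have [le_b|gt_b] := boolP (card2le _ q2).
  have -> : (fun x => U x && (true ==> (Z x == true))) = (fun x => U x && Z x).
    by apply: functional_extensionality => x; rewrite eqb_id.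
  split; [|apply: leq_trans pA _; apply: clsn_le => x Ax; rewrite AU ?AZ //|exact: le_b].
  by move=> x y Cxy; rewrite (compU _ _ Cxy) (compZ _ _ Cxy).
have -> : (fun x => U x && (true ==> (Z x == false))) = (fun x => U x && ~~ Z x).
  by apply: functional_extensionality => x; case: (Z x).
split.
- by move=> x y Cxy; rewrite (compU _ _ Cxy) (compZ _ _ Cxy).
- apply: leq_trans pB _; apply: clsn_le => x Bx; rewrite BU //=.
  by apply/negP => Zx; apply: BZ; exists x; rewrite Bx.
- have := border_split U Z symE; rewrite /card2le -/(border E _) -ltnNge in gt_b.
  move: gt_b; rewrite q2E => gt_b; have : q2 < border E (fun x => U x && Z x) by rewrite q2E.
  by rewrite q2E in q_U *; lia.
Qed.

Lemma shrink_good : p < clsn C (fun=> true) -> good E C p q2 (shrink E C bits p q q2).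
Proof.
move=> lt_p; have [C1 C2 C3] := eqC.
have good1 v b1 u b2 U : good E C p q2 U -> good E C p q2 (shrink1 E C bits p q q2 v b1 u b2 U).
  move=> gU; have [compU _ _] := gU.
  have [cA AU] := grow_sound E (fun x => x == v) (bits b1) eqC compU.
  have [cB BU] := grow_sound E (fun x => x == u) (bits b2) eqC compU.
  exact: shrink_by_good.
have I (F : 'I_N -> ('I_N -> bool) -> 'I_N -> bool) S : good E C p q2 S ->
    (forall i S, good E C p q2 S -> good E C p q2 (F i S)) -> good E C p q2 (itr S F).
  by move=> gS gF; apply: (@itr_ind _ _ _ (fun=> good E C p q2)).
apply: (I) => [|_ S gS]; last first.
  rewrite /shrink_pass; apply: (I) => // v S1 g1; apply: (I) => // b1 S2 g2; apply: (I) => // u S3 g3.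
  by apply: (I) => // b2 S4; apply: good1.
by split=> //; rewrite /border eq_card0 // => u; rewrite !inE andbF.
Qed.

Definition big Z := exists2 v, Z v & p < clsn C (conn (restr E C Z) v).

Definition unbreakable U := forall D, compat C D -> cut E U D <= q ->
  ~ (big (fun x => U x && D x) /\ big (fun x => U x && ~~ D x)).

Lemma fringe_cut U D v : D v -> U v ->
  #|fringe E U (fun x => x == v) (fun x => U x && D x)| <= cut E U D.
Proof.
move=> Dv Uv; pose P := [pred w : 'I_N * 'I_N | [&& E w.1 w.2, U w.1 && D w.1 & U w.2 && ~~ D w.2]].
suff le : #|fringe E U (fun x => x == v) (fun x => U x && D x)| <= #|image snd P|.
  exact: leq_trans le (leq_image_card snd P).
apply/subset_leq_card/subsetP => x; rewrite !inE => /and3P[Ux nD /orP[/eqP ex|/exbP[y /andP[/andP[Uy Dy] Eyx]]]].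
  by rewrite ex Uv Dv in nD.
by apply/imageP; exists (y, x) => //; rewrite inE /= Eyx Uy Dy Ux /=; rewrite Ux in nD.
Qed.

Hypothesis bitsE : bits = @bit_table N.

(** From a set [D] that breaks the region, growing at [v] and at [u] yields guesses [A] and [B] with
    more than [p] classes on the two sides. [D] separates them by at most [q] edges, so the minimum
    cut passes the test [breaks] and the corresponding step removes [A] or [B] from the region,
    which is however a fixed point. *)
Lemma shrink_unbreakable m : p < clsn C (fun=> true) -> 2 ^ m <= N -> p + q < m ->
  unbreakable (shrink E C bits p q q2).
Proof.
move=> lt_p le_N lt_m; have [compU p_U q_U] := shrink_good lt_p.
have fixU := @shrink_fix E C bits p q q2; set U := shrink E C bits p q q2 in compU p_U q_U fixU *.
move=> D compD le_cut [[v /andP[Uv Dv] big_v] [u /andP[Uu Du] big_u]].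
have cutC : cut E U (fun x => ~~ D x) <= q.
  apply: leq_trans le_cut; rewrite /cut -!sum1_card (reindex_inj (h := fun w : 'I_N * 'I_N => (w.2, w.1))) /=; last by move=> [? ?] [? ?] /= [-> ->].
  rewrite (eq_bigl [pred u : 'I_N * 'I_N | [&& E u.1 u.2, U u.1 && D u.1 & U u.2 && ~~ D u.2]]) //.
  by move=> [x y]; rewrite !inE /= symE negbK; case: (E x y) => //=; rewrite andbC.
have compUD : compat C (fun x => U x && D x) by move=> x y Cxy; rewrite (compU _ _ Cxy) (compD _ _ Cxy).
have compUnD : compat C (fun x => U x && ~~ D x) by move=> x y Cxy; rewrite (compU _ _ Cxy) (compD _ _ Cxy).
have [|||||b1 [pA A_D]] := @grow_big N E C U (fun x => x == v) (fun x => U x && D x) eqC compUD _ m p v le_N.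
- by move=> x /andP[].
- by apply: leq_ltn_trans lt_m; rewrite leq_add2l; apply: leq_trans le_cut; apply: fringe_cut.
- by rewrite Uv.
- exact: eqxx.
- exact: big_v.
have [|||||b2 [pB B_D]] := @grow_big N E C U (fun x => x == u) (fun x => U x && ~~ D x) eqC compUnD _ m p u le_N.
- by move=> x /andP[].
- by apply: leq_ltn_trans lt_m; rewrite leq_add2l; apply: leq_trans cutC; apply: fringe_cut.
- by rewrite Uu.
- exact: eqxx.
- exact: big_u.
have := fixU v b1 u b2; rewrite /shrink1 bitsE /shrink_by /=.
set A := grow _ _ _ _ _ in pA A_D *; set B := grow _ _ _ _ _ in pB B_D *.
set Z := sink_side _ _ _ _ _ => eU.
have AU x : A x -> U x by move=> /A_D/andP[].
have sepD : separates C A B D.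
  by split=> // x; [move=> /A_D/andP[]|move=> /B_D/andP[]].
have lt_q : q < N by [].
have [[compZ AZ BZ] ZU cutZ] := sink_sideP symE eqC compU AU lt_q sepD le_cut.
rewrite -/Z in compZ AZ BZ ZU cutZ.
have br : breaks E C p q U A B Z.
  rewrite /breaks !clsleE -!ltnNge pA pB /=; apply/andP; split=> //.
  by apply/exbP => -[x /andP[/BZ nZ Zx]]; rewrite Zx in nZ.
have nonempty X : p < clsn C X -> exists x, X x.
  by move=> /(leq_ltn_trans (leq0n _))/card_gt0P[x]; rewrite inE => /andP[Xx _]; exists x.
have [a Aa] := nonempty _ pA; have [b Bb] := nonempty _ pB.
have Ub : U b by case/andP: (B_D _ Bb).
have := congr1 (@^~ a) eU; have := congr1 (@^~ b) eU; rewrite /= br !implyTb Ub AU // (AZ _ Aa) (negbTE (BZ _ Bb)) /=.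
by case: card2le.
Qed.

End Shrink.

(** * Coarsening *)

Section Coarsen.
Variable N : nat.
Implicit Types (E C F W : 'I_N -> 'I_N -> bool) (c U D X Y Z : 'I_N -> bool) (x y z v b : 'I_N).

Definition flip c D x : bool := c x (+) D x.

Definition rkle F (m : 'I_N) : bool := cardle (nonmin (conn F)) m.

Definition bd E U x : bool := U x && exb (fun y => E x y && ~~ U y).

Definition terminals E c U x : bool := U x && exb (fun y => E x y && (~~ U y || (c x == c y))).

Definition guess E c C U (bits : 'I_N -> 'I_N -> bool) b : 'I_N -> bool :=
  grow E C U (terminals E c U) (bits b).

Definition inner E c U X x y : bool := [&& U x, U y & monochr E (flip c X) x y].

(** Equality of the two ranks is expressed by comparing both with every element. *)
Definition same E c U X Y : bool :=
  [&& allb (fun x => bd E U x ==> (X x == Y x)),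
      allb (fun x => allb (fun y => (bd E U x && bd E U y) ==>
        (conn (inner E c U X) x y == conn (inner E c U Y) x y))) &
      allb (fun m => rkle (inner E c U X) m == rkle (inner E c U Y) m)].

Definition kept E c U W (k : 'I_N) b : bool :=
  rkle (inner E c U (W b)) k &&
  ~~ exb (fun b' : 'I_N => [&& b' < b, rkle (inner E c U (W b')) k & same E c U (W b) (W b')]).

Definition coarsen E c C U W (k P : 'I_N) x y : bool :=
  C x y || [&& ~~ clsle C (fun=> true) P, U x, U y &
               allb (fun b => kept E c U W k b ==> (W b x == W b y))].

Definition coarsen_step E c bits (k Q Q2 P : 'I_N) C : 'I_N -> 'I_N -> bool :=
  let U := shrink E C bits P Q Q2 in coarsen E c C U (guess E c C U bits) k P.

Definition coarsen_all E c bits (k Q Q2 P : 'I_N) : 'I_N -> 'I_N -> bool :=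
  itr (fun x y => x == y) (fun _ : 'I_N => coarsen_step E c bits k Q Q2 P).

Definition fits E c W (k : 'I_N) b : bool := rkle (monochr E (flip c (W b))) k.

Definition recolor E c W (k : 'I_N) x : bool :=
  c x (+) exb (fun b => [&& W b x, fits E c W k b & ~~ exb (fun b' : 'I_N => (b' < b) && fits E c W k b')]).

Definition compress E bits (k Q Q2 P : 'I_N) c : 'I_N -> bool :=
  recolor E c (guess E c (coarsen_all E c bits k Q Q2 P) (fun=> true) bits) k.

(** The order in which edges are inserted is lexicographic. The pair [(a, b)] itself is included:
    the repair takes place after its insertion. *)
Definition before (a b x y : 'I_N) : bool := (x < a) || ((x == a) && ~~ (b < y)).

Definition upto E (a b x y : 'I_N) : bool := E x y && (before a b x y || before a b y x).

Definition solve E bits (k Q Q2 P : 'I_N) : 'I_N -> bool :=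
  itr (fun=> false) (fun a c => itr c (fun b => compress (upto E a b) bits k Q Q2 P)).

Lemma rkleE F m : rkle F m = (rk F <= m).
Proof. by []. Qed.

Lemma sameP E c U X Y : reflect
  [/\ forall x, bd E U x -> X x = Y x,
      forall x y, bd E U x -> bd E U y -> conn (inner E c U X) x y = conn (inner E c U Y) x y &
      forall m, rkle (inner E c U X) m = rkle (inner E c U Y) m] (same E c U X Y).
Proof.
apply: (iffP and3P) => [[/allbP h1 /allbP h2 /allbP h3]|[h1 h2 h3]]; split.
- by move=> x bx; apply/eqP; have := h1 x; rewrite bx.
- by move=> x y bx by_; apply/eqP; have /allbP/(_ y) := h2 x; rewrite bx by_.
- by move=> m; exact: (eqP (h3 m)).
- by apply/allbP => x; apply/implyP => bx; rewrite h1.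
- by apply/allbP => x; apply/allbP => y; apply/implyP => /andP[bx by_]; rewrite h2.
- by apply/allbP => m; rewrite h3.
Qed.

Lemma same_trans E c U X Y Z : same E c U X Y -> same E c U Y Z -> same E c U X Z.
Proof.
move=> /sameP[h1 h2 h3] /sameP[g1 g2 g3]; apply/sameP; split=> [x bx|x y bx by_|m].
- by rewrite h1 // g1.
- by rewrite h2 // g2.
- by rewrite h3 g3.
Qed.

Lemma flipK c D x : flip c (flip c D) x = D x.
Proof. by rewrite /flip addbA addbb. Qed.

Lemma eq_monochr E c c' : c =1 c' -> monochr E c =2 monochr E c'.
Proof. by move=> cc x y; rewrite /monochr !cc. Qed.

Variables (E : 'I_N -> 'I_N -> bool) (c : 'I_N -> bool) (k Q Q2 : 'I_N).
Hypotheses (symE : symmetric E) (irrE : irreflexive E) (rk_c : rk (monochr E c) <= k.+1).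
Hypothesis QE : 8 * k.+1 ^ 2 <= Q.

Definition sol D := rk (monochr E (flip c D)) <= k.

(* An edge between [D] and its complement is monochromatic for exactly one of the two colorings. *)
Lemma cut_sol U D : sol D -> cut E U D <= Q.
Proof.
move=> solD; apply: leq_trans QE.
have le1 := edges_le (monochr_sym c symE) (monochr_irr c irrE).
have le2 := edges_le (monochr_sym (flip c D) symE) (monochr_irr (flip c D) irrE).
(* Origin of the factor 8: two colorings of rank at most [k.+1], each with at most [(2 * k.+1) ^ 2]
   ordered monochromatic pairs. *)
apply: (@leq_trans ((2 * k.+1) ^ 2 + (2 * k.+1) ^ 2)); last by rewrite -!mulnn; lia.
have h1 : (2 * rk (monochr E c)) ^ 2 <= (2 * k.+1) ^ 2 by rewrite leq_sqr leq_mul2l.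
have h2 : (2 * rk (monochr E (flip c D))) ^ 2 <= (2 * k.+1) ^ 2.
  by rewrite leq_sqr leq_mul2l /=; apply: leqW.
apply: leq_trans (leq_add (leq_trans le1 h1) (leq_trans le2 h2)).
rewrite /cut -(cardID [pred w : 'I_N * 'I_N | c w.1 == c w.2] [pred u : 'I_N * 'I_N | [&& E u.1 u.2, U u.1 && D u.1 & U u.2 && ~~ D u.2]]).
apply: leq_add; apply/subset_leq_card/subsetP => -[x y]; rewrite !inE /= /monochr /flip;
  by case: (E x y); case: (U x); case: (U y); case: (c x); case: (c y); case: (D x); case: (D y).
Qed.

Lemma card_terminals U : border E U <= Q2 -> #|[pred x | terminals E c U x]| <= Q2 + 2 * k.+1.
Proof.
move=> leU; have leT := touched_le (monochr_sym c symE) (monochr_irr c irrE).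
have h : 2 * rk (monochr E c) <= 2 * k.+1 by rewrite leq_mul2l.
apply: leq_trans (leq_add leU (leq_trans leT h)).
apply: (@leq_trans (#|image fst [pred w : 'I_N * 'I_N | [&& E w.1 w.2, U w.1 & ~~ U w.2]]| +
                    #|[pred x | exb (monochr E c x)]|)); last first.
  by rewrite leq_add2r; apply: leq_image_card.
rewrite -(cardID [pred x | exb (monochr E c x)]) addnC; apply: leq_add; last first.
  by apply/subset_leq_card/subsetP => x; rewrite !inE => /andP[].
apply/subset_leq_card/subsetP => x; rewrite !inE => /andP[nx /andP[Ux /exbP[y /andP[Exy]]]].
move=> /orP[nUy|cxy]; first by apply/imageP; exists (x, y); rewrite ?inE //= Exy Ux.
by case/negP: nx; apply/exbP; exists y; rewrite /monochr Exy.
Qed.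

Lemma card_bd U : #|[pred x | bd E U x]| <= border E U.
Proof.
apply: leq_trans (leq_image_card fst [pred w : 'I_N * 'I_N | [&& E w.1 w.2, U w.1 & ~~ U w.2]]).
apply/subset_leq_card/subsetP => x; rewrite !inE => /andP[Ux /exbP[y /andP[Exy nUy]]].
by apply/imageP; exists (x, y); rewrite ?inE //= Exy Ux.
Qed.

(** * Solutions and guesses inside one region *)

Section Represent.
Variables (C : 'I_N -> 'I_N -> bool) (U D : 'I_N -> bool) (P : 'I_N) (L : nat).
Hypotheses (eqC : equivr C) (compU : compat C U) (leU : border E U <= Q2).
Hypotheses (compD : compat C D) (solD : sol D).
Hypotheses (ltL : (Q2 + 2 * k.+1) * P.+1 + Q < L) (leN : 2 ^ L <= N).

Local Notation T := (terminals E c U).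

(** The union of the pieces of [X] that contain a terminal: the part of [X] that growing from the
    terminals can produce. *)
Definition attached X x := X x && exb (fun v => [&& X v, T v & conn (restr E C X) v x]).

Lemma attachedP X x : attached X x -> exists v, [/\ attached X v, T v & conn (restr E C (attached X)) v x].
Proof.
move=> /andP[Xx /exbP[v /and3P[Xv Tv /connectP[p pp ex]]]].
have av u : X u -> conn (restr E C X) v u -> attached X u.
  by move=> Xu vu; rewrite /attached Xu; apply/exbP; exists v; rewrite Xv Tv.
exists v; split=> //; first by apply: av; rewrite /conn ?connect0.
suff gen u l : X u -> conn (restr E C X) v u -> path (restr E C X) u l ->
    conn (restr E C (attached X)) u (last u l).
  by rewrite ex; apply: gen => //; apply: connect0.
elim: l u => [|w l IH] u Xu vu /=; first by rewrite /conn connect0.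
move=> /andP[ruw pl]; have vw := connect_trans vu (connect1 ruw).
have /and3P[_ Xw EC] := ruw.
by apply: connect_trans (connect1 _) (IH w Xw vw pl); rewrite /restr EC !av.
Qed.

(** [side] exchanges [D] with its complement. Every piece counted holds a terminal and has at most
    [P] classes, which bounds the classes. A vertex of the fringe is a terminal or the far end of an
    edge cut by [D], as a neighbour on the same side would be attached. The sum stays below [L]
    bits. *)
Lemma attached_guess (side : bool) :
  ~ big E C P (fun x => U x && (D x (+) side)) ->
  exists b, guess E c C U (@bit_table N) b =1 attached (fun x => U x && (D x (+) side)).
Proof.
set X := (fun x => U x && _) => nbig; have [C1 C2 C3] := eqC.
have compX : compat C X by move=> x y Cxy; rewrite /X (compU Cxy) (compD Cxy).
have card_T := card_terminals leU.
have cut_side : cut E U (fun x => D x (+) side) <= Q.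
  rewrite (_ : cut E U _ = if side then cut E U (fun x => ~~ D x) else cut E U D).
    case: (side); last exact: cut_sol.
    have sol' : sol (fun x => ~~ D x).
      by apply: leq_trans solD; rewrite (eq_rk (G := monochr E (flip c D))) // => x y;
        rewrite /monochr /flip; case: (c x); case: (c y); case: (D x); case: (D y).
    exact: cut_sol.
  by case: (side); apply: eq_card => -[x y]; rewrite !inE ?addbT ?addbF.
apply: (grow_exact eqC _ _ leN).
- have sub x y : C x y -> attached X x -> attached X y.
    move=> Cxy /andP[Xx /exbP[v /and3P[Xv Tv vx]]]; rewrite /attached -(compX _ _ Cxy) Xx.
    apply/exbP; exists v; rewrite Xv Tv /=; apply: connect_trans vx (connect1 _).
    by rewrite /restr Xx -(compX _ _ Cxy) Xx Cxy orbT.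
  by move=> x y Cxy; apply/idP/idP; apply: sub; rewrite // C2.
- by move=> x /andP[/andP[]].
- have le_f : #|fringe E U T (attached X)| <= #|[pred x | T x]| + Q.
    apply: leq_trans (leq_add (leqnn _) cut_side).
    apply: leq_trans (leq_add (leqnn _) (leq_image_card snd _)).
    rewrite -(cardID [pred x | T x]); apply: leq_add; apply/subset_leq_card/subsetP => x; rewrite !inE.
      by case/andP.
    move=> /andP[nT /and3P[Ux nA]]; rewrite (negbTE nT) /= => /exbP[y /andP[Ay Eyx]].
    have /andP[Xy /exbP[v /and3P[Xv Tv vy]]] := Ay; have /andP[Uy sy] := Xy.
    apply/imageP; exists (y, x) => //; rewrite inE /= Eyx Uy Ux sy /=.
    apply: contra nA => sx; have Xx : X x by rewrite /X Ux.
    rewrite /attached Xx; apply/exbP; exists v; rewrite Xv Tv /=.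
    by apply: connect_trans vy (connect1 _); rewrite /restr Xy Xx Eyx.
  have le_c : clsn C (attached X) <= #|[pred x | T x]| * P.
    pose r v x := [&& X v, T v, conn (restr E C X) v x & ~~ nonmin C x].
    apply: (@leq_trans #|image snd [pred w : 'I_N * 'I_N | r w.1 w.2]|).
      apply/subset_leq_card/subsetP => x; rewrite !inE.
      move=> /andP[/andP[Xx /exbP[v /and3P[Xv Tv vx]]] nx].
      by apply/imageP; exists (v, x); rewrite ?inE //= /r Xv Tv nx vx.
    apply: leq_trans (leq_image_card _ _) _; rewrite card_pairs -sum_nat_const.
    rewrite [X in _ <= X]big_mkcond /=; apply: leq_sum => v _; rewrite inE.
    case Tv : (T v); last by rewrite eq_card0 // => x; rewrite !inE /r Tv andbF.
    have [Xv|nXv] := boolP (X v); last by rewrite eq_card0 // => x; rewrite !inE /r (negbTE nXv).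
    rewrite leqNgt; apply/negP => lt; apply: nbig; exists v => //.
    by apply: leq_trans lt _; apply/subset_leq_card/subsetP => x; rewrite !inE => /and4P[_ _ -> ->].
  apply: leq_ltn_trans ltL; move: card_T le_f le_c; move: #|_| => t card_T le_f le_c.
  rewrite mulnS; have : t * P <= (Q2 + 2 * k.+1) * P by rewrite leq_mul2r card_T orbT.
  lia.
- exact: attachedP.
Qed.

Local Notation W := (guess E c C U (@bit_table N)).

Definition patch X (side : bool) x : bool := if U x then X x (+) side else D x.

(** Moving the unattached pieces creates no monochromatic edge. Such a piece has no terminal, so its
    edges stay in [U] and are properly colored by [c]. An edge leaving the piece crosses [D], hence
    is monochromatic after flipping [D], and the move makes it properly colored again. *)
Lemma sol_guess : unbreakable E C P Q U -> exists side b, sol (patch (W b) side).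
Proof.
move=> /(_ D compD (cut_sol U solD)) nbig.
have [side nb] : exists side, ~ big E C P (fun x => U x && (D x (+) side)).
  have e0 : (fun x => U x && (D x (+) false)) = (fun x => U x && D x).
    by apply: functional_extensionality => x; rewrite addbF.
  have e1 : (fun x => U x && (D x (+) true)) = (fun x => U x && ~~ D x).
    by apply: functional_extensionality => x; rewrite addbT.
  apply: NNPP => no; apply: nbig; rewrite -e0 -e1.
  by split; apply: NNPP => nb; apply: no; [exists false|exists true].
have [b bP] := attached_guess nb; exists side, b; apply: leq_trans solD.
set X := (fun x => U x && _) in nb bP.
apply: rk_le => x y /andP[Exy /eqP cxy]; apply: connect1; rewrite /monochr Exy.
have at_ u w : X u -> ~~ attached X u -> E u w -> [/\ U w, c u != c w & X w -> ~~ attached X w].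
  move=> Xu nAu Euw; have /andP[Uu su] := Xu; have nTu : ~~ T u.
    by apply: contra nAu => Tu; rewrite /attached Xu; apply/exbP; exists u; rewrite Xu Tu /conn connect0.
  have nb_u : forall w, E u w -> U w && (c u != c w).
    move=> w' Euw'; apply: contraNT nTu; rewrite negb_and negbK => h; rewrite /terminals Uu.
    by apply/exbP; exists w'; rewrite Euw'.
  have /andP[Uw cw] := nb_u w Euw; split=> // Xw; apply: contra nAu => /andP[_ /exbP[v /and3P[Xv Tv vw]]].
  rewrite /attached Xu; apply/exbP; exists v; rewrite Xv Tv /=.
  by apply: connect_trans vw (connect1 _); rewrite /restr Xw Xu symE Euw.
have XE u : U u -> X u = (D u (+) side) by move=> Uu; rewrite /X Uu.
have pE u : patch (W b) side u = D u (+) (X u && ~~ attached X u).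
  rewrite /patch bP; have [Uu|nUu] := boolP (U u); last by rewrite /X (negbTE nUu) addbF.
  rewrite /attached (XE u Uu); case: (exb _); rewrite ?andbT ?andbF ?addbF /=.
    by case: (D u); case: (side).
  by case: (D u); case: (side).
(* [f] marks the vertices moved to the other side of [D]; a monochromatic edge of the new coloring
   has both ends moved or none. *)
pose f u := X u && ~~ attached X u.
have key u w : E u w -> f u -> ~~ f w -> c u (+) (D u (+) f u) != c w (+) (D w (+) f w).
  move=> Euw fu nfw; have /andP[Xu nAu] := fu; have [Uw cuw XA] := at_ u w Xu nAu Euw.
  have nXw : ~~ X w by apply: contra nfw => Xw; rewrite /f Xw XA.
  have /andP[Uu _] := Xu; move: Xu nXw cuw; rewrite fu (negbTE nfw) !XE //.
  by case: (c u); case: (c w); case: (D u); case: (D w); case: (side).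
have fE : f x = f y.
  apply/idP/idP => [fx|fy]; apply/negPn/negP => nf.
    by have /negP[] := key x y Exy fx nf; apply/eqP; move: cxy; rewrite /flip !pE.
  by have /negP[] := key y x (etrans (symE y x) Exy) fy nf; apply/eqP; move: (esym cxy); rewrite /flip !pE.
by move: cxy; rewrite /flip !pE -/(f x) -/(f y) fE; case: (c x); case: (c y); case: (D x); case: (D y); case: (f y).
Qed.

(** The monochromatic edges with an end outside [U] see the guess only on the border, so they are
    the same for two guesses of equal behaviour, and [rk_glue] exchanges the graphs inside [U]. *)
Lemma sol_kept side b : sol (patch (W b) side) ->
  exists2 b', kept E c U W k b' & sol (patch (W b') side).
Proof.
pose out X x y := ~~ (U x && U y) && monochr E (flip c (patch X side)) x y.
(* Inside [U] the bit [side] flips both ends of an edge, so [inner] does not depend on it. *)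
have split_mono X : monochr E (flip c (patch X side)) =2 unionr (inner E c U X) (out X).
  move=> x y; rewrite /unionr /inner /out /monochr /flip /patch.
  case: (U x); case: (U y) => //=; rewrite orbF; congr (_ && _).
  by case: (c x); case: (c y); case: (X x); case: (X y); case: (side).
have sym_inner X : symmetric (inner E c U X).
  by move=> x y; rewrite /inner (monochr_sym _ symE) andbCA.
have sym_out X : symmetric (out X).
  by move=> x y; rewrite /out (monochr_sym _ symE) andbC [U x && _]andbC andbC.
move=> sol_b; have valid_b : rkle (inner E c U (W b)) k.
  apply: leq_trans sol_b; apply: rk_le => x y Fxy; apply: connect1.
  by rewrite split_mono /unionr Fxy.
have Pb : rkle (inner E c U (W b)) k && same E c U (W b) (W b) by rewrite valid_b; apply/sameP.
case: (arg_minnP (P := fun b' => rkle (inner E c U (W b')) k && same E c U (W b) (W b')) (fun b' : 'I_N => b') Pb).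
move=> b' /andP[valid' same'] min_b'; exists b'.
  rewrite /kept valid'; apply/exbP => -[b2 /and3P[lt_b2 v2 s2]].
  by have := min_b' b2; rewrite v2 (same_trans same' s2) => /(_ isT); rewrite leqNgt lt_b2.
have [h1 h2 h3] := sameP _ _ _ _ _ same'.
apply: leq_trans sol_b; rewrite (eq_rk (split_mono (W b'))) (eq_rk (split_mono (W b))).
have out_bd X x y : out X x y -> U x -> bd E U x.
  move=> /andP[nU /andP[Exy _]] Ux; rewrite /bd Ux; apply/exbP; exists y.
  by rewrite Ux in nU; rewrite Exy.
have eout : out (W b') =2 out (W b).
  move=> x y; rewrite /out; case nU: (U x && U y) => //=; rewrite /monochr.
  case Exy: (E x y) => //=; congr (_ == _); rewrite /flip /patch; congr (_ (+) _).
    case: ifP => // Ux; rewrite h1 // /bd Ux; apply/exbP; exists y.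
    by rewrite Ux /= in nU; rewrite Exy nU.
  case: ifP => // Uy; rewrite h1 // /bd Uy; apply/exbP; exists x.
  by rewrite Uy andbT in nU; rewrite symE Exy nU.
rewrite (eq_rk (G := unionr (inner E c U (W b')) (out (W b)))); last first.
  by move=> x y; rewrite /unionr eout.
rewrite (@rk_glue N (inner E c U (W b')) (inner E c U (W b)) (out (W b)) U (bd E U)) //.
- by move=> x y /and3P[].
- by move=> x y /and3P[].
- exact: out_bd.
- by move=> x y bx by_; rewrite h2.
(* [same] compares the ranks with elements only; being at most [k], both ranks are themselves
   elements, so they agree. *)
have lt1 : rk (inner E c U (W b)) < N by apply: leq_ltn_trans valid_b _.
have lt2 : rk (inner E c U (W b')) < N by apply: leq_ltn_trans valid' _.
have := h3 (Ordinal lt1); have := h3 (Ordinal lt2); rewrite !rkleE /= !leqnn => e1 e2.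
by apply/eqP; rewrite eqn_leq e1 -e2.
Qed.

Lemma compat_patch b side : kept E c U W k b -> compat (coarsen E c C U W k P) (patch (W b) side).
Proof.
move=> kb x y /orP[Cxy|/and4P[_ Ux Uy /allbP/(_ b)]]; last first.
  by rewrite kb /patch Ux Uy => /eqP->.
have [compW _] := grow_sound E T (bit_table b) eqC compU.
by rewrite /patch /guess (compU Cxy) (compD Cxy) (compW _ _ Cxy).
Qed.

End Represent.

(** Two kept guesses never have the same behaviour. The three factors count the traces on the
    border, the connectivity relations between border vertices and the ranks up to [k]. *)
Lemma card_kept U W : border E U <= Q2 ->
  #|[pred b | kept E c U W k b]| <= 2 ^ Q2 * (2 ^ Q2 ^ 2 * k.+1).
Proof.
move=> leU; pose B := [set x | bd E U x].
have leB : #|B| <= Q2 by apply: leq_trans leU; rewrite cardsE; apply: card_bd.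
pose key b : {set 'I_N} * ({set 'I_N * 'I_N} * 'I_k.+1) :=
  ([set x in B | W b x],
   ([set p in setX B B | conn (inner E c U (W b)) p.1 p.2], inord (rk (inner E c U (W b))))).
have le_k b : kept E c U W k b -> rk (inner E c U (W b)) < k.+1 by case/andP.
have kept_lt b1 b2 : b1 < b2 -> kept E c U W k b1 -> kept E c U W k b2 -> key b1 <> key b2.
  move=> lt k1 k2 [/setP e1 /setP e2 /(congr1 val)]; rewrite /= !inordK ?le_k // => e3.
  case/andP: (k2) => _ /negP[]; apply/exbP; exists b1; rewrite lt /=.
  case/andP: (k1) => -> _ /=; apply/sameP; split=> [x bx|x y bx by_|m].
  - by have := e1 x; rewrite !inE bx.
  - by have := e2 (x, y); rewrite !inE /= bx by_.
  - by rewrite !rkleE e3.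
have inj : {in [set b | kept E c U W k b] &, injective key}.
  move=> b1 b2; rewrite !inE => k1 k2 e; apply: ord_inj.
  by case: (ltngtP b1 b2) => // /kept_lt[] //.
rewrite -cardsE -(card_in_imset inj).
apply: (@leq_trans #|setX (powerset B) (setX (powerset (setX B B)) [set: 'I_k.+1])|).
  apply/subset_leq_card/subsetP => _ /imsetP[b _ ->]; rewrite !inE /= andbT.
  by apply/andP; split; apply/subsetP => x; rewrite inE => /andP[].
rewrite !cardsX !card_powerset cardsT card_ord cardsX.
apply: leq_mul; first by rewrite leq_exp2l.
by rewrite leq_mul2r leq_exp2l //= -mulnn leq_mul.
Qed.

Lemma coarsen_equivr C U W (P : 'I_N) : equivr C -> compat C U -> (forall b, compat C (W b)) ->
  equivr (coarsen E c C U W k P).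
Proof.
move=> [C1 C2 C3] compU compW; rewrite /coarsen; split=> [x|x y|y x z].
- by rewrite C1.
- rewrite C2; congr (_ || _); case: (clsle _ _ _) => //=; rewrite andbCA; congr [&& _, _ & _].
  by apply: eq_forallb => b; rewrite eq_sym.
move=> /orP[Cxy|/and4P[nP Ux Uy /allbP hxy]] /orP[Cyz|/and4P[nP' Uy' Uz /allbP hyz]].
- by rewrite (C3 _ _ _ Cxy Cyz).
- apply/orP; right; rewrite nP' Uz (compU _ _ Cxy) Uy' /=; apply/allbP => b.
  by rewrite (compW b _ _ Cxy).
- apply/orP; right; rewrite nP Ux -(compU _ _ Cyz) Uy /=; apply/allbP => b.
  by rewrite -(compW b _ _ Cyz).
- apply/orP; right; rewrite nP Ux Uz /=; apply/allbP => b; apply/implyP => kb.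
  by have := hxy b; have := hyz b; rewrite kb /= => /eqP<- /eqP->.
Qed.

(** Classes of [U] that stay distinct are told apart by a kept guess, so at most [P] remain where
    there were more than [P]; nothing is split outside [U]. *)
Lemma clsn_coarsen C U W (P : 'I_N) : equivr C -> compat C U -> (forall b, compat C (W b)) ->
  border E U <= Q2 -> 2 ^ (2 ^ Q2 * (2 ^ Q2 ^ 2 * k.+1)) <= P -> P < clsn C U ->
  clsn (coarsen E c C U W k P) (fun=> true) < clsn C (fun=> true).
Proof.
move=> eqC compU compW leU leP ltU; set C' := coarsen _ _ _ _ _ _ _.
have eqC' : equivr C' by apply: coarsen_equivr.
have ltV : ~~ clsle C (fun=> true) P.
  by rewrite /clsle /cardle -ltnNge; apply: leq_trans ltU _; apply: clsn_le.
have min_sub x : ~~ nonmin C' x -> ~~ nonmin C x.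
  apply: contra => /nonminP[y lt Cxy]; apply/nonminP; exists y => //.
  by rewrite /C' /coarsen Cxy.
have leU' : clsn C' U <= P.
  apply: leq_trans leP; pose K := [set b | kept E c U W k b].
  have le_K : #|K| <= 2 ^ Q2 * (2 ^ Q2 ^ 2 * k.+1) by rewrite cardsE; apply: card_kept.
  apply: leq_trans (leq_pexp2l (isT : 0 < 2) le_K); rewrite -card_powerset.
  pose key x := [set b in K | W b x].
  have inj : {in [set x | U x && ~~ nonmin C' x] &, injective key}.
    move=> x y; rewrite !inE => /andP[Ux nx] /andP[Uy ny] /setP e; apply: (least_unique eqC') => //.
    rewrite /C' /coarsen ltV Ux Uy /=; apply/orP; right; apply/allbP => b; apply/implyP => kb.
    by have := e b; rewrite !inE kb /= => ->.
  have -> : clsn C' U = #|[set x | U x && ~~ nonmin C' x]| by rewrite cardsE.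
  rewrite -(card_in_imset inj); apply/subset_leq_card/subsetP => _ /imsetP[x _ ->].
  by rewrite inE; apply/subsetP => b; rewrite inE => /andP[].
have split_clsn R : clsn R (fun=> true) = clsn R U + clsn R (fun x => ~~ U x).
  rewrite /clsn -(cardID [pred x | U x]); congr (_ + _); apply: eq_card => x; rewrite !inE /=.
  by rewrite andbC.
rewrite !split_clsn; have : clsn C' (fun x => ~~ U x) <= clsn C (fun x => ~~ U x).
  by apply/subset_leq_card/subsetP => x; rewrite !inE => /andP[-> /min_sub].
by have := leq_ltn_trans leU' ltU; lia.
Qed.

Lemma coarsen_done C U W (P : 'I_N) : clsn C (fun=> true) <= P -> coarsen E c C U W k P = C.
Proof.
move=> le; do 2!apply: functional_extensionality => ?.
by rewrite /coarsen /clsle /cardle le /= orbF.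
Qed.

Section Compress.
Variables (P : 'I_N) (L : nat).
Hypotheses (Q2E : Q2 = Q + Q :> nat) (leP : 2 ^ (2 ^ Q2 * (2 ^ Q2 ^ 2 * k.+1)) <= P).
Hypotheses (ltL : (Q2 + 2 * k.+1) * P.+1 + Q < L) (leN : 2 ^ L <= N).

Local Notation bits := (@bit_table N).

(** A round with more than [P] classes loses at least one and keeps some solution compatible,
    although not necessarily the same one; [N] rounds are therefore enough. *)
Lemma coarsen_allP D0 : sol D0 ->
  [/\ equivr (coarsen_all E c bits k Q Q2 P), clsn (coarsen_all E c bits k Q Q2 P) (fun=> true) <= P &
      exists2 D, compat (coarsen_all E c bits k Q Q2 P) D & sol D].
Proof.
move=> sol0; pose I i C := [/\ equivr C, (clsn C (fun=> true) <= P) || (clsn C (fun=> true) + i <= N) &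
  exists2 D, compat C D & sol D].
suff: I N (coarsen_all E c bits k Q Q2 P).
  by case=> eqC /orP[le|le] ex; split=> //; rewrite (leq_trans _ (leq0n P)) //; lia.
apply: (@itr_ind N _ _ I).
  split; last by exists D0 => // x y /eqP->.
    by split=> [x|x y|y x z]; [exact: eqxx|exact: eq_sym|move=> /eqP-> /eqP->].
  by rewrite addn0 -[X in _ || (_ <= X)]card_ord max_card orbT.
move=> i C [eqC le [D compD solD]]; have [done|more] := leqP (clsn C (fun=> true)) P.
  by rewrite /coarsen_step coarsen_done //; split; [|rewrite done|exists D].
rewrite leqNgt more /= in le; rewrite /coarsen_step.
have [compU ltU leU] := shrink_good bits symE eqC Q2E more.
set U := shrink _ _ _ _ _ _ in compU ltU leU *.
have compW b : compat C (guess E c C U bits b).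
  by have [] := grow_sound E (terminals E c U) (bits b) eqC compU.
split; first exact: coarsen_equivr.
  by apply/orP; right; have := clsn_coarsen eqC compU compW leU leP ltU; lia.
have unb : unbreakable E C P Q U.
  apply: (@shrink_unbreakable N E C bits P Q Q2 symE eqC Q2E (erefl _) L more leN).
  by move: ltL; rewrite mulnS mulnDl; have := leq_pmulr P (ltn0Sn k); lia.
have [side [b sb]] := sol_guess eqC compU leU compD solD ltL leN unb.
have [b' kb sb'] := sol_kept sb.
by exists (patch U D (guess E c C U bits b') side) => //; apply: compat_patch.
Qed.

(** With at most [P] classes in all no piece is big, so the whole vertex set is unbreakable, has an
    empty border, and falls under [sol_guess]. *)
Lemma compressP D0 : sol D0 -> rk (monochr E (compress E bits k Q Q2 P c)) <= k.
Proof.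
move=> /coarsen_allP[eqC le [D compD solD]]; rewrite /compress; set C := coarsen_all _ _ _ _ _ _ _ in eqC le compD *.
pose V := fun _ : 'I_N => true.
have compV : compat C V by [].
have leV : border E V <= Q2 by rewrite /border eq_card0 // => u; rewrite !inE !andbF.
have unb : unbreakable E C P Q V.
  move=> D' _ _ [[v _ big_v] _]; have := leq_trans big_v (clsn_le C (Y := V) _).
  by move=> /(_ (fun _ _ => isT)); rewrite ltnNge le.
have [side [b sb]] := sol_guess eqC compV leV compD solD ltL leN unb.
set W := guess _ _ _ _ _ in sb *.
have fit_b : fits E c W k b.
  rewrite /fits rkleE; apply: leq_trans sb.
  (* Flipping all vertices changes no monochromatic edge, so [side] can be forgotten. *)
  rewrite (@eq_rk N _ (monochr E (flip c (patch V D (W b) side)))) ?leqnn // => x y.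
  rewrite /monochr /flip /patch /=.
  by case: (E x y); case: (c x); case: (c y); case: (W b x); case: (W b y); case: (side).
case: (arg_minnP (P := fits E c W k) (fun b : 'I_N => b) fit_b) => b' fit'' min'; have := fit''; rewrite /fits rkleE => fit'; apply: leq_trans fit'.
rewrite (@eq_rk N _ (monochr E (flip c (W b')))) ?leqnn //; apply: eq_monochr => x.
rewrite /recolor /flip; congr (_ (+) _); apply/exbP/idP => [[b2 /and3P[Wx f2 /exbP no]]|Wx].
  suff <- : b2 = b' by [].
  apply: ord_inj; apply/eqP; rewrite eqn_leq min' // andbT leqNgt; apply/negP => lt.
  by apply: no; exists b'; rewrite lt.
exists b'; rewrite Wx fit'' /=; apply/exbP => -[b2 /andP[lt /min']].
by rewrite leqNgt lt.
Qed.

End Compress.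
End Coarsen.

(** * Inserting the edges one at a time *)

Section Solve.
Variables (N : nat) (E : 'I_N -> 'I_N -> bool) (k Q Q2 P : 'I_N) (L : nat).
Hypotheses (symE : symmetric E) (irrE : irreflexive E).
Hypotheses (QE : 8 * k.+1 ^ 2 <= Q) (Q2E : Q2 = Q + Q :> nat).
Hypothesis leP : 2 ^ (2 ^ Q2 * (2 ^ Q2 ^ 2 * k.+1)) <= P.
Hypotheses (ltL : (Q2 + 2 * k.+1) * P.+1 + Q < L) (leN : 2 ^ L <= N).

(** A solution of the whole graph is one of every subgraph, so each repair succeeds if there is a
    solution at all. In the other direction the computed coloring is itself the witness. *)
Lemma solveP : (exists c, rk (monochr E c) <= k) <->
  rk (monochr E (solve E (@bit_table N) k Q Q2 P)) <= k.
Proof.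
split=> [[c0 sol0]|le]; last by exists (solve E (@bit_table N) k Q Q2 P).
pose bf (a j : nat) (x y : 'I_N) := (x < a) || ((x == a :> nat) && (y < j)).
pose dn a j x y := E x y && (bf a j x y || bf a j y x).
have sub_rk (F G : 'I_N -> 'I_N -> bool) (c : 'I_N -> bool) : (forall x y, F x y -> G x y) -> rk (monochr F c) <= rk (monochr G c).
  move=> FG; apply: rk_le => x y /andP[/FG Gxy cxy]; apply: connect1; by rewrite /monochr Gxy.
have sym_dn a j : symmetric (dn a j) by move=> x y; rewrite /dn symE orbC.
pose I a c := rk (monochr (dn a 0) c) <= k.
suff: I N (solve E (@bit_table N) k Q Q2 P).
  by apply: leq_trans; apply: sub_rk => x y Exy; rewrite /dn Exy /bf ltn_ord.
apply: (@itr_ind _ _ _ I).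
  rewrite /I (eq_rk (G := srels [::])) ?rk_nil // => x y.
  by rewrite /monochr /dn /bf !ltn0 !andbF.
move=> a c Ia; pose J j c := rk (monochr (dn a j) c) <= k.
suff: J N (itr c (fun b => compress (upto E a b) (@bit_table N) k Q Q2 P)).
  apply: leq_trans; apply: sub_rk => x y /andP[Exy h]; rewrite /dn Exy /bf.
  by move: h; rewrite /bf; have := ltn_ord x; have := ltn_ord y; lia.
apply: (@itr_ind _ _ _ J); first exact: Ia.
move=> b c1 Jb.
have eu : upto E a b =2 dn a b.+1.
  by move=> x y; rewrite /upto /before /dn /bf -!val_eqE /= -!leqNgt !ltnS.
have symU : symmetric (upto E a b) by move=> x y; rewrite !eu sym_dn.
have irrU : irreflexive (upto E a b) by move=> x; rewrite /upto irrE.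
have rk1 : rk (monochr (upto E a b) c1) <= k.+1.
  apply: (@leq_trans (rk (addedge (monochr (dn a b) c1) a b))); last first.
    by rewrite rk_addedge ?(monochr_sym c1 (sym_dn a b)) //; [case: conn; rewrite /J in Jb *; lia|exact: monochr_sym].
  apply: rk_le => x y /andP[]; rewrite eu => /andP[Exy h] cxy; apply: connect1.
  rewrite /addedge /monochr /dn Exy cxy andbT /=; move: h; rewrite /bf -!(inj_eq val_inj) /=; lia.
rewrite /J (eq_rk (G := monochr (upto E a b) (compress (upto E a b) (@bit_table N) k Q Q2 P c1))); last first.
  by move=> x y; rewrite /monochr eu.
(* [flip c1 c0] is the set of vertices whose flipping turns [c1] into the solution [c0]. *)
apply: (@compressP N (upto E a b) c1 k Q Q2 symU irrU rk1 QE P L Q2E leP ltL leN (flip c1 c0)).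
apply: leq_trans sol0; apply: rk_le => x y; rewrite /monochr !flipK => /andP[/andP[Exy _] cxy].
by apply: connect1; rewrite Exy.
Qed.

End Solve.

(** * Definability of the algorithm *)

Notation fel G := (forall N, car G N -> 'I_N) (only parsing).
Notation fset G := (forall N, car G N -> 'I_N -> bool) (only parsing).
Notation frel G := (forall N, car G N -> 'I_N -> 'I_N -> bool) (only parsing).
Notation var1 s := (rel_in (S := shape1) s) (only parsing).
Notation var2 s := (rel_in (S := shape2) s) (only parsing).

Ltac def_op := fail.
Ltac def_all := cbn [emb sort shape1 shape2 fst snd]; repeat (cbv beta; first [def_op | def_step]).

Ltac count_op := match goal with
  | |- @definable ?G (fun N c => conn (@?r N c) (@?x N c) (@?y N c)) =>
      first [apply: (@def_conn_var G r x y); solve [elt_tac] | apply: (@def_conn G r x y); [|solve [elt_tac]..]]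
  | |- @definable ?G (fun N c => cardle (@?s N c) (@?m N c)) =>
      apply: (@def_cardle G s m); [|solve [elt_tac]]
  | |- @definable ?G (fun N c => card2le (@?s N c) (@?m N c)) =>
      apply: (@def_card2le G s m); [|solve [elt_tac]]
  | |- @definable ?G (fun N c => succ (@?x N c) (@?y N c)) =>
      apply: (@def_succ G x y); solve [elt_tac]
  end.

Ltac def_op ::= count_op.

Lemma def_true G : definable (fun N (c : car G N) => true).
Proof. apply: (def_ext (g := fun N c => ~~ false)) => //; def_all. Qed.

Lemma def_rkle G (F : frel G) (m : fel G) : lam2 G F -> elt_in m ->
  definable (fun N c => rkle (F N c) (m N c)).
Proof.
move=> dF dm; apply: (@def_let shape2 G F (fun N c q => rkle q (m N c))); def_all.
by rewrite /rkle /nonmin; def_all.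
Qed.

Lemma def_clsle G (C : frel G) (X : fset G) (m : fel G) : var2 C -> lam1 G X -> elt_in m ->
  definable (fun N c => clsle (C N c) (X N c) (m N c)).
Proof. by move=> dC dX dm; rewrite /clsle /nonmin; def_all. Qed.

Lemma def_reach G (r : frel G) (A : fset G) (y : fel G) : var2 r -> var1 A -> elt_in y ->
  definable (fun N c => reach (r N c) (A N c) (y N c)).
Proof. by move=> dr dA dy; rewrite /reach; def_all. Qed.

Lemma def_joined G (r : frel G) (A B : fset G) : var2 r -> var1 A -> var1 B ->
  definable (fun N c => joined (r N c) (A N c) (B N c)).
Proof. by move=> dr dA dB; rewrite /joined /reach; def_all. Qed.

Lemma def_joined_del G (q : frel G) (x y : fel G) (A B : fset G) : var2 q -> elt_in x -> elt_in y ->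
  var1 A -> var1 B -> definable (fun N c => joined (del (q N c) (x N c) (y N c)) (A N c) (B N c)).
Proof.
move=> dq dx dy dA dB; apply: (@def_let shape2 G (fun N c => del (q N c) (x N c) (y N c))
  (fun N c r => joined r (A N c) (B N c))); rewrite /del; def_all.
by apply: def_joined; elt_tac.
Qed.

Lemma def_minpath G (A B : fset G) (r : frel G) (x y : fel G) : var1 A -> var1 B -> var2 r ->
  elt_in x -> elt_in y -> definable (fun N c => minpath (A N c) (B N c) (r N c) (x N c) (y N c)).
Proof.
move=> dA dB dr dx dy; apply: (@def_itr shape2 G r
  (fun N c x q => itr q (fun y => prune (A N c) (B N c) x y))
  (fun N c q => q (x N c) (y N c))); def_all.
apply: (@def_itr shape2 (cstep shape2 G) (fun N p => p.1.1.1.1.2)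
  (fun N p y => prune (A N p.1.1.1.1.1) (B N p.1.1.1.1.1) p.1.1.1.2 y)
  (fun N p q => q p.1.2 p.2)); rewrite /prune; def_all.
by apply: def_joined_del; elt_tac.
Qed.

(** Telling the two components of a stored pair apart takes an element 0 and another one. *)
Definition wide (G : ctx) := forall N, car G N -> 1 < N.

Lemma wide_cel G : wide G -> wide (cel G).
Proof. by move=> wG N [c _]; apply: wG c. Qed.

Lemma wide_crel S G : wide G -> wide (crel S G).
Proof. by move=> wG N [c _]; apply: wG c. Qed.

Ltac wide_tac := rewrite /cinit /cstep; repeat first [assumption | apply: wide_cel | apply: wide_crel].

Lemma def_fst G (s : forall N, car G N -> ('I_N -> bool) * ('I_N -> bool)) (x : fel G) : wide G ->
  rel_in (S := shape12) s -> elt_in x -> definable (fun N c => (s N c).1 (x N c)).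
Proof.
move=> wG ds dx; apply: (def_ext (g := fun N c => exb (fun z => isz z && emb (s := shape12) (s N c) z (x N c) (x N c)))).
  move=> N c; apply/idP/exbP => [h|[z /andP[z0]]]; last by move: z0; rewrite iszE /= => ->.
  by exists (Ordinal (ltnW (wG N c))); rewrite iszE.
apply: def_ex; apply: def_and; first by def_all.
by apply: (@def_rel3 shape12 (cel G) (fun N p => s N p.1)); elt_tac.
Qed.

Lemma def_snd G (s : forall N, car G N -> ('I_N -> bool) * ('I_N -> bool)) (x : fel G) : wide G ->
  rel_in (S := shape12) s -> elt_in x -> definable (fun N c => (s N c).2 (x N c)).
Proof.
move=> wG ds dx; apply: (def_ext (g := fun N c => exb (fun z => ~~ isz z && emb (s := shape12) (s N c) z (x N c) (x N c)))).
  move=> N c; apply/idP/exbP => [h|[z /andP[z0]]]; last by move: z0; rewrite iszE /= => /negbTE->.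
  by exists (Ordinal (wG N c)); rewrite iszE.
apply: def_ex; apply: def_and; first by def_all.
by apply: (@def_rel3 shape12 (cel G) (fun N p => s N p.1)); elt_tac.
Qed.

Ltac pair_op := match goal with
  | |- @definable ?G (fun N c => fst (@?s N c) (@?x N c)) =>
      apply: (@def_fst G s x); [solve [wide_tac]|solve [elt_tac]|solve [elt_tac]]
  | |- @definable ?G (fun N c => snd (@?s N c) (@?x N c)) =>
      apply: (@def_snd G s x); [solve [wide_tac]|solve [elt_tac]|solve [elt_tac]]
  end.

Ltac def_op ::= first [count_op | pair_op].

Lemma def_grow G (E C : frel G) (U T : fset G) (bits : frel G) (b x : fel G) : wide G ->
  var2 E -> var2 C -> var1 U -> var1 T -> var2 bits -> elt_in b -> elt_in x ->
  definable (fun N c => grow (E N c) (C N c) (U N c) (T N c) (bits N c (b N c)) (x N c)).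
Proof.
move=> wG dE dC dU dT dbits db dx; apply: (@def_itr shape12 G (fun N c => (fun=> false, fun=> false))
  (fun N c i => gstep (E N c) (C N c) (U N c) (T N c) (bits N c (b N c) i))
  (fun N c s => s.1 (x N c))).
- by cbn [emb shape12]; def_all.
- cbn [emb shape12]; rewrite /gstep /first_cand /cand; def_all.
- by def_all.
Qed.

Lemma def_resid G (E C : frel G) (U : fset G) (f : frel G) (x y : fel G) : var2 E -> var2 C -> var1 U ->
  var2 f -> elt_in x -> elt_in y -> definable (fun N c => resid (E N c) (C N c) (U N c) (f N c) (x N c) (y N c)).
Proof. by move=> *; rewrite /resid; def_all. Qed.

Lemma def_augment G (C f p : frel G) (x y : fel G) : var2 C -> var2 f -> var2 p -> elt_in x -> elt_in y ->
  definable (fun N c => augment (C N c) (f N c) (p N c) (x N c) (y N c)).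
Proof. by move=> *; rewrite /augment; def_all. Qed.

Lemma def_flow_step G (E C : frel G) (U A B : fset G) (f : frel G) (x y : fel G) : var2 E -> var2 C ->
  var1 U -> var1 A -> var1 B -> var2 f -> elt_in x -> elt_in y ->
  definable (fun N c => flow_step (E N c) (C N c) (U N c) (A N c) (B N c) (f N c) (x N c) (y N c)).
Proof.
move=> dE dC dU dA dB df dx dy.
apply: (@def_let shape2 G (fun N c => resid (E N c) (C N c) (U N c) (f N c))
  (fun N c r => if joined r (A N c) (B N c) then augment (C N c) (f N c) (minpath (A N c) (B N c) r) (x N c) (y N c)
                else f N c (x N c) (y N c))); def_all.
  by apply: def_resid; elt_tac.
  by apply: def_joined; elt_tac.
apply: (@def_let shape2 (crel shape2 G) (fun N p => minpath (A N p.1) (B N p.1) p.2)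
  (fun N p q => augment (C N p.1) (f N p.1) q (x N p.1) (y N p.1))); def_all.
  by apply: def_minpath; elt_tac.
by apply: def_augment; elt_tac.
Qed.

Lemma def_sink_side G (E C : frel G) (U A B : fset G) (x : fel G) : var2 E -> var2 C ->
  var1 U -> var1 A -> var1 B -> elt_in x ->
  definable (fun N c => sink_side (E N c) (C N c) (U N c) (A N c) (B N c) (x N c)).
Proof.
move=> dE dC dU dA dB dx.
apply: (@def_itr shape2 G (fun N c _ _ => false)
  (fun N c _ => flow_step (E N c) (C N c) (U N c) (A N c) (B N c))
  (fun N c f => reach (resid (E N c) (C N c) (U N c) f) (A N c) (x N c))); def_all.
  by apply: def_flow_step; elt_tac.
apply: (@def_let shape2 (crel shape2 G) (fun N p => resid (E N p.1) (C N p.1) (U N p.1) p.2)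
  (fun N p r => reach r (A N p.1) (x N p.1))); def_all.
  by apply: def_resid; elt_tac.
by apply: def_reach; elt_tac.
Qed.


Ltac alg_op := match goal with
  | |- @definable ?G (fun N c => clsle (@?C N c) (@?X N c) (@?m N c)) =>
      apply: (@def_clsle G C X m); [solve [elt_tac]| |solve [elt_tac]]
  | |- @definable ?G (fun N c => rkle (@?F N c) (@?m N c)) =>
      apply: (@def_rkle G F m); [|solve [elt_tac]]
  | |- @definable ?G (fun N c => grow (@?E N c) (@?C N c) (@?U N c) (@?T N c) (@?B N c) (@?x N c)) =>
      let bits := constr:(fun N (env : car G N) => ltac:(let b := eval cbv beta in (B N env) in
        match b with ?h _ => exact h end)) in
      let b := constr:(fun N (env : car G N) => ltac:(let b := eval cbv beta in (B N env) in
        match b with _ ?y => exact y end)) in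
      apply: (@def_grow G E C U T bits b x); [solve [wide_tac]|solve [elt_tac]..]
  | |- @definable ?G (fun N c => sink_side (@?E N c) (@?C N c) (@?U N c) (@?A N c) (@?B N c) (@?x N c)) =>
      apply: (@def_sink_side G E C U A B x); solve [elt_tac]
  | |- @definable ?G (fun N c => true) => exact: def_true
  end.

Ltac def_op ::= first [count_op | pair_op | alg_op].

Lemma def_shrink_by G (E C : frel G) (p q q2 : fel G) (U A B : fset G) (x : fel G) : var2 E -> var2 C ->
  elt_in p -> elt_in q -> elt_in q2 -> var1 U -> var1 A -> var1 B -> elt_in x ->
  definable (fun N c => shrink_by (E N c) (C N c) (p N c) (q N c) (q2 N c) (U N c) (A N c) (B N c) (x N c)).
Proof.
move=> dE dC dp dq dq2 dU dA dB dx.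
apply: (@def_let shape1 G (fun N c => sink_side (E N c) (C N c) (U N c) (A N c) (B N c))
  (fun N c Z => U N c (x N c) && (breaks (E N c) (C N c) (p N c) (q N c) (U N c) (A N c) (B N c) Z ==>
    (Z (x N c) == card2le (fun x y => [&& E N c x y, U N c x && Z x & ~~ (U N c y && Z y)]) (q2 N c))))).
  by def_all.
by rewrite /breaks; def_all.
Qed.

(** The operators expect stored sets, so the two singletons and the two grown sets are stored one
    after the other before [def_shrink_by] applies. *)
Lemma def_shrink1 G (E C bits : frel G) (p q q2 v b1 u b2 : fel G) (U : fset G) (x : fel G) : wide G ->
  var2 E -> var2 C -> var2 bits -> elt_in p -> elt_in q -> elt_in q2 -> elt_in v -> elt_in b1 ->
  elt_in u -> elt_in b2 -> var1 U -> elt_in x ->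
  definable (fun N c => shrink1 (E N c) (C N c) (bits N c) (p N c) (q N c) (q2 N c)
    (v N c) (b1 N c) (u N c) (b2 N c) (U N c) (x N c)).
Proof.
move=> wG dE dC dbits dp dq dq2 dv db1 du db2 dU dx.
apply: (@def_let shape1 G (fun N c x => x == v N c) (fun N c T => shrink_by (E N c) (C N c) (p N c) (q N c) (q2 N c)
  (U N c) (grow (E N c) (C N c) (U N c) T (bits N c (b1 N c)))
  (grow (E N c) (C N c) (U N c) (fun x => x == u N c) (bits N c (b2 N c))) (x N c))); first by def_all.
apply: (@def_let shape1 (crel shape1 G) (fun N c x => x == u N c.1) (fun N c T' => shrink_by (E N c.1) (C N c.1)
  (p N c.1) (q N c.1) (q2 N c.1) (U N c.1) (grow (E N c.1) (C N c.1) (U N c.1) c.2 (bits N c.1 (b1 N c.1)))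
  (grow (E N c.1) (C N c.1) (U N c.1) T' (bits N c.1 (b2 N c.1))) (x N c.1))); first by def_all.
apply: (@def_let shape1 (crel shape1 (crel shape1 G)) (fun N c => grow (E N c.1.1) (C N c.1.1) (U N c.1.1) c.1.2 (bits N c.1.1 (b1 N c.1.1)))
  (fun N c A => shrink_by (E N c.1.1) (C N c.1.1) (p N c.1.1) (q N c.1.1) (q2 N c.1.1) (U N c.1.1) A
  (grow (E N c.1.1) (C N c.1.1) (U N c.1.1) c.2 (bits N c.1.1 (b2 N c.1.1))) (x N c.1.1))); first by def_all.
apply: (@def_let shape1 (crel shape1 (crel shape1 (crel shape1 G))) (fun N c => grow (E N c.1.1.1) (C N c.1.1.1) (U N c.1.1.1) c.1.2 (bits N c.1.1.1 (b2 N c.1.1.1)))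
  (fun N c B => shrink_by (E N c.1.1.1) (C N c.1.1.1) (p N c.1.1.1) (q N c.1.1.1) (q2 N c.1.1.1) (U N c.1.1.1)
     c.2 B (x N c.1.1.1))); first by def_all.
by apply: def_shrink_by; elt_tac.
Qed.

(** The four nested loops of a pass are treated one per lemma, from the innermost outwards, each
    loop index becoming an element of the context. *)
Lemma def_shrink_loop4 G (E C bits : frel G) (p q q2 v b1 u : fel G) (U : fset G) (x : fel G) : wide G ->
  var2 E -> var2 C -> var2 bits -> elt_in p -> elt_in q -> elt_in q2 -> elt_in v -> elt_in b1 -> elt_in u -> var1 U -> elt_in x ->
  definable (fun N c => itr (U N c) (fun b2 => shrink1 (E N c) (C N c) (bits N c) (p N c) (q N c) (q2 N c) (v N c) (b1 N c) (u N c) b2) (x N c)).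
Proof.
move=> *; apply: (@def_itr shape1 G U (fun N c => fun b2 => shrink1 (E N c) (C N c) (bits N c) (p N c) (q N c) (q2 N c) (v N c) (b1 N c) (u N c) b2) (fun N c U => U (x N c))); [by def_all| |by def_all].
by cbn [emb shape1 fst snd]; apply: def_shrink1; first [solve [wide_tac]|elt_tac].
Qed.

Lemma def_shrink_loop3 G (E C bits : frel G) (p q q2 v b1 : fel G) (U : fset G) (x : fel G) : wide G ->
  var2 E -> var2 C -> var2 bits -> elt_in p -> elt_in q -> elt_in q2 -> elt_in v -> elt_in b1 -> var1 U -> elt_in x ->
  definable (fun N c => itr (U N c) (fun u U => itr U (fun b2 => shrink1 (E N c) (C N c) (bits N c) (p N c) (q N c) (q2 N c) (v N c) (b1 N c) u b2)) (x N c)).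
Proof.
move=> *; apply: (@def_itr shape1 G U (fun N c => fun u U => itr U (fun b2 => shrink1 (E N c) (C N c) (bits N c) (p N c) (q N c) (q2 N c) (v N c) (b1 N c) u b2)) (fun N c U => U (x N c))); [by def_all| |by def_all].
by cbn [emb shape1 fst snd]; apply: def_shrink_loop4; first [solve [wide_tac]|elt_tac].
Qed.

Lemma def_shrink_loop2 G (E C bits : frel G) (p q q2 v : fel G) (U : fset G) (x : fel G) : wide G ->
  var2 E -> var2 C -> var2 bits -> elt_in p -> elt_in q -> elt_in q2 -> elt_in v -> var1 U -> elt_in x ->
  definable (fun N c => itr (U N c) (fun b1 U => itr U (fun u U => itr U (fun b2 => shrink1 (E N c) (C N c) (bits N c) (p N c) (q N c) (q2 N c) (v N c) b1 u b2))) (x N c)).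
Proof.
move=> *; apply: (@def_itr shape1 G U (fun N c => fun b1 U => itr U (fun u U => itr U (fun b2 => shrink1 (E N c) (C N c) (bits N c) (p N c) (q N c) (q2 N c) (v N c) b1 u b2))) (fun N c U => U (x N c))); [by def_all| |by def_all].
by cbn [emb shape1 fst snd]; apply: def_shrink_loop3; first [solve [wide_tac]|elt_tac].
Qed.

Lemma def_shrink_pass G (E C bits : frel G) (p q q2 : fel G) (U : fset G) (x : fel G) : wide G ->
  var2 E -> var2 C -> var2 bits -> elt_in p -> elt_in q -> elt_in q2 -> var1 U -> elt_in x ->
  definable (fun N c => shrink_pass (E N c) (C N c) (bits N c) (p N c) (q N c) (q2 N c) (U N c) (x N c)).
Proof.
move=> *; apply: (@def_itr shape1 G U (fun N c => fun v U => itr U (fun b1 U => itr U (fun u U => itr U (fun b2 => shrink1 (E N c) (C N c) (bits N c) (p N c) (q N c) (q2 N c) v b1 u b2)))) (fun N c U => U (x N c))); [by def_all| |by def_all].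
by cbn [emb shape1 fst snd]; apply: def_shrink_loop2; first [solve [wide_tac]|elt_tac].
Qed.

Lemma def_shrink G (E C bits : frel G) (p q q2 : fel G) (x : fel G) : wide G ->
  var2 E -> var2 C -> var2 bits -> elt_in p -> elt_in q -> elt_in q2 -> elt_in x ->
  definable (fun N c => shrink (E N c) (C N c) (bits N c) (p N c) (q N c) (q2 N c) (x N c)).
Proof.
move=> *; apply: (@def_itr shape1 G (fun N c _ => true)
  (fun N c _ => shrink_pass (E N c) (C N c) (bits N c) (p N c) (q N c) (q2 N c))
  (fun N c U => U (x N c))); [by def_all| |by def_all].
by cbn [emb shape1 fst snd]; apply: def_shrink_pass; first [solve [wide_tac]|elt_tac].
Qed.

Lemma def_kept G (E : frel G) (c U : fset G) (W : frel G) (k b : fel G) : var2 E -> var1 c -> var1 U ->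
  var2 W -> elt_in k -> elt_in b ->
  definable (fun N d => kept (E N d) (c N d) (U N d) (W N d) (k N d) (b N d)).
Proof. by move=> *; rewrite /kept /same /inner /bd /monochr /flip; def_all. Qed.

Lemma def_coarsen G (E : frel G) (c : fset G) (C : frel G) (U : fset G) (W : frel G) (k P x y : fel G) :
  var2 E -> var1 c -> var2 C -> var1 U -> var2 W -> elt_in k -> elt_in P -> elt_in x -> elt_in y ->
  definable (fun N d => coarsen (E N d) (c N d) (C N d) (U N d) (W N d) (k N d) (P N d) (x N d) (y N d)).
Proof.
move=> *; apply: (@def_let shape1 G (fun N d => kept (E N d) (c N d) (U N d) (W N d) (k N d))
  (fun N d K => C N d (x N d) (y N d) || [&& ~~ clsle (C N d) (fun=> true) (P N d), U N d (x N d), U N d (y N d) &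
    allb (fun b => K b ==> (W N d b (x N d) == W N d b (y N d)))])); last by def_all.
by cbn [emb shape1]; apply: def_kept; elt_tac.
Qed.

Lemma def_terminals G (E : frel G) (c U : fset G) (x : fel G) : var2 E -> var1 c -> var1 U -> elt_in x ->
  definable (fun N d => terminals (E N d) (c N d) (U N d) (x N d)).
Proof. by move=> *; rewrite /terminals; def_all. Qed.

Lemma def_guess G (E : frel G) (c : fset G) (C : frel G) (U : fset G) (bits : frel G) (b x : fel G) : wide G ->
  var2 E -> var1 c -> var2 C -> var1 U -> var2 bits -> elt_in b -> elt_in x ->
  definable (fun N d => guess (E N d) (c N d) (C N d) (U N d) (bits N d) (b N d) (x N d)).
Proof.
move=> *; apply: (@def_let shape1 G (fun N d => terminals (E N d) (c N d) (U N d))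
  (fun N d T => grow (E N d) (C N d) (U N d) T (bits N d (b N d)) (x N d))); last by def_all.
by cbn [emb shape1]; apply: def_terminals; elt_tac.
Qed.

Lemma def_coarsen_step G (E : frel G) (c : fset G) (bits : frel G) (k Q Q2 P : fel G) (C : frel G) (x y : fel G) :
  wide G -> var2 E -> var1 c -> var2 bits -> elt_in k -> elt_in Q -> elt_in Q2 -> elt_in P -> var2 C ->
  elt_in x -> elt_in y ->
  definable (fun N d => coarsen_step (E N d) (c N d) (bits N d) (k N d) (Q N d) (Q2 N d) (P N d) (C N d) (x N d) (y N d)).
Proof.
move=> *; apply: (@def_let shape1 G (fun N d => shrink (E N d) (C N d) (bits N d) (P N d) (Q N d) (Q2 N d))
  (fun N d U => coarsen (E N d) (c N d) (C N d) U (guess (E N d) (c N d) (C N d) U (bits N d)) (k N d) (P N d) (x N d) (y N d))).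
  by cbn [emb shape1]; apply: def_shrink; first [solve [wide_tac]|elt_tac].
apply: (@def_let shape2 (crel shape1 G)
  (fun N d => guess (E N d.1) (c N d.1) (C N d.1) d.2 (bits N d.1))
  (fun N d W => coarsen (E N d.1) (c N d.1) (C N d.1) d.2 W (k N d.1) (P N d.1) (x N d.1) (y N d.1))).
  by cbn [emb shape2]; apply: def_guess; first [solve [wide_tac]|elt_tac].
by apply: def_coarsen; elt_tac.
Qed.

Lemma def_coarsen_all G (E : frel G) (c : fset G) (bits : frel G) (k Q Q2 P x y : fel G) :
  wide G -> var2 E -> var1 c -> var2 bits -> elt_in k -> elt_in Q -> elt_in Q2 -> elt_in P ->
  elt_in x -> elt_in y ->
  definable (fun N d => coarsen_all (E N d) (c N d) (bits N d) (k N d) (Q N d) (Q2 N d) (P N d) (x N d) (y N d)).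
Proof.
move=> *; apply: (@def_itr shape2 G (fun N d x y => x == y)
  (fun N d _ => coarsen_step (E N d) (c N d) (bits N d) (k N d) (Q N d) (Q2 N d) (P N d))
  (fun N d C => C (x N d) (y N d))); [by def_all| |by def_all].
by cbn [emb shape2]; apply: def_coarsen_step; first [solve [wide_tac]|elt_tac].
Qed.

Lemma def_recolor G (E : frel G) (c : fset G) (W : frel G) (k x : fel G) : var2 E -> var1 c -> var2 W ->
  elt_in k -> elt_in x -> definable (fun N d => recolor (E N d) (c N d) (W N d) (k N d) (x N d)).
Proof.
move=> *; apply: (@def_let shape1 G (fun N d => fits (E N d) (c N d) (W N d) (k N d))
  (fun N d F => c N d (x N d) (+) exb (fun b => [&& W N d b (x N d), F b &
    ~~ exb (fun b' : 'I_N => (b' < b) && F b')]))); last by def_all.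
by rewrite /fits /monochr /flip; def_all.
Qed.

Lemma def_compress G (E bits : frel G) (k Q Q2 P : fel G) (c : fset G) (x : fel G) :
  wide G -> var2 E -> var2 bits -> elt_in k -> elt_in Q -> elt_in Q2 -> elt_in P -> var1 c -> elt_in x ->
  definable (fun N d => compress (E N d) (bits N d) (k N d) (Q N d) (Q2 N d) (P N d) (c N d) (x N d)).
Proof.
move=> *; apply: (@def_let shape1 G (fun N d _ => true)
  (fun N d V => recolor (E N d) (c N d) (guess (E N d) (c N d)
    (coarsen_all (E N d) (c N d) (bits N d) (k N d) (Q N d) (Q2 N d) (P N d)) V (bits N d)) (k N d) (x N d))); first by def_all.
apply: (@def_let shape2 (crel shape1 G)
  (fun N d => coarsen_all (E N d.1) (c N d.1) (bits N d.1) (k N d.1) (Q N d.1) (Q2 N d.1) (P N d.1))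
  (fun N d C => recolor (E N d.1) (c N d.1) (guess (E N d.1) (c N d.1) C d.2 (bits N d.1)) (k N d.1) (x N d.1))).
  by cbn [emb shape2]; apply: def_coarsen_all; first [solve [wide_tac]|elt_tac].
apply: (@def_let shape2 (crel shape2 (crel shape1 G))
  (fun N d => guess (E N d.1.1) (c N d.1.1) d.2 d.1.2 (bits N d.1.1))
  (fun N d W => recolor (E N d.1.1) (c N d.1.1) W (k N d.1.1) (x N d.1.1))).
  by cbn [emb shape2]; apply: def_guess; first [solve [wide_tac]|elt_tac].
by apply: def_recolor; elt_tac.
Qed.

Lemma def_compress_upto G (E bits : frel G) (k Q Q2 P a b : fel G) (c : fset G) (x : fel G) :
  wide G -> var2 E -> var2 bits -> elt_in k -> elt_in Q -> elt_in Q2 -> elt_in P -> elt_in a -> elt_in b ->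
  var1 c -> elt_in x ->
  definable (fun N d => compress (upto (E N d) (a N d) (b N d)) (bits N d) (k N d) (Q N d) (Q2 N d) (P N d) (c N d) (x N d)).
Proof.
move=> *; apply: (@def_let shape2 G (fun N d => upto (E N d) (a N d) (b N d))
  (fun N d F => compress F (bits N d) (k N d) (Q N d) (Q2 N d) (P N d) (c N d) (x N d))).
  by rewrite /upto /before; def_all.
by apply: def_compress; first [solve [wide_tac]|elt_tac].
Qed.

Lemma def_solve G (E bits : frel G) (k Q Q2 P x : fel G) :
  wide G -> var2 E -> var2 bits -> elt_in k -> elt_in Q -> elt_in Q2 -> elt_in P -> elt_in x ->
  definable (fun N d => solve (E N d) (bits N d) (k N d) (Q N d) (Q2 N d) (P N d) (x N d)).
Proof.
move=> *; apply: (@def_itr shape1 G (fun N d _ => false)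
  (fun N d a c => itr c (fun b => compress (upto (E N d) a b) (bits N d) (k N d) (Q N d) (Q2 N d) (P N d)))
  (fun N d c => c (x N d))); [by def_all| |by def_all].
cbn [emb shape1]; apply: (@def_itr shape1 (cstep shape1 G) (fun N p => p.1.1.1.1.2)
  (fun N p b => compress (upto (E N p.1.1.1.1.1) p.1.1.1.2 b) (bits N p.1.1.1.1.1) (k N p.1.1.1.1.1)
    (Q N p.1.1.1.1.1) (Q2 N p.1.1.1.1.1) (P N p.1.1.1.1.1)) (fun N p c => c p.2)); [by def_all| |by def_all].
by cbn [emb shape1 fst snd]; apply: def_compress_upto; first [solve [wide_tac]|elt_tac].
Qed.

Lemma def_bit_table G (b x : fel G) : elt_in b -> elt_in x ->
  definable (fun N d => bit_table (b N d) (x N d)).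
Proof.
move=> *; apply: (@def_itr shape2 G (fun N d _ _ => false) (fun N d i q (b j : 'I_N) =>
  if succ i b then q i j (+) allb (fun l : 'I_N => (l < j) ==> q i l) else q b j)
  (fun N d q => q (b N d) (x N d))); [by def_all| |by def_all].
by rewrite /succ; def_all.
Qed.

(** * The formula, its constants and the running time *)

Program Definition shape3 : shape := {|
  sort := rel3;
  emb := fun N s => s;
  bot := fun N _ _ _ => false |}.

(** The bound [1 < N] is part of the carrier, which makes the context [wide]: definability is asked
    only for universes in which pairs can be stored. *)
Definition input : ctx := {|
  car := fun N => {p : (nat -> rel3 N) * (nat -> 'I_N) | 1 < N};
  rels := fun N c => (sval c).1;
  elts := fun N c => (sval c).2;
  nd := 1;
  nv := 4 |}.

Definition input_graph N (c : car input N) (x y : 'I_N) : bool :=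
  exb (fun z => isz z && rels c 0 z x y).

Definition accepts N (c : car input N) : bool :=
  rkle (monochr (input_graph c) (solve (input_graph c) (@bit_table N)
    (elts c 0) (elts c 1) (elts c 2) (elts c 3))) (elts c 0).

Lemma def_accepts : definable accepts.
Proof.
have w0 : wide input by move=> N [].
have de j : j < 4 -> elt_in (G := input) (fun N c => elts c j) by exists j.
have d0 := de 0 isT; have d1 := de 1 isT; have d2 := de 2 isT; have d3 := de 3 isT.
apply: (@def_let shape2 input input_graph (fun N c E => rkle (monochr E (solve E (@bit_table N)
    (elts c 0) (elts c 1) (elts c 2) (elts c 3))) (elts c 0))).
  cbn [emb shape2]; rewrite /input_graph; apply: def_ex; apply: def_and; first by def_all.
  have dr : rel_in (S := shape3) (G := input) (fun N c => rels c 0) by exists 0.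
  by apply: (@def_rel3 shape3 (cel (cinit shape2 input)) (fun N p => rels p.1.1.1.1.1 0)); elt_tac.
apply: (@def_let shape2 (crel shape2 input) (fun N _ => @bit_table N) (fun N p bits =>
  rkle (monochr p.2 (solve p.2 bits
    (elts p.1 0) (elts p.1 1) (elts p.1 2) (elts p.1 3))) (elts p.1 0))).
  by cbn [emb shape2]; apply: def_bit_table; elt_tac.
apply: (@def_let shape1 (crel shape2 (crel shape2 input))
  (fun N p => solve p.1.2 p.2 (elts p.1.1 0) (elts p.1.1 1) (elts p.1.1 2) (elts p.1.1 3))
  (fun N p col => rkle (monochr p.1.2 col) (elts p.1.1 0))).
  by cbn [emb shape1]; apply: def_solve; first [solve [wide_tac]|elt_tac].
by rewrite /monochr; def_all.
Qed.

(** One more exponential absorbs a square, which is [quad]. Of the three levels from [Q] to [P], two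
    are the exponentials in the number of membership patterns, and the third covers the quadratic
    exponent. *)
Lemma tower_bounds k (Q := tow k 1) (P := tow k 4) :
  [/\ 8 * k.+1 ^ 2 <= Q, 2 ^ (2 ^ (Q + Q) * (2 ^ (Q + Q) ^ 2 * k.+1)) <= P &
      (Q + Q + 2 * k.+1) * P.+1 + Q < tow k 5].
Proof.
have exp2_lt j : j < 2 ^ j by apply: ltn_expl.
have exp2_ge a j : a <= j -> 2 ^ a <= 2 ^ j by move=> le; rewrite leq_exp2l.
have sq k' : k'.+1 ^ 2 <= 8 * 2 ^ k'.
  elim: k' => // j IH; have := exp2_lt j; move: IH; rewrite -!mulnn expnS; move: (2 ^ j) => m; lia.
have lin j : 6 <= j -> 4 + 2 * j <= 2 ^ j.
  by elim: j => // j IH; rewrite leq_eqVlt => /orP[/eqP<- //|/IH]; rewrite expnS; lia.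
have quad R : 6 <= R -> 16 * (2 ^ R) ^ 2 <= 2 ^ 2 ^ R.
  move=> /lin le; rewrite -[16]/(2 ^ 4) -expnM -expnD; apply: (exp2_ge); lia.
have QE : Q = 2 ^ (k + 6) by [].
have leQ : 8 * k.+1 ^ 2 <= Q.
  by rewrite QE expnD; have := sq k; move: (2 ^ k) (k.+1 ^ 2) => a b; lia.
have ltkQ : k.+1 < Q by move: leQ; rewrite -mulnn; nia.
split=> //.
  rewrite /P /=; apply: (exp2_ge); rewrite -[X in _ <= X]/(2 ^ 2 ^ Q) mulnA -expnD.
  apply: (@leq_trans (2 ^ (Q + Q + (Q + Q) ^ 2) * 2 ^ k.+1)); first by rewrite leq_mul2l orbC ltnW.
  rewrite -expnD; apply: (exp2_ge); apply: leq_trans ((quad) (k + 6) _); last by rewrite leq_addl.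
  by rewrite -QE -!mulnn; nia.
have leP : 16 * P ^ 2 <= tow k 5.
  by apply: (quad); rewrite -[6]/(0 + 6); apply: leq_trans (@tow_le k 0 3 isT); rewrite /= leq_addl.
have leQP : Q <= P by apply: tow_le.
apply: leq_trans leP; rewrite -mulnn; nia.
Qed.

Lemma run_mono m (M : TM m) t t' cf cf' : t <= t' -> run M t cf = Some cf' -> run M t' cf = Some cf'.
Proof.
elim: t t' cf => [|t IH] [|t'] cf //=; case: (step M cf) => // cf1 le; exact: IH.
Qed.

Theorem theorem4 : BipartiteContraction_FPT.
Proof.
have [phi wf_phi sem_phi] := def_accepts.
have [m [M [K [c run_M]]]] := formula_machine wf_phi.
(* The parameter and the size separate because [N.+2 <= (tow k 6 + 2) * n.+1], raised to the power
   [c]. *)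
exists m, M, (fun k => K * (tow k 6 + 2) ^ c), c => n e k sg; have [symE irrE] := sg.
set N := tow k 6 + n; have [leQ leP ltL] := tower_bounds k.
have lt_N i : i < 6 -> tow k i < N.
  move=> lt; apply: leq_trans (leq_addr _ _); apply: leq_trans (tow_ltS k i) (tow_le k lt).
have lt_k : k < N by apply: leq_ltn_trans (lt_N 0 isT); rewrite /= leq_addr.
have lt_1 : 1 < N by apply: leq_ltn_trans (lt_N 0 isT); rewrite /= addnS.
have lt_Q2 : 2 * tow k 1 < N by apply: leq_ltn_trans (lt_N 5 isT); move: ltL; rewrite mulnS; lia.
pose eta j : 'I_N := match j with 0 => Ordinal lt_k | 1 => Ordinal (lt_N 1 isT)
  | 2 => Ordinal lt_Q2 | _ => Ordinal (lt_N 4 isT) end.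
pose rho (q t x y : nat) := (t == 0) && extrel e x y.
have [//|//|cf run_cf acc_cf] := run_M n e k rho eta.
exists cf; split.
  apply: run_mono run_cf; rewrite -mulnA -expnMn; apply: leq_mul => //.
  have le : N.+2 <= (tow k 6 + 2) * n.+1 by rewrite /N; nia.
  by case: (c) => // c'; rewrite leq_exp2r.
pose inp : car input N := exist _ ((fun q (t x y : 'I_N) => rho q t x y), eta) lt_1.
have -> : accepting M (cfg_state cf) = accepts inp by rewrite acc_cf (sem_phi N inp).
have le_n : n <= N by apply: leq_addl.
have graphE : input_graph inp = extgraph (N := N) e.
  do 2!apply: functional_extensionality => ?; apply/exbP/idP => [[z /andP[_ /andP[]]] //|exy].
  by exists (Ordinal (ltnW lt_1)); rewrite iszE /=; exact: exy.
rewrite /accepts graphE rkleE (contraction_coloring k sg) (coloring_ext e le_n).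
apply: iff_sym; apply: (@solveP N (extgraph (N := N) e) (eta 0) (eta 1) (eta 2) (eta 3) (tow k 5)
  (extgraph_sym le_n symE) (extgraph_irr le_n irrE)) => //=.
- by rewrite mul2n addnn.
- by rewrite mul2n -addnn.
- by rewrite mul2n -addnn.
- exact: leq_addr.
Qed.
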